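(* Let $n\ge 1$. Let $\mathcal{H}$ and $\widetilde{\mathcal{H}}$ be the operators on $L^2(\mathbb{R}^n)$ defined by $$\mathrm{Dom}\,\mathcal{H}=\Big\{f\in L^2(\mathbb{R}^n)\colon \sum_{\alpha\in\mathbb{N}^n}|\lambda_\alpha\langle f,h_\alpha\rangle|^2<\infty\Big\},\qquad \mathcal{H}f=\sum_{\alpha\in\mathbb{N}^n}\lambda_\alpha\langle f,h_\alpha\rangle h_\alpha,$$ with $\lambda_\alpha=n+2|\alpha|$, and $$\mathrm{Dom}\,\widetilde{\mathcal{H}}=\Big\{f\in L^2(\mathbb{R}^n)\colon \sum_{k,s,j}|\lambda_{k,s}\langle f,\phi_{k,s,j}\rangle|^2<\infty\Big\},\qquad \widetilde{\mathcal{H}}f=\sum_{k,s,j}\lambda_{k,s}\langle f,\phi_{k,s,j}\rangle\phi_{k,s,j},$$ with $\lambda_{k,s}=n+2(s+2k)$. Then $\widetilde{\mathcal{H}}=\mathcal{H}$, i.e. $\mathrm{Dom}\,\widetilde{\mathcal{H}}=\mathrm{Dom}\,\mathcal{H}$ and $\widetilde{\mathcal{H}}f=\mathcal{H}f$ for every $f$ in this common domain.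
   Context: $\mathbb{N}=\{0,1,2,\ldots\}$; $L^2(\mathbb{R}^n)$ is the complex Hilbert space with respect to Lebesgue measure, with inner product $\langle f,g\rangle=\int_{\mathbb{R}^n} f\overline{g}\,dx$. Hermite functions: for $k\in\mathbb{N}$, $h_k(t)=(2^k k!\sqrt{\pi})^{-1/2}H_k(t)e^{-t^2/2}$, $t\in\mathbb{R}$, where $H_k$ is the (physicists') Hermite polynomial of degree $k$. For $\alpha=(\alpha_1,\ldots,\alpha_n)\in\mathbb{N}^n$, $|\alpha|=\alpha_1+\cdots+\alpha_n$ and $h_\alpha(x)=\prod_{i=1}^n h_{\alpha_i}(x_i)$; the $h_\alpha$ form an orthonormal basis of $L^2(\mathbb{R}^n)$. Laguerre functions of order $\beta>-1$: $\ell_k^\beta(r)=\Big(\frac{2\Gamma(k+1)}{\Gamma(k+\beta+1)}\Big)^{1/2}L_k^\beta(r^2)e^{-r^2/2}$, $k\in\mathbb{N}$, $r>0$, where $L_k^\beta(t)=\frac{1}{k!}e^t t^{-\beta}\frac{d^k}{dt^k}(e^{-t}t^{k+\beta})$ is the Laguerre polynomial of degree $k$ and order $\beta$. Solid harmonics: $H_{(s)}$ is the (complex) space of harmonic polynomials on $\mathbb{R}^n$ homogeneous of degree $s$, and $d_s=\dim H_{(s)}$. For each $s$, $\{Y_{s,j}\}_{j=1}^{d_s}$ is a fixed basis of $H_{(s)}$ whose restrictions to the unit sphere $\Sigma_{n-1}=\{|x|=1\}$ are orthonormal in $L^2(\Sigma_{n-1},\sigma_{n-1})$, where $\sigma_{n-1}$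 is surface measure (for $n=1$, $\Sigma_0=\{-1,1\}$ with counting measure). Set $\phi_{k,s,j}(x)=\ell_k^{\frac n2-1+s}(|x|)\,Y_{s,j}(x)$ for $k\in\mathbb{N}$, $s\in\mathbb{N}$, $1\le j\le d_s$; if $n=1$, then $s$ ranges only over $\{0,1\}$. The system $\{\phi_{k,s,j}\}$ is an orthonormal basis of $L^2(\mathbb{R}^n)$. Sums over $k,s,j$ run over all admissible indices. *)

(* Defs.v *)
From HB Require Import structures.
From mathcomp Require Import all_boot all_order all_algebra finmap.
From mathcomp Require Import complex.
From mathcomp Require Import all_classical all_reals all_analysis.
From mathcomp Require Import measurable_realfun.
From mathcomp Require mpoly.
Import (canonicals, coercions) mpoly.

Set Implicit Arguments.
Unset Strict Implicit.
Unset Printing Implicit Defensive.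

Import Order.TTheory GRing.Theory Num.Theory.
Import numFieldNormedType.Exports.

Local Open Scope classical_set_scope.
Local Open Scope ring_scope.
Local Open Scope complex_scope.

(* R^n with its Borel sigma-algebra.  Restricting to Borel functions does not
   change L^2: a Lebesgue measurable function equals a Borel one almost
   everywhere. *)
Notation Rn R n := (n.-tuple (measurableTypeR R)).

Section RnCons.
Context {R : realType} {n : nat}.

Definition Rn_cons (p : measurableTypeR R * Rn R n) : Rn R n.+1 :=
  [the n.+1.-tuple _ of p.1 :: p.2].

Lemma measurable_Rn_cons : measurable_fun [set: _] Rn_cons.
Proof. by apply: measurable_cons; [exact: measurable_fst|exact: measurable_snd]. Qed.

Variable m : {sigma_finite_measure set (Rn R n) -> \bar R}.

Definition lebesgue_cons : set (Rn R n.+1) -> \bar R :=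
  pushforward (@lebesgue_measure R \x m)%E Rn_cons.

Let lebesgue_cons0 : lebesgue_cons set0 = 0%E.
Proof. by rewrite /lebesgue_cons /pushforward preimage_set0 measure0. Qed.

Let lebesgue_cons_ge0 A : (0 <= lebesgue_cons A)%E.
Proof. exact: (measure_ge0 (lebesgue_measure \x m)%E). Qed.

Let lebesgue_cons_sigma_additive : semi_sigma_additive lebesgue_cons.
Proof.
exact: (@measure_semi_sigma_additive _ _ _
  (measure_function_pushforward__canonical__measure_function_Measure _
    measurable_Rn_cons)).
Qed.

HB.instance Definition _ := isMeasure.Build _ _ _ lebesgue_cons
  lebesgue_cons0 lebesgue_cons_ge0 lebesgue_cons_sigma_additive.

Let lebesgue_cons_sigma_finite : sigma_finite [set: _] lebesgue_cons.
Proof.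
have /sigma_finiteP[F [FT ndF Foo]] := sigma_finiteT (@lebesgue_measure R).
have /sigma_finiteP[G [GT ndG Goo]] := sigma_finiteT m.
pose g (x : Rn R n.+1) := (thead x, [tuple of behead x] : Rn R n).
have mg : measurable_fun [set: _] g.
  apply/measurable_fun_pairP; split; first exact: measurable_tnth.
  exact: measurable_behead.
have gK : cancel Rn_cons g.
  by case=> a x; rewrite /g; congr pair; apply/val_inj.
exists (fun k => g @^-1` (F k `*` G k)).
  rewrite -preimage_bigcup predeqE => x; split=> // _.
  have [i _ Fi] : (\bigcup_k F k) (g x).1 by rewrite -FT.
  have [j _ Gj] : (\bigcup_k G k) (g x).2 by rewrite -GT.
  exists (maxn i j) => //; split.
    by move: (_.1) Fi; exact/subsetPset/ndF/leq_maxl.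
  by move: (_.2) Gj; exact/subsetPset/ndG/leq_maxr.
move=> k; have [mF Fk] := Foo k; have [mG Gk] := Goo k; split.
  by rewrite -[X in measurable X]setTI; apply: mg => //; exact: measurableX.
rewrite /lebesgue_cons /pushforward -comp_preimage.
rewrite (_ : g \o Rn_cons = id); last by apply/funext => p; exact: gK.
rewrite [X in (X < _)%E](product_measure1E (@lebesgue_measure R) m) //.
by rewrite lte_mul_pinfty// ge0_fin_numE.
Qed.

HB.instance Definition _ :=
  @Measure_isSigmaFinite.Build _ _ _ lebesgue_cons lebesgue_cons_sigma_finite.

End RnCons.

(* Lebesgue measure on the Borel sets of R^n, as an iterated product measure. *)
Fixpoint lebesgue_Rn (R : realType) (n : nat) :
    {sigma_finite_measure set (Rn R n) -> \bar R} :=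
  match n with
  | 0 => \d_([tuple] : Rn R 0)
  | n'.+1 => lebesgue_cons (lebesgue_Rn R n')
  end.

Section Sphere.
Context {R : realType} {n : nat}.

Definition enorm (x : Rn R n) : R := Num.sqrt (\sum_(i < n) tnth x i ^+ 2).

Definition normalize (x : Rn R n) : Rn R n :=
  [tuple tnth x i / enorm x | i < n].

Lemma measurable_enorm : measurable_fun [set: _] enorm.
Proof.
rewrite (_ : enorm = (@powR R ^~ 2^-1) \o
    (fun x : Rn R n => \sum_(i < n) tnth x i ^+ 2)); last first.
  by apply/funext => x /=; rewrite powR12_sqrt// sumr_ge0// => i _; exact: sqr_ge0.
apply: measurableT_comp; first exact: measurable_powR.
apply: measurable_sum => i; apply: measurable_funX; exact: measurable_tnth.
Qed.

Lemma measurable_normalize : measurable_fun [set: _] normalize.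
Proof.
apply/measurable_fun_tnthP => i.
rewrite (_ : _ \o _ = (tnth (T:=measurableTypeR R))^~ i \*
    ((@powR R ^~ (-1)) \o enorm)); last first.
  by apply/funext => x /=; rewrite tnth_mktuple powR_inv1// sqrtr_ge0.
apply: measurable_funM; first exact: measurable_tnth.
by apply: measurableT_comp; [exact: measurable_powR|exact: measurable_enorm].
Qed.

(* Surface measure on the unit sphere, extended by 0 to R^n: n times the
   Lebesgue measure of the cone {r u | 0 < r <= 1, u \in A, |u| = 1}.  For n = 1
   this is the counting measure on {-1, 1}. *)
Definition surface_measure (A : set (Rn R n)) : \bar R :=
  (n%:R%:E *
   lebesgue_Rn R n [set x | (0 < enorm x <= 1)%R /\ A (normalize x)])%E.

Let cone_base : set (Rn R n) := [set x | (0 < enorm x <= 1)%R].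

Let measurable_cone_base : measurable cone_base.
Proof.
rewrite (_ : cone_base = enorm @^-1` `]0, 1]%classic).
  by rewrite -[X in measurable X]setTI; exact: measurable_enorm.
by apply/seteqP; split=> x /=; rewrite in_itv.
Qed.

Let surface_measureE : surface_measure = mscale n%:R%:nng
  (measure_function_pushforward__canonical__measure_function_Measure
    (mrestr (lebesgue_Rn R n) measurable_cone_base) measurable_normalize).
Proof.
by apply/funext => A; congr (_ * _)%E; congr (lebesgue_Rn R n _); exact: setIC.
Qed.

Let surface_measure0 : surface_measure set0 = 0%E.
Proof. by rewrite surface_measureE measure0. Qed.

Let surface_measure_ge0 A : (0 <= surface_measure A)%E.
Proof. by rewrite surface_measureE measure_ge0. Qed.

Let surface_measure_sigma_additive : semi_sigma_additive surface_measure.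
Proof. by rewrite surface_measureE; exact: measure_semi_sigma_additive. Qed.

HB.instance Definition _ := isMeasure.Build _ _ _ surface_measure
  surface_measure0 surface_measure_ge0 surface_measure_sigma_additive.

End Sphere.

Section ComplexL2.
Context {R : realType} {d : measure_display} {T : measurableType d}.
Variable mu : {measure set T -> \bar R}.

Definition Cintegral (f : T -> R[i]) : R[i] :=
  (\int[mu]_x complex.Re (f x)) +i* (\int[mu]_x complex.Im (f x)).

Definition inner (f g : T -> R[i]) : R[i] :=
  Cintegral (fun x => f x * (g x)^*).

Definition L2norm (f : T -> R[i]) : \bar R :=
  Lnorm mu 2%:E (fun x => (Normc.normc (f x))%:E).

(* Representatives of the elements of the complex Hilbert space L^2(mu). *)
Definition L2 : set (T -> R[i]) :=
  [set f | [/\ measurable_fun [set: T] (fun x => complex.Re (f x)),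
              measurable_fun [set: T] (fun x => complex.Im (f x))
            & (L2norm f < +oo)%E]].

(* Unordered summation in L^2: the net of finite partial sums tends to g; such
   a g is unique up to equality almost everywhere. *)
Definition has_L2_sum (I : choiceType) (u : I -> T -> R[i]) (g : T -> R[i]) :=
  forall eps : R, 0 < eps -> exists J0 : {fset I}, forall J : {fset I},
    (J0 `<=` J)%fset ->
    (L2norm (fun x => g x - \sum_(i <- J) u i x)%R < eps%:E)%E.

(* The operator f |-> \sum_i lam_i <f, e_i> e_i, as a domain and a graph:
   spectral_graph lam e f g says that the series at f converges to the class
   of g. *)
Definition spectral_dom (I : choiceType) (lam : I -> R) (e : I -> T -> R[i]) :
    set (T -> R[i]) :=
  [set f | L2 f /\
    (\esum_(i in [set: I])
       (Normc.normc ((lam i)%:C * inner f (e i)) ^+ 2)%:E < +oo)%E].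

Definition spectral_graph (I : choiceType) (lam : I -> R) (e : I -> T -> R[i])
    (f g : T -> R[i]) : Prop :=
  [/\ spectral_dom lam e f, L2 g
    & has_L2_sum (fun i x => (lam i)%:C * inner f (e i) * e i x) g].

End ComplexL2.

Section SpecialFunctions.
Context {R : realType}.

Definition Gamma (x : R) : R :=
  \int[lebesgue_measure]_(t in `]0, +oo[) (t `^ (x - 1) * expR (- t)).

Definition hermite_poly (k : nat) (t : R) : R :=
  (-1) ^+ k * expR (t ^+ 2) * derive1n k (fun u : R => expR (- u ^+ 2)) t.

Definition hermite_fun1 (k : nat) (t : R) : R :=
  (Num.sqrt (2 ^+ k * k`!%:R * Num.sqrt pi))^-1 * hermite_poly k t
  * expR (- (t ^+ 2 / 2)).

Definition hermite_fun (n : nat) (a : n.-tuple nat) (x : Rn R n) : R[i] :=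
  (\prod_(i < n) hermite_fun1 (tnth a i) (tnth x i))%:C.

(* Meaningful for t > 0 only; the value at t = 0 affects phi only at the origin. *)
Definition laguerre_poly (k : nat) (b t : R) : R :=
  (k`!%:R)^-1 * expR t * t `^ (- b)
  * derive1n k (fun u : R => expR (- u) * u `^ (k%:R + b)) t.

Definition laguerre_fun (k : nat) (b r : R) : R :=
  Num.sqrt (2 * Gamma (k%:R + 1) / Gamma (k%:R + b + 1))
  * laguerre_poly k b (r ^+ 2) * expR (- (r ^+ 2 / 2)).

End SpecialFunctions.

Section SolidHarmonics.
Context {R : realType} {n : nat}.
Local Notation Cpoly := (mpoly.mpoly n R[i]).

Definition laplacian (p : Cpoly) : Cpoly :=
  \sum_(i < n) mpoly.mderiv i (mpoly.mderiv i p).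

Definition solid_harmonic (s : nat) : set Cpoly :=
  [set p | p \is @mpoly.ishomog1 n _ s mpoly.mdeg
           /\ laplacian p = 0].

Definition Cpoly_fun (p : Cpoly) (x : Rn R n) : R[i] :=
  mpoly.meval (fun i => (tnth x i)%:C) p.

(* Y is a basis of the space of solid harmonics of degree s, so that its length
   d is the dimension of that space, and Y is orthonormal on the unit sphere. *)
Definition orthonormal_harmonic_basis (s d : nat) (Y : 'I_d -> Cpoly) : Prop :=
  [/\ forall j, solid_harmonic s (Y j),
      forall c : 'I_d -> R[i], \sum_j c j *: Y j = 0 -> forall j, c j = 0,
      forall p, solid_harmonic s p ->
        exists c : 'I_d -> R[i], p = \sum_j c j *: Y j
    & forall j k, inner surface_measure (Cpoly_fun (Y j)) (Cpoly_fun (Y k))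
        = (j == k)%:R].

(* Indices (k, (s, j)).  For n = 1 there are no nonzero solid harmonics of
   degree s >= 2, hence d s = 0 and s only takes the values 0 and 1. *)
Definition phi_index (d : nat -> nat) : choiceType :=
  (nat * {s : nat & 'I_(d s)})%type.

Definition phi (d : nat -> nat) (Y : forall s, 'I_(d s) -> Cpoly)
    (i : phi_index d) (x : Rn R n) : R[i] :=
  let: (k, existT s j) := i in
  (laguerre_fun k (n%:R / 2 - 1 + s%:R) (enorm x))%:C * Cpoly_fun (Y s j) x.

End SolidHarmonics.

Section Operators.
Context {R : realType} {n : nat}.

Definition hermite_eigenvalue (a : n.-tuple nat) : R :=
  n%:R + 2 * (\sum_(i < n) tnth a i)%N%:R.

Definition H_dom : set (Rn R n -> R[i]) :=
  spectral_dom (lebesgue_Rn R n) hermite_eigenvalue (@hermite_fun R n).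

Definition H_graph : (Rn R n -> R[i]) -> (Rn R n -> R[i]) -> Prop :=
  spectral_graph (lebesgue_Rn R n) hermite_eigenvalue (@hermite_fun R n).

Variables (d : nat -> nat) (Y : forall s, 'I_(d s) -> mpoly.mpoly n R[i]).

Definition phi_eigenvalue (i : phi_index d) : R :=
  let: (k, existT s _) := i in n%:R + 2 * (s%:R + 2 * k%:R).

Definition Htilde_dom : set (Rn R n -> R[i]) :=
  spectral_dom (lebesgue_Rn R n) phi_eigenvalue (phi Y).

Definition Htilde_graph : (Rn R n -> R[i]) -> (Rn R n -> R[i]) -> Prop :=
  spectral_graph (lebesgue_Rn R n) phi_eigenvalue (phi Y).

End Operators.

(* Main.v *)
Require Import Defs.
From HB Require Import structures.
From mathcomp Require Import all_boot all_order all_algebra finmap.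
From mathcomp Require Import complex.
From mathcomp Require Import all_classical all_reals all_analysis.
From mathcomp Require Import measurable_realfun ring lra zify.
From mathcomp Require mpoly.
Import -(notations) mpoly.

(** Both systems consist of joint eigenfunctions of the harmonic oscillator.
    Conjugating by the Gaussian e^{-|x|^2/2}, the oscillator becomes
    2 E - Delta + n on polynomials (E the Euler operator), and h_alpha and
    phi_{k,s,j} become polynomials of eigenvalue 2 |alpha| + n and
    2 (s + 2 k) + n.  The raising operators 2 x_i - d_i, adjoint to d_i for the
    Gaussian functional p |-> int p e^{-|x|^2}, produce the Hermite polynomials
    from 1, and iterating a quarter of the sum of their squares on a solid
    harmonic Y produces, up to sign, k! L_k^{n/2-1+s}(|x|^2) Y.  Hence for each
    N the h_alpha with |alpha| = N and the phi_{k,s,j} with s + 2 k = N are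
    orthonormal bases, almost everywhere, of the same finite-dimensional space,
    and both operators multiply the orthogonal projection onto that space by
    n + 2 N.  The series defining the two operators, summed along these levels,
    have the same partial sums; summability is unconditional, so domains and
    values agree. *)

Set Implicit Arguments.
Unset Strict Implicit.
Unset Printing Implicit Defensive.

Import Order.TTheory GRing.Theory Num.Theory.
Import numFieldNormedType.Exports.

Local Open Scope ring_scope.

(** * The harmonic oscillator on polynomials *)

(* Locked: otherwise unification unfolds the polynomial products. *)
HB.lock Definition raise (K : numFieldType) (n : nat) (i : 'I_n) (p : mpoly n K) : mpoly n K :=
  2 * mpolyX K (mnm1 i) * p - mderiv i p.

Section Ladder.
Variables (K : numFieldType) (n : nat).
Local Notation P := (mpoly n K).
Implicit Types (p q : P) (i j : 'I_n) (m : multinom n).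

Local Notation D := mderiv.
Local Notation VX i := (mpolyX K (mnm1 i)).

Definition mlap p : P := \sum_(i < n) D i (D i p).
Definition euler p : P := \sum_(i < n) VX i * D i p.
Definition hermite_op p : P := 2 * euler p - mlap p.
(* [p] times e^{-|x|^2/2} is an eigenfunction of -Delta + |x|^2 for 2 N + n. *)
Definition eigen (N : nat) p := hermite_op p = (2 * N)%:R * p.
Definition raise2 p : P := 4^-1 *: \sum_(i < n) raise i (raise i p).
Definition r2 : P := \sum_(i < n) VX i ^+ 2.

Lemma raiseE i p : raise i p = 2 * VX i * p - D i p.
Proof. by rewrite raise.unlock. Qed.

Lemma raise0 i : raise i (0 : P) = 0.
Proof. by rewrite raiseE mderiv0 mulr0 subr0. Qed.

Lemma mderivX1 i j : D i (VX j) = (i == j)%:R.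
Proof.
rewrite mderivX mnm1E eq_sym; case: eqP => [->|_]; last by rewrite scale0r.
rewrite scale1r (_ : mnm_sub _ _ = @mnm0 n) ?mpolyX0//.
by apply/mnmP => k; rewrite mnmBE mnm0E subnn.
Qed.

Lemma mderiv_nat i k : D i (k%:R : P) = 0.
Proof. by rewrite -mpolyC_nat mderivC. Qed.

Lemma mderivMX i j p : D i (VX j * p) = (i == j)%:R * p + VX j * D i p.
Proof. by rewrite mderivM mderivX1. Qed.

Lemma raiseD i p q : raise i (p + q) = raise i p + raise i q.
Proof. by rewrite !raiseE mderivD; ring. Qed.

Lemma raiseZ i c p : raise i (c *: p) = c *: raise i p.
Proof. by rewrite !raiseE mderivZ scalerBr scalerAr. Qed.

Lemma raise_nat i k p : raise i (k%:R * p) = k%:R * raise i p.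
Proof. by rewrite !raiseE mderivM mderiv_nat; ring. Qed.

Lemma mderiv_raise i j p : D i (raise j p) = raise j (D i p) + (2 * (i == j))%:R * p.
Proof.
rewrite !raiseE mderivB -mulrA mderivM mderiv_nat mderivMX mderiv_comm natrM.
by ring.
Qed.

Lemma raiseC i j p : raise i (raise j p) = raise j (raise i p).
Proof.
rewrite raiseE [in RHS]raiseE !mderiv_raise !raiseE (eq_sym j i).
by have [->|_] := eqVneq i j; rewrite ?(mderiv_comm j i); ring.
Qed.

Lemma hermite_opE p : hermite_op p = \sum_(i < n) raise i (D i p).
Proof.
rewrite /hermite_op /euler /mlap mulr_sumr -sumrB; apply: eq_bigr => i _.
by rewrite !raiseE mulrA.
Qed.

Lemma hermite_op_raise i p :
  hermite_op (raise i p) = raise i (hermite_op p) + 2 * raise i p.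
Proof.
have raise_sum (F : 'I_n -> P) : raise i (\sum_j F j) = \sum_j raise i (F j).
  by apply: (big_morph (raise i) (raiseD i)); exact: raise0.
rewrite !hermite_opE raise_sum.
transitivity (\sum_j (raise i (raise j (D j p)) + (2 * (j == i))%:R * raise j p)).
  by apply: eq_bigr => j _; rewrite mderiv_raise raiseD raiseC raise_nat.
rewrite big_split /=; congr (_ + _).
rewrite (bigD1 i)//= eqxx muln1 big1 ?addr0// => j /negPf->.
by rewrite muln0 mul0r.
Qed.

Lemma hermite_op_mderiv i p : hermite_op (D i p) = D i (hermite_op p) - 2 * D i p.
Proof.
rewrite !hermite_opE raddf_sum /=.
have -> : \sum_j D i (raise j (D j p)) =
    \sum_j (raise j (D j (D i p)) + (2 * (i == j))%:R * D j p).
  by apply: eq_bigr => j _; rewrite mderiv_raise mderiv_comm.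
have S2 : \sum_j (2 * (i == j))%:R * D j p = 2 * D i p.
  rewrite (bigD1 i)//= eqxx muln1 big1 ?addr0// => j.
  by rewrite eq_sym => /negPf->; rewrite muln0 mul0r.
by rewrite [in RHS]big_split /= S2 addrK.
Qed.

Lemma hermite_opD p q : hermite_op (p + q) = hermite_op p + hermite_op q.
Proof.
by rewrite !hermite_opE -big_split; apply: eq_bigr => i _; rewrite mderivD raiseD.
Qed.

Lemma hermite_opZ c p : hermite_op (c *: p) = c *: hermite_op p.
Proof.
by rewrite !hermite_opE scaler_sumr; apply: eq_bigr => i _; rewrite mderivZ raiseZ.
Qed.

Lemma eigenD N p q : eigen N p -> eigen N q -> eigen N (p + q).
Proof. by rewrite /eigen hermite_opD => -> ->; rewrite mulrDr. Qed.

Lemma eigenZ N c p : eigen N p -> eigen N (c *: p).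
Proof. by rewrite /eigen hermite_opZ => ->; rewrite scalerAr. Qed.

Lemma eigen0 N : eigen N 0.
Proof.
rewrite /eigen hermite_opE big1 ?mulr0// => i _.
by rewrite mderiv0 raise0.
Qed.

Lemma eigen_sum N (I : Type) (s : seq I) (F : I -> P) :
  (forall x, eigen N (F x)) -> eigen N (\sum_(i <- s) F i).
Proof.
move=> h; elim/big_ind: _ => //; first exact: eigen0.
by move=> p q; exact: eigenD.
Qed.

Lemma eigen_raise N i p : eigen N p -> eigen N.+1 (raise i p).
Proof.
rewrite /eigen hermite_op_raise => ->; rewrite raise_nat -mulrDl -natrD.
by rewrite -mulnSr.
Qed.

Lemma eigen_mderiv N i p : eigen N.+1 p -> eigen N (D i p).
Proof.
rewrite /eigen hermite_op_mderiv => ->; rewrite mderivM mderiv_nat mul0r add0r.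
by rewrite -mulrBl mulnSr natrD addrK.
Qed.

Lemma eigen_raise2 N p : eigen N p -> eigen N.+2 (raise2 p).
Proof.
by move=> h; apply: eigenZ; apply: eigen_sum => i; do 2!apply: eigen_raise.
Qed.

Lemma mcoeff_euler p m : mcoeff m (euler p) = (mdeg m)%:R * mcoeff m p.
Proof.
rewrite /euler raddf_sum /= mdegE natr_sum mulr_suml; apply: eq_bigr => i _.
case: (posnP (m i)) => mi.
  rewrite mi mul0r; apply: memN_msupp_eq0; apply/negP.
  rewrite mulrC (perm_mem (msuppMX _ _)) => /mapP[m' _ mE]; move: mi.
  by rewrite mE mnmDE mnm1E eqxx.
have mE : m = mnm_add (mnm1 i) (mnm_sub m (mnm1 i)).
  apply/mnmP => k; rewrite mnmDE mnmBE mnm1E.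
  by case: eqP => [<-|_]; rewrite ?subn0// subnKC.
rewrite [in LHS]mE mulrC mcoeffMX mcoeff_deriv addmC -mE.
by rewrite mnmBE mnm1E eqxx subn1 prednK// mulr_natl.
Qed.

Lemma mcoeff_lead_mlap p : mcoeff (mlead p) (mlap p) = 0.
Proof.
rewrite /mlap raddf_sum big1// => i _; rewrite /= !mcoeff_deriv.
rewrite mcoeff_gt_mlead ?mul0rn// -addmA.
apply: lt_mdeg_ltmc; rewrite !mdegD !mdeg1; lia.
Qed.

Lemma eigen_mlead N p : eigen N p -> p != 0 -> mdeg (mlead p) = N.
Proof.
move=> /(congr1 (mcoeff (mlead p))) h p0.
have : (mdeg (mlead p))%:R = N%:R :> K.
  have l0 : mcoeff (mlead p) p != 0 by rewrite mleadc_eq0.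
  apply: (mulIf l0); apply: (@mulfI _ 2); first by rewrite pnatr_eq0.
  move: h; rewrite /hermite_op mcoeffB mcoeff_lead_mlap subr0.
  rewrite -!mpolyC_nat !mcoeffCM mcoeff_euler mulrA => ->.
  by rewrite natrM mulrA.
by move/eqP; rewrite eqr_nat => /eqP.
Qed.

End Ladder.

Section HermiteMpoly.
Variables (K : numFieldType) (n : nat).
Local Notation P := (mpoly n K).
Implicit Types (p q : P) (i j : 'I_n) (m : multinom n).
Local Notation D := mderiv.
Local Notation VX i := (mpolyX K (mnm1 i)).

Definition herm1 i k : P := iter k (raise i) 1.
Definition herm m : P := \prod_(i < n) herm1 i (m i).

Lemma mderiv_herm1_neq i j k : i != j -> D i (herm1 j k) = 0.
Proof.
move=> /negPf ij; elim: k => [|k IH]; first by rewrite /= -[1]/(1%:R) mderiv_nat.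
by rewrite /= mderiv_raise ij IH muln0 mul0r addr0 raise0.
Qed.

Lemma mderiv_herm1 i k : D i (herm1 i k) = (2 * k)%:R * herm1 i k.-1.
Proof.
elim: k => [|k IH]; first by rewrite /= -[1]/(1%:R) mderiv_nat muln0 mul0r.
rewrite /= mderiv_raise IH eqxx raise_nat -/(herm1 i k).
case: k IH => [|k] _ /=; first by rewrite !mul0r add0r muln1.
by rewrite -/(herm1 i k) -mulrDl -natrD; congr (_%:R * _); lia.
Qed.

Lemma herm1_rec i k :
  herm1 i k.+2 = 2 * VX i * herm1 i k.+1 - (2 * k.+1)%:R * herm1 i k.
Proof. by rewrite [LHS]/= [LHS]raiseE -!iterS -/(herm1 i k.+1) mderiv_herm1. Qed.

Lemma mderiv_prod_neq i (Q : pred 'I_n) (F : 'I_n -> P) :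
  (forall j, Q j -> D i (F j) = 0) -> D i (\prod_(j < n | Q j) F j) = 0.
Proof.
move=> h; elim/big_ind: _ => [|p q hp hq|//]; first by rewrite -[1]/(1%:R) mderiv_nat.
by rewrite mderivM hp hq mul0r mulr0 addr0.
Qed.

Lemma hermE i m : herm m = herm1 i (m i) * \prod_(j < n | j != i) herm1 j (m j).
Proof. by rewrite /herm (bigD1 i). Qed.

Lemma herm_rest_eq i m m' : (forall j, j != i -> m j = m' j) ->
  \prod_(j < n | j != i) herm1 j (m j) = \prod_(j < n | j != i) herm1 j (m' j).
Proof. by move=> h; apply: eq_bigr => j ji; rewrite h. Qed.

Lemma mderiv_herm_rest i m : D i (\prod_(j < n | j != i) herm1 j (m j)) = 0.
Proof. by apply: mderiv_prod_neq => j ji; rewrite mderiv_herm1_neq// eq_sym. Qed.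

Lemma raise_herm i m : raise i (herm m) = herm (mnm_add m (mnm1 i)).
Proof.
rewrite !(hermE i) mnmDE mnm1E eqxx addn1 /=.
rewrite (@herm_rest_eq i (mnm_add m (mnm1 i)) m); last first.
  by move=> j ji; rewrite mnmDE mnm1E eq_sym (negPf ji) addn0.
by rewrite !raiseE mderivM mderiv_herm_rest mulr0 addr0 mulrBl mulrA.
Qed.

Lemma mderiv_herm i m : D i (herm m) = (2 * m i)%:R * herm (mnm_sub m (mnm1 i)).
Proof.
rewrite !(hermE i) mderivM mderiv_herm_rest mulr0 addr0 mderiv_herm1.
rewrite mnmBE mnm1E eqxx subn1 mulrA; congr (_ * _); apply: herm_rest_eq => j ji.
by rewrite mnmBE mnm1E eq_sym (negPf ji) subn0.
Qed.

Lemma eigen_herm m : eigen (mdeg m) (herm m).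
Proof.
rewrite /eigen hermite_opE mdegE big_distrr /= natr_sum mulr_suml.
apply: eq_bigr => i _; rewrite mderiv_herm raise_nat.
have [->|mi] := posnP (m i); first by rewrite muln0 !mul0r.
rewrite raise_herm; congr (_ * herm _); apply/mnmP => j.
by rewrite mnmDE mnmBE mnm1E; case: eqP => [<-|_]; rewrite ?subn0 ?addn0// subnK.
Qed.

Lemma herm0 : herm (@mnm0 n) = 1.
Proof. by rewrite /herm big1// => i _; rewrite mnm0E. Qed.

Lemma eigen0_const p : eigen 0 p -> p = mpolyC n (mcoeff (@mnm0 n) p).
Proof.
have [->|p0] := eqVneq p 0; first by rewrite mcoeff0 mpolyC0.
by move=> /eigen_mlead/(_ p0) h; apply: msize1_polyC; rewrite -mlead_deg// h.
Qed.

Lemma eigen_herm_span N p : eigen N p ->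
  exists s : seq (K * multinom n), p = \sum_(cm <- s) cm.1 *: herm cm.2.
Proof.
elim: N p => [|N IH] p hp.
  exists [:: (mcoeff (@mnm0 n) p, @mnm0 n)]; rewrite big_seq1 /= herm0.
  by rewrite alg_mpolyC -eigen0_const.
have /choice[s hs] : forall i, exists s : seq (K * multinom n), D i p = \sum_(cm <- s) cm.1 *: herm cm.2.
  by move=> i; apply: IH; exact: eigen_mderiv.
have raise_sum i (t : seq (K * multinom n)) : raise i (\sum_(cm <- t) cm.1 *: herm cm.2) =
    \sum_(cm <- [seq (cm.1, mnm_add cm.2 (mnm1 i)) | cm <- t]) cm.1 *: herm cm.2.
  elim: t => [|c t IHt]; first by rewrite !big_nil raise0.
  by rewrite /= !big_cons raiseD IHt raiseZ raise_herm.
exists [seq ((2 * N.+1)%:R^-1 * cm.1, cm.2) | cm <-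
  flatten [seq [seq (cm.1, mnm_add cm.2 (mnm1 i)) | cm <- s i] | i <- enum 'I_n]].
rewrite big_map big_flatten big_map /= big_enum /=.
have N0 : (2 * N.+1)%:R != 0 :> K by rewrite pnatr_eq0.
apply: (scalerI N0); transitivity (hermite_op p).
  by rewrite hp -mpolyC_nat mul_mpolyC.
rewrite hermite_opE scaler_sumr; apply: eq_bigr => i _.
rewrite hs raise_sum scaler_sumr; apply: eq_bigr => c _.
by rewrite scalerA mulrA divff// mul1r.
Qed.

End HermiteMpoly.

Section LaguerreMpoly.
Variables (K : numFieldType) (n : nat).
Local Notation P := (mpoly n K).
Implicit Types (p q Y : P) (i j : 'I_n) (m : multinom n).
Local Notation D := mderiv.
Local Notation VX i := (mpolyX K (mnm1 i)).
Local Notation r2 := (@r2 K n).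

Definition radial k Y : P := iter k (@raise2 K n) Y.

Lemma raise2D p q : raise2 (p + q) = raise2 p + raise2 q.
Proof.
rewrite /raise2; under eq_bigr do rewrite !raiseD.
by rewrite big_split /= scalerDr.
Qed.

Lemma raise2Z c p : raise2 (c *: p) = c *: raise2 p.
Proof.
rewrite /raise2; under eq_bigr do rewrite !raiseZ.
by rewrite -scaler_sumr !scalerA mulrC.
Qed.

Lemma radialD k p q : radial k (p + q) = radial k p + radial k q.
Proof. by elim: k => //= k ->; rewrite raise2D. Qed.

Lemma radialZ k c p : radial k (c *: p) = c *: radial k p.
Proof. by elim: k => //= k ->; rewrite raise2Z. Qed.

Lemma eigen_radial N k p : eigen N p -> eigen (N + 2 * k) (radial k p).
Proof.
move=> h; elim: k => [|k IH] /=; first by rewrite muln0 addn0.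
by rewrite mulnS addnCA; exact: eigen_raise2.
Qed.

Lemma mlapZ c p : mlap (c *: p) = c *: mlap p.
Proof. by rewrite /mlap scaler_sumr; apply: eq_bigr => i _; rewrite !mderivZ. Qed.

Lemma mlapD p q : mlap (p + q) = mlap p + mlap q.
Proof. by rewrite /mlap -big_split; apply: eq_bigr => i _; rewrite !mderivD. Qed.

Lemma eigen_mlap N p : eigen N.+2 p -> eigen N (mlap p).
Proof. by move=> h; apply: eigen_sum => i; do 2! apply: eigen_mderiv. Qed.

Lemma mlap_raise2 p :
  mlap (raise2 p) = raise2 (mlap p) + 2 * hermite_op p + (2 * n)%:R * p.
Proof.
have key i j : D i (D i (raise j (raise j p))) =
    raise j (raise j (D i (D i p))) + (8 * (i == j))%:R * raise j (D i p)
    + (8 * (i == j))%:R * p.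
  have [->|ij] := eqVneq i j; last first.
    have c q : D i (raise j q) = raise j (D i q).
      by rewrite mderiv_raise (negPf ij) muln0 mul0r addr0.
    by rewrite !c muln0 !mul0r !addr0.
  rewrite !(mderiv_raise, raiseD, raise_nat, mderivD, mderivM, mderiv_nat) eqxx /= !muln1.
  by rewrite mul0r raise0; ring.
have raise_sum i (F : 'I_n -> P) : raise i (\sum_j F j) = \sum_j raise i (F j).
  by apply: (big_morph (raise i) (raiseD i)); exact: raise0.
have Dsum i (F : 'I_n -> P) : D i (\sum_j F j) = \sum_j D i (F j) by exact: raddf_sum.
have four : 4%:R != 0 :> K by rewrite pnatr_eq0.
apply: (scalerI four); rewrite /raise2 mlapZ !scalerDr !scalerA divff// !scale1r.
transitivity (\sum_i \sum_j (raise j (raise j (D i (D i p))) + (8 * (i == j))%:R * raise j (D i p)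
    + (8 * (i == j))%:R * p)).
  apply: eq_bigr => i _; rewrite !Dsum; apply: eq_bigr => j _.
  exact: key.
have dsum i (F : 'I_n -> P) : \sum_j (8 * (i == j))%:R * F j = 8 * F i.
  rewrite (bigD1 i)//= eqxx muln1 big1 ?addr0// => j.
  by rewrite eq_sym => /negPf->; rewrite muln0 mul0r.
under eq_bigr do rewrite 2!big_split /= !dsum.
rewrite 2!big_split /=; congr (_ + _ + _).
- rewrite exchange_big; apply: eq_bigr => j _.
  by rewrite /mlap !raise_sum.
- rewrite -mulr_sumr -hermite_opE -mul_mpolyC mpolyC_nat; ring.
- rewrite sumr_const card_ord -mul_mpolyC mpolyC_nat natrM -mulr_natl; ring.
Qed.

Definition radial_coef s k : nat := (k.+1 * (2 * (k + s) + n))%N.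

Lemma mlap_radial s k Y : eigen s Y -> mlap Y = 0 ->
  mlap (radial k.+1 Y) = (2 * radial_coef s k)%:R * radial k Y.
Proof.
move=> hY Y0; elim: k => [|k IH].
  rewrite /= mlap_raise2 Y0 hY /raise2 big1 ?scaler0 ?add0r; last first.
    by move=> i _; rewrite !raise0.
  by rewrite /radial_coef mulrA -!natrM -mulrDl -natrD; congr (_%:R * _); lia.
rewrite [LHS]/= mlap_raise2 -/(radial k.+1 Y) IH (eigen_radial k.+1 hY).
rewrite -mpolyC_nat mul_mpolyC raise2Z -mul_mpolyC mpolyC_nat.
rewrite -/(radial k.+1 Y) mulrA -!natrM -!mulrDl -!natrD /radial_coef.
by congr (_%:R * _); lia.
Qed.

Lemma eulerD p q : euler (p + q) = euler p + euler q.
Proof. by rewrite /euler -big_split; apply: eq_bigr => i _; rewrite mderivD mulrDr. Qed.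

Lemma eulerM p q : euler (p * q) = euler p * q + p * euler q.
Proof.
rewrite /euler mulr_suml mulr_sumr -big_split; apply: eq_bigr => i _.
by rewrite mderivM /=; ring.
Qed.

Lemma euler_const (c : K) : euler (mpolyC n c) = 0.
Proof. by rewrite /euler big1// => i _; rewrite mderivC mulr0. Qed.

Lemma euler_r2 : euler r2 = 2 * r2.
Proof.
rewrite {2}/r2 mulr_sumr /euler; apply: eq_bigr => i _; rewrite /r2 raddf_sum (bigD1 i)//=.
rewrite big1 ?addr0 ?expr2 ?mderivMX ?mderivX1 ?eqxx; first by rewrite mul1r mulr1; ring.
by move=> j /negPf ji; rewrite expr2 mderivMX mderivX1 eq_sym ji mul0r mulr0 addr0.
Qed.

Definition radial_fun (q : {poly K}) : P := (map_poly (@mpolyC n K) q).[r2].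

Lemma euler_radial_fun (q : {poly K}) : euler (radial_fun q) = 2 * r2 * radial_fun q^`().
Proof.
elim/poly_ind: q => [|q c IH].
  by rewrite /radial_fun deriv0 !rmorph0 !horner0 mulr0 -(mpolyC0 n K) euler_const.
rewrite /radial_fun derivD derivC addr0 derivM derivX mulr1 !rmorphD !rmorphM /= map_polyX map_polyC /=.
rewrite !hornerE -/(radial_fun q) -/(radial_fun q^`()) eulerD euler_const eulerM euler_r2 IH.
by ring.
Qed.

Lemma raise2_eigen N p : eigen N p ->
  raise2 p = r2 * p - 2^-1 *: (euler p + (N + n)%:R * p).
Proof.
move=> hN; have four : 4%:R != 0 :> K by rewrite pnatr_eq0.
apply: (scalerI four); rewrite /raise2 scalerA divff// scale1r.
have lapE : mlap p = 2 * euler p - (2 * N)%:R * p.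
  by rewrite -hN /hermite_op; ring.
transitivity (4 * r2 * p - 4 * euler p - (2 * n)%:R * p + mlap p).
  have key i : raise i (raise i p) = 4 * (VX i ^+ 2 * p) - 4 * (VX i * D i p) - 2 * p + D i (D i p).
    have h : D i (2 * VX i * p) = 2 * p + 2 * VX i * D i p.
      by rewrite -[2 * _ * p]mulrA mderivM mderiv_nat mderivMX eqxx mul0r mul1r; ring.
    by rewrite !raiseE mderivB h; ring.
  under eq_bigr do rewrite key.
  rewrite 3!big_split /= !sumrN -!mulr_sumr -mulr_suml sumr_const card_ord -/r2.
  by rewrite -(mulr_natl p n) natrM -/(euler p) -/(mlap p); ring.
rewrite lapE scalerBr scalerA -!mul_mpolyC (_ : 4%:R / 2 = 2%:R); last by field.
by rewrite !mpolyC_nat (natrD _ N n) (natrM _ 2 n) (natrM _ 2 N); ring.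
Qed.

End LaguerreMpoly.

Section RadialSpan.
Variables (K : numFieldType) (n : nat).
Hypothesis n_gt0 : (0 < n)%N.
Local Notation P := (mpoly n K).
Implicit Types (p q Y : P) (i j : 'I_n).
Local Notation D := mderiv.

Lemma homog_euler s p : p \is ishomog1 s mdeg <-> euler p = s%:R * p.
Proof.
split=> [/dhomogP h|h].
  apply/mpolyP => m; rewrite mcoeff_euler -mpolyC_nat mcoeffCM.
  have [/h ->//|mp] := boolP (m \in msupp p).
  by rewrite memN_msupp_eq0// !mulr0.
apply/dhomogP => m mp; have := congr1 (mcoeff m) h.
rewrite mcoeff_euler -mpolyC_nat mcoeffCM => /mulIf.
by rewrite -mcoeff_msupp => /(_ mp)/eqP; rewrite eqr_nat => /eqP.
Qed.

Lemma harmonic_eigen s p : mlap p = 0 ->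
  p \is ishomog1 s mdeg <-> eigen s p.
Proof.
have two : (2 : P) = mpolyC n 2 by rewrite mpolyC_nat.
have two0 : (2 : K) != 0 by rewrite pnatr_eq0.
move=> p0; rewrite homog_euler /eigen /hermite_op p0 subr0 natrM -mulrA.
split=> [->//|]; rewrite two !mul_mpolyC; exact: scalerI.
Qed.

Lemma mderiv_eigen0 i p : eigen 0 p -> D i p = 0.
Proof. by move=> /eigen0_const ->; rewrite mderivC. Qed.

Lemma mlap_eigen_lt2 N p : (N < 2)%N -> eigen N p -> mlap p = 0.
Proof.
move=> N2 h; rewrite /mlap big1// => i _.
case: N N2 h => [|[|//]] _ h; first by rewrite (mderiv_eigen0 i h) mderiv0.
by apply: mderiv_eigen0; exact: eigen_mderiv.
Qed.

Lemma eigen_iter_mlap N m p : eigen (N + 2 * m) p -> eigen N (iter m (@mlap K n) p).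
Proof.
elim: m N => [|m IH] N h /=; first by move: h; rewrite muln0 addn0.
by apply: eigen_mlap; apply: IH; move: h; rewrite mulnS addnA addn2.
Qed.

Lemma iter_mlap_radial s m Y : eigen s Y -> mlap Y = 0 ->
  iter m (@mlap K n) (radial m Y) = (\prod_(k < m) (2 * radial_coef n s k)%N)%:R * Y.
Proof.
move=> hY Y0; elim: m => [|m IH]; first by rewrite big_ord0 mul1r.
rewrite iterSr (mlap_radial m hY Y0) -mpolyC_nat mul_mpolyC.
have iterZ c q : iter m (@mlap K n) (c *: q) = c *: iter m (@mlap K n) q.
  by elim: m {IH} => //= m' ->; rewrite mlapZ.
by rewrite iterZ IH big_ord_recr /= -mul_mpolyC mpolyC_nat mulrA -natrM mulnC.
Qed.

Lemma radial_span_aux m N p : (2 * m <= N.+2)%N -> eigen N p -> iter m (@mlap K n) p = 0 ->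
  exists Ys : nat -> P, (forall k, (k < m)%N -> eigen (N - 2 * k) (Ys k) /\ mlap (Ys k) = 0)
    /\ p = \sum_(k < m) radial k (Ys k).
Proof.
elim: m p => [|m IH] p mN hp p0.
  by exists (fun=> 0); split => //; rewrite big_ord0.
pose Y := iter m (@mlap K n) p.
have hY : eigen (N - 2 * m) Y by apply: eigen_iter_mlap; rewrite subnK//; lia.
have Y0 : mlap Y = 0 by [].
pose c : K := (\prod_(k < m) (2 * radial_coef n (N - 2 * m) k)%N)%:R.
have c0 : c != 0.
  rewrite pnatr_eq0 -lt0n prodn_gt0// => k.
  by rewrite !muln_gt0 /= addn_gt0 n_gt0 orbT.
pose Z := c^-1 *: Y.
have hZ : eigen (N - 2 * m) Z by exact: eigenZ.
have Z0 : mlap Z = 0 by rewrite mlapZ Y0 scaler0.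
have [|||Ys [hYs pE]] := IH (p - radial m Z).
- by lia.
- apply: eigenD => //; rewrite -scaleN1r; apply: eigenZ.
  have -> : N = (N - 2 * m + 2 * m)%N by lia.
  exact: eigen_radial.
- have iterB q q' : iter m (@mlap K n) (q - q') = iter m (@mlap K n) q - iter m (@mlap K n) q'.
    by elim: m {IH mN p0 Y hY Y0 c c0 Z hZ Z0} => //= m ->; rewrite mlapD -scaleN1r mlapZ scaleN1r.
  rewrite iterB (iter_mlap_radial _ hZ Z0) -mpolyC_nat mul_mpolyC scalerA divff//.
  by rewrite scale1r subrr.
exists (fun k => if k == m then Z else Ys k); split.
  move=> k; rewrite ltnS leq_eqVlt; case: eqP => [->//|_ /=]; exact: hYs.
rewrite big_ord_recr /= eqxx -[LHS](subrK (radial m Z)) pE; congr (_ + _).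
by apply: eq_bigr => k _; rewrite ltn_eqF.
Qed.

Lemma radial_span N p : eigen N p -> exists Ys : nat -> P,
  (forall k, (k <= N./2)%N -> eigen (N - 2 * k) (Ys k) /\ mlap (Ys k) = 0)
    /\ p = \sum_(k < (N./2).+1) radial k (Ys k).
Proof.
move=> hp; have [|||Ys h] := @radial_span_aux (N./2).+1 N p; last by exists Ys.
- by lia.
- by [].
apply: (@mlap_eigen_lt2 (N - 2 * N./2)); first lia.
by apply: eigen_iter_mlap; rewrite subnK//; lia.
Qed.

End RadialSpan.

Section GaussianFunctional.
Variables (K : numFieldType) (n : nat).
Local Notation P := (mpoly n K).
Implicit Types (p q Y : P) (i j : 'I_n).
Local Notation D := mderiv.
Variable G : P -> K.
Hypothesis GD : forall p q, G (p + q) = G p + G q.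
Hypothesis GZ : forall c p, G (c *: p) = c * G p.
Hypothesis Gadj : forall i p, G (D i p) = G (2 * mpolyX K (mnm1 i) * p).

Let GB p q : G (p - q) = G p - G q.
Proof. by rewrite -scaleN1r GD GZ mulN1r. Qed.

Let Gnat k p : G (k%:R * p) = k%:R * G p.
Proof. by rewrite -mpolyC_nat mul_mpolyC GZ. Qed.

Let Gsum (I : Type) (s : seq I) (F : I -> P) : G (\sum_(x <- s) F x) = \sum_(x <- s) G (F x).
Proof. by apply: (big_morph G GD); rewrite -(scale0r (0 : P)) GZ mul0r. Qed.

Lemma gauss_raise i p q : G (raise i p * q) = G (p * D i q).
Proof.
have -> : raise i p * q = 2 * mpolyX K (mnm1 i) * (p * q) - D i (p * q) + p * D i q.
  by rewrite raiseE mderivM; ring.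
by rewrite GD GB -Gadj subrr add0r.
Qed.

Lemma gauss_raiser i p q : G (p * raise i q) = G (D i p * q).
Proof. by rewrite mulrC gauss_raise mulrC. Qed.

Lemma gauss_hermite_op p q : G (hermite_op p * q) = G (p * hermite_op q).
Proof.
rewrite !hermite_opE mulr_suml mulr_sumr !Gsum; apply: eq_bigr => i _.
by rewrite gauss_raise gauss_raiser.
Qed.

Lemma gauss_eigen_orth N M p q : eigen N p -> eigen M q -> N <> M -> G (p * q) = 0.
Proof.
move=> hp hq NM; have := gauss_hermite_op p q.
rewrite hp hq -mulrA [in RHS]mulrCA !Gnat => /eqP; rewrite -subr_eq0 -mulrBl mulf_eq0.
case/orP => [|/eqP//]; rewrite subr_eq0 eqr_nat => /eqP h; exfalso; lia.
Qed.

Lemma gauss_raise2 p q : G (raise2 p * q) = 4^-1 * G (p * mlap q).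
Proof.
rewrite -scalerAl GZ; congr (_ * _); rewrite mulr_suml mulr_sumr !Gsum.
by apply: eq_bigr => i _; rewrite !gauss_raise.
Qed.

Lemma gauss_radialS s k l Y Z : eigen s Z -> mlap Z = 0 ->
  G (radial k.+1 Y * radial l.+1 Z) = (radial_coef n s l)%:R / 2 * G (radial k Y * radial l Z).
Proof.
move=> hZ Z0; rewrite [radial k.+1 Y]/= gauss_raise2 (mlap_radial _ hZ Z0).
rewrite mulrCA Gnat mulrA natrM; congr (_ * _).
by rewrite mulrA mulrC (_ : 4 = 2 * 2); [field|ring].
Qed.

Lemma gauss_radial_neq s t k l Y Z : eigen s Y -> mlap Y = 0 -> eigen t Z -> mlap Z = 0 ->
  k <> l -> G (radial k Y * radial l Z) = 0.
Proof.
move=> hY Y0 hZ Z0; elim: k l => [|k IH] [|l] // kl.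
- by rewrite mulrC [radial l.+1 Z]/= gauss_raise2 Y0 mulr0 -(scale0r (0 : P)) GZ mul0r mulr0.
- by rewrite [radial k.+1 Y]/= gauss_raise2 Z0 mulr0 -(scale0r (0 : P)) GZ mul0r mulr0.
- by rewrite (gauss_radialS _ _ _ hZ Z0) IH ?mulr0// => kl'; apply: kl; rewrite kl'.
Qed.

Lemma gauss_radial_eq s k Y Z : eigen s Z -> mlap Z = 0 ->
  G (radial k Y * radial k Z) = \prod_(i < k) ((radial_coef n s i)%:R / 2) * G (Y * Z).
Proof.
move=> hZ Z0; elim: k => [|k IH]; first by rewrite big_ord0 mul1r.
by rewrite (gauss_radialS _ _ _ hZ Z0) IH big_ord_recr /= mulrCA mulrA.
Qed.

Lemma gauss_herm (a b : multinom n) :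
  G (herm K a * herm K b) =
  (a == b)%:R * (\prod_(i < n) (2 ^ a i * (a i)`!)%N)%:R * G 1.
Proof.
have [k] := ubnP (mdeg a); elim: k a b => // k IH a b; rewrite ltnS => ak.
have [a0|/existsP[i ai]] : (a = @mnm0 n) \/ [exists i, a i != 0%N].
  case: (boolP [exists i, a i != 0%N]); [by right|rewrite negb_exists => /forallP h; left].
  by apply/mnmP => i; rewrite mnm0E; have := h i; rewrite negbK => /eqP.
  have pa : (\prod_(i < n) (2 ^ a i * (a i)`!)%N) = 1%N.
    by rewrite big1// => i _; rewrite a0 mnm0E.
  rewrite pa a0 herm0 mul1r mulr1.
  have [b0|/existsP[i bi]] : (b = @mnm0 n) \/ [exists i, b i != 0%N].
    case: (boolP [exists i, b i != 0%N]); [by right|rewrite negb_exists => /forallP h; left].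
    by apply/mnmP => i; rewrite mnm0E; have := h i; rewrite negbK => /eqP.
  - by rewrite b0 herm0 eqxx mul1r.
  - case: eqP => [b0|_]; first by move: bi; rewrite -b0 mnm0E.
    have -> : b = mnm_add (mnm_sub b (mnm1 i)) (mnm1 i).
      by apply/mnmP => j; rewrite mnmDE mnmBE mnm1E; case: eqP => [<-|_]; rewrite ?subn0 ?addn0// subnK// lt0n.
    by rewrite -raise_herm -[_ (herm _ _)]mul1r gauss_raiser -[1]/(1%:R) mderiv_nat mul0r -(scale0r (0 : P)) GZ !mul0r.
have aE : a = mnm_add (mnm_sub a (mnm1 i)) (mnm1 i).
  by apply/mnmP => j; rewrite mnmDE mnmBE mnm1E; case: eqP => [<-|_]; rewrite ?subn0 ?addn0// subnK// lt0n.
set a' := mnm_sub a (mnm1 i) in aE.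
have ai' : a i = (a' i).+1 by rewrite aE mnmDE mnm1E eqxx addn1.
rewrite {1}aE -raise_herm gauss_raise mderiv_herm mulrCA Gnat IH; last first.
  by move: ak; rewrite {1}aE mdegD mdeg1 addn1.
have pE : (\prod_(j < n) (2 ^ a j * (a j)`!)%N) =
    (2 * a i * \prod_(j < n) (2 ^ a' j * (a' j)`!)%N)%N.
  rewrite (bigD1 i)//= [in RHS](bigD1 i)//= ai' expnS factS !mulnA; congr (_ * _)%N; first lia.
  by apply: eq_bigr => j ji; rewrite aE mnmDE mnm1E eq_sym (negPf ji) addn0.
rewrite pE; case: (eqVneq a b) => [ab|ab].
  by rewrite -ab -/a' eqxx !mul1r mulrA -natrM.
rewrite !mul0r; case: (posnP (b i)) => bi; first by rewrite bi muln0 mul0r.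
rewrite (_ : _ == _ = false) ?mul0r ?mulr0//; apply/negbTE; apply: contraNN ab => /eqP a'b.
rewrite aE a'b; apply/eqP/mnmP => j.
by rewrite mnmDE mnmBE mnm1E; case: eqP => [<-|_]; rewrite ?subn0 ?addn0// subnK.
Qed.

End GaussianFunctional.

Local Open Scope classical_set_scope.
Local Open Scope ring_scope.
Local Open Scope complex_scope.

(** * Spectral operators of orthonormal families in L^2 *)

Section ComplexL2Theory.
Context {R : realType} {d : measure_display} {T : measurableType d}.
Variable mu : {measure set T -> \bar R}.
Implicit Types f g : T -> R[i].

Local Notation Re := (@complex.Re R).
Local Notation Im := (@complex.Im R).

Definition abs2 (z : R[i]) : R := Re z ^+ 2 + Im z ^+ 2.

Definition sqnorm f : R := \int[mu]_x abs2 (f x).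

Lemma abs2_ge0 z : 0 <= abs2 z.
Proof. by rewrite addr_ge0// sqr_ge0. Qed.

Lemma normc_abs2 z : Normc.normc z ^+ 2 = abs2 z.
Proof. by case: z => a b; rewrite /= sqr_sqrtr// addr_ge0// sqr_ge0. Qed.

Lemma mulc_conj z : z * z^* = (abs2 z)%:C.
Proof.
case: z => a b; apply/eqP; rewrite eq_complex /abs2 /=.
by apply/andP; split; apply/eqP; ring.
Qed.

Lemma abs2M z w : abs2 (z * w) = abs2 z * abs2 w.
Proof. by case: z w => a b [a' b']; rewrite /abs2/=; ring. Qed.

Lemma conjcM (z w : R[i]) : conjc (z * w) = conjc z * conjc w.
Proof. exact: rmorphM. Qed.

Lemma conjc_sum (I : Type) (s : seq I) (F : I -> R[i]) :
  conjc (\sum_(i <- s) F i) = \sum_(i <- s) conjc (F i).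
Proof. exact: raddf_sum. Qed.

Lemma abs2N z : abs2 (- z) = abs2 z.
Proof. by case: z => a b; rewrite /abs2/= !sqrrN. Qed.

Lemma abs2D_le z w : abs2 (z + w) <= 2 * abs2 z + 2 * abs2 w.
Proof.
case: z w => a b [a' b']; rewrite /abs2 /=.
have := sqr_ge0 (a - a'); have := sqr_ge0 (b - b'); nra.
Qed.

Lemma L2normE f : L2norm mu f = ((\int[mu]_x (abs2 (f x))%:E) `^ 2^-1)%E.
Proof.
rewrite /L2norm unlock; congr (_ `^ _)%E; apply: eq_integral => x _.
rewrite /= ger0_norm; last by case: (f x) => a b; exact: sqrtr_ge0.
rewrite powR_mulrn ?normc_abs2//.
by case: (f x) => a b; exact: sqrtr_ge0.
Qed.

Lemma measurable_abs2 f : measurable_fun setT (Re \o f) ->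
  measurable_fun setT (Im \o f) -> measurable_fun setT (fun x => abs2 (f x)).
Proof. by move=> mr mi; apply: measurable_funD; exact: measurable_funX. Qed.

Lemma L2P f : L2 mu f <-> [/\ measurable_fun setT (Re \o f),
  measurable_fun setT (Im \o f) & mu.-integrable setT (EFin \o (abs2 \o f))].
Proof.
split=> [[mr mi l]|[mr mi /integrableP[_ l]]]; split => //.
  apply/integrableP; split.
    by apply/measurable_EFinP; exact: measurable_abs2.
  under eq_integral do rewrite /= ger0_norm ?abs2_ge0//.
  have : (L2norm mu f `^ 2 < +oo)%E by exact: poweR_lty.
  by rewrite L2normE -poweRrM mulVf ?poweRe1// integral_ge0// => x _; rewrite lee_fin abs2_ge0.
rewrite L2normE poweR_lty//.
by move: l; under eq_integral do rewrite /= ger0_norm ?abs2_ge0//.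
Qed.

Lemma L2_integrable f : L2 mu f -> mu.-integrable setT (EFin \o (abs2 \o f)).
Proof. by case/L2P. Qed.

Lemma sqnorm_ge0 f : 0 <= sqnorm f.
Proof. by apply: Rintegral_ge0 => x _; exact: abs2_ge0. Qed.

Lemma L2norm_sqrt f : L2 mu f -> L2norm mu f = (Num.sqrt (sqnorm f))%:E.
Proof.
case/L2P => _ _ l; rewrite L2normE -(@fineK _ (\int[mu]_x _)%E).
  by rewrite poweR_EFin powR12_sqrt// sqnorm_ge0.
exact: integrable_fin_num.
Qed.

Lemma L2norm_lt f eps : 0 < eps -> L2 mu f ->
  (L2norm mu f < eps%:E)%E = (sqnorm f < eps ^+ 2).
Proof.
move=> e0 l; rewrite L2norm_sqrt// lte_fin.
rewrite -[LHS](ltr_pXn2r (ltn0Sn 1)) ?nnegrE ?sqrtr_ge0 ?ltW//.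
by rewrite sqr_sqrtr// sqnorm_ge0.
Qed.

Lemma L2_dominated f (h : T -> R) : measurable_fun setT (Re \o f) ->
  measurable_fun setT (Im \o f) -> mu.-integrable setT (EFin \o h) ->
  (forall x, abs2 (f x) <= h x) -> L2 mu f.
Proof.
move=> mr mi ih le_fh; apply/L2P; split=> //.
apply: le_integrable ih => //; first by apply/measurable_EFinP; exact: measurable_abs2.
move=> x _ /=; rewrite lee_fin ger0_norm ?abs2_ge0// ger0_norm//.
exact: le_trans (abs2_ge0 _) (le_fh x).
Qed.

Lemma measurable_ReD f g : measurable_fun setT (Re \o f) ->
  measurable_fun setT (Re \o g) -> measurable_fun setT (fun x => Re (f x + g x)).
Proof.
move=> mf mg; rewrite (_ : (fun _ => _) = (Re \o f) \+ (Re \o g)).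
  exact: measurable_funD.
by apply/funext => x /=; case: (f x) (g x) => a b [].
Qed.

Lemma measurable_ImD f g : measurable_fun setT (Im \o f) ->
  measurable_fun setT (Im \o g) -> measurable_fun setT (fun x => Im (f x + g x)).
Proof.
move=> mf mg; rewrite (_ : (fun _ => _) = (Im \o f) \+ (Im \o g)).
  exact: measurable_funD.
by apply/funext => x /=; case: (f x) (g x) => a b [].
Qed.

Lemma L2D f g : L2 mu f -> L2 mu g -> L2 mu (fun x => f x + g x).
Proof.
move=> /L2P[fr fi f2] /L2P[gr gi g2].
apply: (@L2_dominated _ (fun x => 2 * abs2 (f x) + 2 * abs2 (g x))).
- exact: measurable_ReD.
- exact: measurable_ImD.
- have := integrableD measurableT (integrableZl measurableT 2 f2)
    (integrableZl measurableT 2 g2).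
  by apply: eq_integrable.
- by move=> x; exact: abs2D_le.
Qed.

Lemma L2Z c f : L2 mu f -> L2 mu (fun x => c * f x).
Proof.
move=> /L2P[fr fi f2].
apply: (@L2_dominated _ (fun x => abs2 c * abs2 (f x))).
- rewrite (_ : _ \o _ = (fun x => Re c * (Re \o f) x - Im c * (Im \o f) x)).
    by apply: measurable_funB; exact: measurable_funM.
  by apply/funext => x /=; case: c (f x) => a b [].
- rewrite (_ : _ \o _ = (fun x => Re c * (Im \o f) x + Im c * (Re \o f) x)).
    by apply: measurable_funD; exact: measurable_funM.
  by apply/funext => x /=; case: c (f x) => a b [].
- by have := integrableZl measurableT (abs2 c) f2; apply: eq_integrable.
- by move=> x; rewrite abs2M.
Qed.

Lemma L2_0 : L2 mu (fun=> 0).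
Proof.
apply: (@L2_dominated _ (fun=> 0)).
- exact: measurable_cst.
- exact: measurable_cst.
- exact: (@integrable0 _ _ _ mu setT).
- by move=> x; rewrite /abs2 /= expr0n addr0.
Qed.

Lemma L2N f : L2 mu f -> L2 mu (fun x => - f x).
Proof. by move=> /(L2Z (-1)); under eq_fun do rewrite mulN1r. Qed.

Lemma L2B f g : L2 mu f -> L2 mu g -> L2 mu (fun x => f x - g x).
Proof. by move=> lf lg; apply: L2D => //; exact: L2N. Qed.

Lemma L2_sum (I : eqType) (s : seq I) (F : I -> T -> R[i]) :
  {in s, forall i, L2 mu (F i)} -> L2 mu (fun x => \sum_(i <- s) F i x).
Proof.
elim: s => [|i s IH] h.
  by under eq_fun do rewrite big_nil; exact: L2_0.
under eq_fun do rewrite big_cons; apply: L2D; first by apply: h; rewrite mem_head.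
by apply: IH => j js; apply: h; rewrite in_cons js orbT.
Qed.

Lemma measurable_mulJ f g :
  measurable_fun setT (Re \o f) -> measurable_fun setT (Im \o f) ->
  measurable_fun setT (Re \o g) -> measurable_fun setT (Im \o g) ->
  measurable_fun setT (fun x => Re (f x * (g x)^*)) /\
  measurable_fun setT (fun x => Im (f x * (g x)^*)).
Proof.
move=> fr fi gr gi; split.
  rewrite (_ : (fun _ => _) = (fun x => (Re \o f) x * (Re \o g) x + (Im \o f) x * (Im \o g) x)).
    by apply: measurable_funD; exact: measurable_funM.
  by apply/funext => x /=; case: (f x) (g x) => a b [a' b'] /=; ring.
rewrite (_ : (fun _ => _) = (fun x => (Im \o f) x * (Re \o g) x - (Re \o f) x * (Im \o g) x)).
  by apply: measurable_funB; exact: measurable_funM.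
by apply/funext => x /=; case: (f x) (g x) => a b [a' b'] /=; ring.
Qed.

Lemma L2_mulJ_integrable f g : L2 mu f -> L2 mu g ->
  mu.-integrable setT (EFin \o (fun x => Re (f x * (g x)^*))) /\
  mu.-integrable setT (EFin \o (fun x => Im (f x * (g x)^*))).
Proof.
move=> /L2P[fr fi f2] /L2P[gr gi g2].
have [mr mi] := measurable_mulJ fr fi gr gi.
have D : mu.-integrable setT (EFin \o (fun x => abs2 (f x) + abs2 (g x))).
  by have := integrableD measurableT f2 g2; apply: eq_integrable.
have s0 x : 0 <= abs2 (f x) + abs2 (g x) by rewrite addr_ge0// abs2_ge0.
split; (apply: le_integrable D => //; first exact/measurable_EFinP);
  move=> x _ /=; rewrite lee_fin (ger0_norm (s0 x));
  case: (f x) (g x) => a b [a' b']; rewrite /abs2/= ler_norml; apply/andP; split.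
- have := sqr_ge0 (a - a'); have := sqr_ge0 (b - b');
  have := sqr_ge0 (a + a'); have := sqr_ge0 (b + b'); nra.
- have := sqr_ge0 (a - a'); have := sqr_ge0 (b - b');
  have := sqr_ge0 (a + a'); have := sqr_ge0 (b + b'); nra.
- have := sqr_ge0 (a - b'); have := sqr_ge0 (b - a');
  have := sqr_ge0 (a + b'); have := sqr_ge0 (b + a'); nra.
- have := sqr_ge0 (a - b'); have := sqr_ge0 (b - a');
  have := sqr_ge0 (a + b'); have := sqr_ge0 (b + a'); nra.
Qed.

Lemma innerDl f1 f2 g : L2 mu f1 -> L2 mu f2 -> L2 mu g ->
  inner mu (fun x => f1 x + f2 x) g = inner mu f1 g + inner mu f2 g.
Proof.
move=> l1 l2 lg; have [r1 i1] := L2_mulJ_integrable l1 lg.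
have [r2 i2] := L2_mulJ_integrable l2 lg.
apply/eqP; rewrite eq_complex /=; apply/andP; split; apply/eqP.
  rewrite -RintegralD//; apply: eq_Rintegral => x _.
  by case: (f1 x) (f2 x) (g x) => ? ? [? ?] [? ?] /=; ring.
rewrite -RintegralD//; apply: eq_Rintegral => x _.
by case: (f1 x) (f2 x) (g x) => ? ? [? ?] [? ?] /=; ring.
Qed.

Lemma innerZl c f g : L2 mu f -> L2 mu g ->
  inner mu (fun x => c * f x) g = c * inner mu f g.
Proof.
move=> lf lg; have [r i] := L2_mulJ_integrable lf lg.
have Z k h : mu.-integrable setT (EFin \o h) ->
    mu.-integrable setT (EFin \o (fun x => k * h x)).
  by move=> /(integrableZl measurableT k); apply: eq_integrable.
case: c => a b; apply/eqP; rewrite eq_complex /=; apply/andP; split; apply/eqP.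
  rewrite -!RintegralZl// -RintegralB//; [|exact: Z|exact: Z].
  apply: eq_Rintegral => x _.
  by case: (f x) (g x) => ? ? [? ?] /=; ring.
rewrite -!RintegralZl// -RintegralD//; [|exact: Z|exact: Z].
apply: eq_Rintegral => x _.
by case: (f x) (g x) => ? ? [? ?] /=; ring.
Qed.

Lemma innerC f g : L2 mu f -> L2 mu g -> inner mu g f = conjc (inner mu f g).
Proof.
move=> lf lg; have [r i] := L2_mulJ_integrable lf lg.
apply/eqP; rewrite eq_complex /=; apply/andP; split; apply/eqP.
  by apply: eq_Rintegral => x _; case: (f x) (g x) => ? ? [? ?] /=; ring.
rewrite -mulN1r -RintegralZl//; apply: eq_Rintegral => x _.
by case: (f x) (g x) => ? ? [? ?] /=; ring.
Qed.

Lemma inner_norm f : inner mu f f = (sqnorm f)%:C.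
Proof.
rewrite /inner /Cintegral; congr (_ +i* _).
  by apply: eq_Rintegral => x _; rewrite mulc_conj.
under eq_Rintegral do rewrite mulc_conj.
by rewrite /Rintegral integral0.
Qed.

Lemma inner_suml (I : eqType) (s : seq I) (c : I -> R[i]) (F : I -> T -> R[i]) g :
  {in s, forall i, L2 mu (F i)} -> L2 mu g ->
  inner mu (fun x => \sum_(i <- s) c i * F i x) g =
  \sum_(i <- s) c i * inner mu (F i) g.
Proof.
move=> h lg; elim: s h => [|i s IH] h.
  rewrite big_nil (_ : (fun _ => _) = (fun x => 0 * 0)).
    by rewrite innerZl ?mul0r//; exact: L2_0.
  by apply/funext => x; rewrite big_nil mul0r.
rewrite big_cons.
have hi : L2 mu (F i) by apply: h; rewrite mem_head.
have hs : {in s, forall i, L2 mu (F i)} by move=> j js; apply: h; rewrite in_cons js orbT.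
rewrite -innerZl// -IH// -innerDl//; last 2 first.
- exact: L2Z.
- by apply: L2_sum => j js; apply: L2Z; exact: hs.
by congr inner; apply/funext => x; rewrite big_cons.
Qed.

Lemma inner_sumr (I : eqType) (s : seq I) (c : I -> R[i]) (F : I -> T -> R[i]) g :
  {in s, forall i, L2 mu (F i)} -> L2 mu g ->
  inner mu g (fun x => \sum_(i <- s) c i * F i x) =
  \sum_(i <- s) conjc (c i) * inner mu g (F i).
Proof.
move=> h lg; rewrite innerC//; last first.
  by apply: L2_sum => j js; apply: L2Z; exact: h.
rewrite inner_suml// conjc_sum big_seq [RHS]big_seq; apply: eq_bigr => i iS.
by rewrite conjcM; congr (_ * _); rewrite -innerC; [|exact: h|].
Qed.

Lemma sqnormD_le f g : L2 mu f -> L2 mu g ->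
  sqnorm (fun x => f x + g x) <= 2 * sqnorm f + 2 * sqnorm g.
Proof.
move=> lf lg; have /L2P[_ _ h] := L2D lf lg.
have /L2P[_ _ f2] := lf; have /L2P[_ _ g2] := lg.
have f2' := integrableZl measurableT 2 f2; have g2' := integrableZl measurableT 2 g2.
rewrite /sqnorm -!RintegralZl// -RintegralD//; apply: le_Rintegral => //.
  by have := integrableD measurableT f2' g2'; apply: eq_integrable.
by move=> x _; exact: abs2D_le.
Qed.

Lemma sqnormN f : sqnorm (fun x => - f x) = sqnorm f.
Proof. by apply: eq_Rintegral => x _; rewrite abs2N. Qed.

Lemma sqnormB_le f g : L2 mu f -> L2 mu g ->
  sqnorm (fun x => f x - g x) <= 2 * sqnorm f + 2 * sqnorm g.
Proof. by move=> lf lg; rewrite -(sqnormN g); apply: sqnormD_le => //; exact: L2N. Qed.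

Lemma sqnorm_ae f g : L2 mu f -> L2 mu g -> {ae mu, forall x, f x = g x} ->
  sqnorm f = sqnorm g.
Proof.
move=> /L2P[fr fi _] /L2P[gr gi _] fg; congr fine; apply: ae_eq_integral => //.
- by apply/measurable_EFinP; exact: measurable_abs2.
- by apply/measurable_EFinP; exact: measurable_abs2.
- by apply: filterS fg => x /= ->.
Qed.

Lemma inner_aer f g g' : L2 mu f -> L2 mu g -> L2 mu g' ->
  {ae mu, forall x, g x = g' x} -> inner mu f g = inner mu f g'.
Proof.
move=> /L2P[fr fi _] /L2P[gr gi _] /L2P[gr' gi' _] fg.
have [? ?] := measurable_mulJ fr fi gr gi.
have [? ?] := measurable_mulJ fr fi gr' gi'.
congr (_ +i* _); congr fine; apply: ae_eq_integral => //;
  try exact/measurable_EFinP; by apply: filterS fg => x /= ->.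
Qed.

Lemma inner_ael f g g' : L2 mu f -> L2 mu g -> L2 mu g' ->
  {ae mu, forall x, g x = g' x} -> inner mu g f = inner mu g' f.
Proof. by move=> lf lg lg' gg'; rewrite innerC// (inner_aer lf lg lg' gg') -innerC. Qed.

End ComplexL2Theory.

Lemma fast_cauchy_cvg (R : realType) (r : R^nat) (w : R) :
  (forall k, 4 ^+ k * (r k.+1 - r k) ^+ 2 <= w) -> cvgn r.
Proof.
move=> h.
have -> : r = (fun n => r 0%N + series (telescope r) n).
  by apply/funext => n; rewrite [LHS]eq_sum_telescope.
apply: is_cvgD; first exact: is_cvg_cst.
apply: normed_cvg; apply: (@series_le_cvg _ _ (geometric (Num.sqrt w) 2^-1)).
- by move=> n /=.
- by move=> n /=; rewrite mulr_ge0 ?sqrtr_ge0// exprn_ge0.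
- move=> n /=; rewrite exprVn ler_pdivlMr ?exprn_gt0//.
  rewrite -(ger0_norm (_ : 0 <= 2 ^+ n)) ?exprn_ge0// -normrM -sqrtr_sqr.
  rewrite ler_wsqrtr// exprMn mulrC -exprM mulnC exprM.
  by rewrite (_ : 2 ^+ 2 = 4 :> R) ?h//; ring.
- by apply: is_cvg_geometric_series; rewrite ger0_norm// invf_lt1// ltr1n.
Qed.

Section L2Complete.
Context {R : realType} {d : measure_display} {T : measurableType d}.
Variable mu : {measure set T -> \bar R}.
Local Notation Re := (@complex.Re R).
Local Notation Im := (@complex.Im R).

Lemma measurable_cvg_set_fast (u : nat -> T -> R[i]) :
  (forall k, L2 mu (u k)) ->
  (forall k, sqnorm mu (fun x => u k.+1 x - u k x) <= (8^-1) ^+ k) ->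
  exists D : set T, [/\ measurable D, mu (~` D) = 0%E &
    forall x, D x -> cvgn (fun k => Re (u k x)) /\ cvgn (fun k => Im (u k x))].
Proof.
move=> u2 hu.
(* Where [W] is finite the increments are O(2^-k), so the sequence converges. *)
pose W x := (\sum_(k <oo) (4 ^+ k * abs2 (u k.+1 x - u k x))%:E)%E.
have mW k : measurable_fun setT (fun x => (4 ^+ k * abs2 (u k.+1 x - u k x))%:E).
  apply/measurable_EFinP; apply: measurable_funM => //.
  by have /L2P[mr mi _] := L2B (u2 k.+1) (u2 k); exact: measurable_abs2.
have W0 k x : (0 <= (4 ^+ k * abs2 (u k.+1 x - u k x))%:E)%E.
  by rewrite lee_fin mulr_ge0 ?abs2_ge0// exprn_ge0.
have mW' : measurable_fun setT W.
  by apply: ge0_emeasurable_sum => // k x _ _.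
have iW : mu.-integrable setT W.
  apply/integrableP; split => //.
  under eq_integral => x _ do rewrite gee0_abs ?nneseries_ge0//.
  rewrite integral_nneseries//.
  have b k : (\int[mu]_x (4 ^+ k * abs2 (u k.+1 x - u k x))%:E <= ((2^-1) ^+ k)%:E)%E.
    have l2 := L2_integrable (L2B (u2 k.+1) (u2 k)).
    under eq_integral do rewrite EFinM.
    rewrite integralZl// -(@fineK _ (integral _ _ _)); last exact: integrable_fin_num.
    rewrite -EFinM lee_fin.
    have -> : (2^-1) ^+ k = 4 ^+ k * (8^-1) ^+ k :> R.
      by rewrite -exprMn; congr (_ ^+ _); lra.
    by rewrite ler_wpM2l ?exprn_ge0//; exact: hu.
  apply: (@le_lt_trans _ _ (\sum_(k <oo) ((2^-1) ^+ k)%:E)%E).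
    by apply: lee_nneseries => // k _ _; apply: integral_ge0.
  have cv : cvgn (series (geometric (1:R) 2^-1)).
    by apply: is_cvg_geometric_series; rewrite ger0_norm// invf_lt1// ltr1n.
  rewrite (_ : (fun n => _) = EFin \o series (geometric (1:R) 2^-1)); last first.
    by apply/funext => n /=; rewrite -sumEFin /=; apply: eq_bigr => i _; rewrite mul1r.
  by rewrite EFin_lim// ltry.
exists [set x | W x < +oo]%E.
have mD : measurable [set x | W x < +oo]%E.
  by rewrite -[X in measurable X]setTI; apply: emeasurable_fun_infty_o.
split => //.
  have [N [mN N0 sN]] := integrable_ae measurableT iW.
  apply/eqP; rewrite eq_le measure_ge0 andbT -N0.
  apply: le_measure; rewrite ?inE//; first exact: measurableC.
  move=> x /= Wx; apply: sN => /= /(_ I) fx; apply: Wx.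
  by rewrite ltey_eq fx.
move=> x /= Wx.
have W0' : (0 <= W x)%E by exact: nneseries_ge0.
have b k : 4 ^+ k * abs2 (u k.+1 x - u k x) <= fine (W x).
  rewrite -lee_fin fineK ?ge0_fin_numE//.
  apply: le_trans (nneseries_lim_ge k.+1 _) => //.
  by rewrite big_nat_recr//= leeDr// sume_ge0.
have e k : 0 <= 4 ^+ k :> R by rewrite exprn_ge0.
split; apply: (@fast_cauchy_cvg _ _ (fine (W x))) => k.
  apply: le_trans (b k); apply: ler_wpM2l => //.
  by rewrite /abs2; case: (u k.+1 x) (u k x) => ? ? [? ?] /=; rewrite lerDl sqr_ge0.
apply: le_trans (b k); apply: ler_wpM2l => //.
by rewrite /abs2; case: (u k.+1 x) (u k x) => ? ? [? ?] /=; rewrite lerDr sqr_ge0.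
Qed.

Lemma L2_fast_complete (u : nat -> T -> R[i]) :
  (forall k, L2 mu (u k)) ->
  (forall k, sqnorm mu (fun x => u k.+1 x - u k x) <= (8^-1) ^+ k) ->
  exists2 g, measurable_fun setT (Re \o g) /\ measurable_fun setT (Im \o g) &
   forall (f : T -> R[i]) (c : R), L2 mu f ->
    (\forall k \near \oo, sqnorm mu (fun x => u k x - f x) <= c) ->
    L2 mu (fun x => g x - f x) /\ sqnorm mu (fun x => g x - f x) <= c.
Proof.
move=> u2 hu; have [D [mD D0 cD]] := measurable_cvg_set_fast u2 hu.
pose gr x := limn (fun k => Re (u k x)) * \1_D x.
pose gi x := limn (fun k => Im (u k x)) * \1_D x.
have cvr x : (fun k => Re (u k x) * \1_D x) @ \oo --> gr x.
  have [Dx|nDx] := pselect (D x).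
    by apply: cvgMl; have [+ _] := cD _ Dx.
  rewrite /gr indicE memNset// mulr0.
  by under eq_fun do rewrite mulr0; exact: cvg_cst.
have cvi x : (fun k => Im (u k x) * \1_D x) @ \oo --> gi x.
  have [Dx|nDx] := pselect (D x).
    by apply: cvgMl; have [_ +] := cD _ Dx.
  rewrite /gi indicE memNset// mulr0.
  by under eq_fun do rewrite mulr0; exact: cvg_cst.
have mgr : measurable_fun setT gr.
  apply: (@measurable_fun_cvg _ _ _ _ (fun k x => Re (u k x) * \1_D x)).
    by move=> k; apply: measurable_funM => //; have /L2P[] := u2 k.
  by move=> x _; exact: cvr.
have mgi : measurable_fun setT gi.
  apply: (@measurable_fun_cvg _ _ _ _ (fun k x => Im (u k x) * \1_D x)).
    by move=> k; apply: measurable_funM => //; have /L2P[] := u2 k.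
  by move=> x _; exact: cvi.
exists (fun x => gr x +i* gi x); first by split.
move=> f c lf nearc.
pose F k x := (abs2 (u k x - f x))%:E.
have F0 k x : (0 <= F k x)%E by rewrite lee_fin abs2_ge0.
have mF k : measurable_fun setT (F k).
  by have /L2P[mr mi _] := L2B (u2 k) lf; apply/measurable_EFinP; exact: measurable_abs2.
have cvF x : D x -> (fun k => F k x) @ \oo --> (abs2 (gr x +i* gi x - f x))%:E.
  move=> Dx; apply: cvg_EFin; first exact: nearW.
  rewrite (_ : fine \o _ = fun k => (Re (u k x) * \1_D x - Re (f x)) ^+ 2 +
     (Im (u k x) * \1_D x - Im (f x)) ^+ 2); last first.
    apply/funext => k; rewrite /F /abs2 /= indicE mem_set// !mulr1.
    by case: (u k x) (f x) => ? ? [].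
  have -> : abs2 (gr x +i* gi x - f x) = (gr x - Re (f x)) ^+ 2 + (gi x - Im (f x)) ^+ 2.
    by rewrite /abs2; case: (f x).
  have sq (v : R^nat) (l : R) : v @ \oo --> l -> (fun k => v k ^+ 2) @ \oo --> l ^+ 2.
    by move=> vl; rewrite expr2; under eq_fun do rewrite expr2; exact: cvgM.
  apply: cvgD; apply: sq.
  - by apply: cvgB; [exact: cvr|exact: cvg_cst].
  - by apply: cvgB; [exact: cvi|exact: cvg_cst].
have mh : measurable_fun setT (fun x => (abs2 (gr x +i* gi x - f x))%:E).
  have /L2P[fr fi _] := lf.
  by apply/measurable_EFinP; apply: measurable_abs2; [apply: (measurable_ReD (g := fun x => - f x))|
    apply: (measurable_ImD (g := fun x => - f x))] => //;
    have /L2P[] := L2N lf.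
have hc : (\int[mu]_x (abs2 (gr x +i* gi x - f x))%:E <= c%:E)%E.
  rewrite (@ge0_negligible_integral _ _ _ _ _ (~` D))//; last 2 first.
  - exact: measurableC.
  - by move=> x _; rewrite lee_fin abs2_ge0.
  rewrite setTD setCK.
  have := fatou mu mD (fun k => measurable_funS measurableT (@subsetT _ D) (mF k)) (fun k x _ => F0 k x).
  rewrite (eq_integral (fun x => (abs2 (gr x +i* gi x - f x))%:E)); last first.
    by move=> x /set_mem Dx; have [-> _] := cvg_limn_einf_sup (cvF x Dx).
  move=> /le_trans; apply.
  rewrite limn_einf_lim; apply: lime_le; first exact: is_cvg_einfs.
  apply: filterS nearc => k kc.
  apply: (@le_trans _ _ (\int[mu]_(x in D) F k x)%E).
    by apply: ereal_inf_lbound; exists k => /=.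
  apply: (@le_trans _ _ (\int[mu]_x F k x)%E).
    by apply: ge0_subset_integral.
  rewrite -(@fineK _ (integral _ _ _)) ?lee_fin//.
  exact: integrable_fin_num (L2_integrable (L2B (u2 k) lf)).
have lgf : L2 mu (fun x => gr x +i* gi x - f x).
  have /L2P[fr fi _] := lf; have /L2P[fr' fi' _] := L2N lf.
  apply/L2P; split.
  - exact: (measurable_ReD (g := fun x => - f x)).
  - exact: (measurable_ImD (g := fun x => - f x)).
  - apply/integrableP; split => //.
    under eq_integral do rewrite /= ger0_norm ?abs2_ge0//.
    exact: le_lt_trans hc (ltry _).
split => //; rewrite -lee_fin.
rewrite /sqnorm /Rintegral fineK//; exact: integrable_fin_num (L2_integrable lgf).
Qed.

Theorem L2_complete (S : nat -> T -> R[i]) :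
  (forall k, L2 mu (S k)) ->
  (forall eps : R, 0 < eps -> exists M0, forall M, (M0 <= M)%N ->
     sqnorm mu (fun x => S M x - S M0 x) < eps) ->
  exists2 g, L2 mu g & forall eps : R, 0 < eps -> exists M0, forall M, (M0 <= M)%N ->
     sqnorm mu (fun x => g x - S M x) <= eps.
Proof.
move=> S2 cauchy.
have tri M0 eps : (forall M, (M0 <= M)%N -> sqnorm mu (fun x => S M x - S M0 x) < eps / 4) ->
    forall M M', (M0 <= M)%N -> (M0 <= M')%N ->
    sqnorm mu (fun x => S M x - S M' x) <= eps.
  move=> h M M' /h hM /h hM'.
  have := sqnormB_le (L2B (S2 M) (S2 M0)) (L2B (S2 M') (S2 M0)).
  under eq_fun do rewrite opprB addrA subrK.
  by move=> /le_trans; apply; lra.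
have /choice[N hN] : forall k, exists M0, forall M M', (M0 <= M)%N -> (M0 <= M')%N ->
    sqnorm mu (fun x => S M x - S M' x) <= (8^-1) ^+ k.
  move=> k; have [|M0 h] := cauchy ((8^-1) ^+ k / 4).
    by rewrite divr_gt0// exprn_gt0.
  by exists M0; exact: tri.
pose m k := (k + \sum_(j < k.+1) N j)%N.
have mN k : (N k <= m k)%N.
  by rewrite /m big_ord_recr /= addnA leq_addl.
have mN' k : (N k <= m k.+1)%N.
  by rewrite /m 2!big_ord_recr /= addnA -!addnA (leq_trans _ (leq_addl _ _))// (leq_trans _ (leq_addl _ _))// leq_addr.
have [g [mgr mgi] hg] := @L2_fast_complete (S \o m) (fun k => S2 _)
  (fun k => hN k _ _ (mN' k) (mN k)).
have key M0 eps : (forall M, (M0 <= M)%N -> sqnorm mu (fun x => S M x - S M0 x) < eps / 4) ->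
    forall M, (M0 <= M)%N -> L2 mu (fun x => g x - S M x) /\ sqnorm mu (fun x => g x - S M x) <= eps.
  move=> h M M0M; apply: hg => //; exists M0 => // k /= M0k; apply: tri h _ _ _ _ => //.
  exact: leq_trans M0k (leq_addr _ _).
exists g.
  have [M0 h] := cauchy (1 / 4) ltac:(lra).
  have [l2 _] := key M0 1 h M0 (leqnn _).
  by have := L2D l2 (S2 M0); under eq_fun do rewrite subrK.
move=> eps e0; have [|M0 h] := cauchy (eps / 4); first lra.
by exists M0 => M /(key M0 eps h)[].
Qed.

End L2Complete.

Lemma big_fset_split (I : choiceType) (V : zmodType) (J K : {fset I}) (F : I -> V) :
  (J `<=` K)%fset ->
  \sum_(i <- K) F i = \sum_(i <- J) F i + \sum_(i <- (K `\` J)%fset) F i.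
Proof.
move=> JK; rewrite (big_fsetID _ (mem J) K); congr (_ + _); apply: perm_big.
  apply: uniq_perm; rewrite ?fset_uniq// => i; rewrite !inE /=.
  by case: (boolP (i \in J)) => iJ; rewrite ?andbF// (fsubsetP JK).
by apply: uniq_perm; rewrite ?fset_uniq// => i; rewrite !inE /= andbC.
Qed.

Lemma nondecreasing_bounded_cauchy (R : realType) (a : R^nat) (B : R) :
  {homo a : m n / (m <= n)%N >-> m <= n} -> (forall n, a n <= B) ->
  forall eps, 0 < eps -> exists M, forall n, (M <= n)%N -> a n - a M < eps.
Proof.
move=> nd ub eps e0; have hs : has_sup (range a).
  by split; [exists (a 0%N), 0%N|exists B => _ [n _ <-]].
have [_ [M _ <-] hM] := sup_adherent e0 hs.
exists M => n Mn; have : a n <= sup (range a) by apply: sup_upper_bound => //; exists n.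
lra.
Qed.

Section Spectral.
Context {R : realType} {d : measure_display} {T : measurableType d}.
Variable mu : {measure set T -> \bar R}.

Definition L2_orthonormal (I : eqType) (e : I -> T -> R[i]) :=
  (forall i, L2 mu (e i)) /\ (forall i j, inner mu (e i) (e j) = (i == j)%:R).

Lemma L2_lincomb (I : eqType) (e : I -> T -> R[i]) (s : seq I) (c : I -> R[i]) :
  L2_orthonormal e -> L2 mu (fun x => \sum_(i <- s) c i * e i x).
Proof. by move=> [e2 _]; apply: L2_sum => i _; exact: L2Z. Qed.

Lemma inner_lincomb (I : choiceType) (e : I -> T -> R[i]) (s : {fset I}) (c : I -> R[i]) j :
  L2_orthonormal e ->
  inner mu (fun x => \sum_(i <- s) c i * e i x) (e j) = c j *+ (j \in s).
Proof.
move=> [e2 eo]; rewrite inner_suml//; under eq_bigr do rewrite eo.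
case: (boolP (j \in s)) => js.
  rewrite (big_fsetD1 j)//= eqxx mulr1 big_seq big1 ?addr0// => i.
  by rewrite !inE => /andP[/negPf-> _]; rewrite mulr0.
rewrite big_seq big1// => i ini; case: eqP => [ij|_]; last by rewrite mulr0.
by rewrite -ij ini in js.
Qed.

Lemma sqnorm_lincomb (I : choiceType) (e : I -> T -> R[i]) (s : {fset I}) (c : I -> R[i]) :
  L2_orthonormal e ->
  sqnorm mu (fun x => \sum_(i <- s) c i * e i x) = \sum_(i <- s) abs2 (c i).
Proof.
move=> oe; have [e2 _] := oe; apply: (@complexI R); rewrite -inner_norm.
rewrite inner_sumr//; last exact: L2_lincomb.
rewrite (raddf_sum (real_complex R)) big_seq [RHS]big_seq; apply: eq_bigr => i si.
by rewrite inner_lincomb// si mulr1n mulrC mulc_conj.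
Qed.

Section OneBasis.
Variables (I : choiceType) (deg : I -> nat) (J : nat -> {fset I}) (lam : I -> R).
Variable e : I -> T -> R[i].
Hypothesis memJ : forall M i, (i \in J M) = (deg i < M)%N.
Hypothesis oe : L2_orthonormal e.

Let a f i := (lam i)%:C * inner mu f (e i).
Definition spectral_partial f M x := \sum_(i <- J M) (lam i)%:C * inner mu f (e i) * e i x.
Local Notation S := spectral_partial.

Lemma homo_levels M N : (M <= N)%N -> (J M `<=` J N)%fset.
Proof. by move=> MN; apply/fsubsetP => i; rewrite !memJ => /leq_trans; apply. Qed.

Lemma levels_cofinal (K : {fset I}) : exists M, (K `<=` J M)%fset.
Proof.
exists (\max_(i <- K) deg i).+1; apply/fsubsetP => i iK.
by rewrite memJ ltnS (big_rem i)//= leq_maxl.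
Qed.

Lemma spectral_domP f : spectral_dom mu lam e f <->
  L2 mu f /\ exists B, forall M, sqnorm mu (S f M) <= B.
Proof.
have abs2E i : (Normc.normc ((lam i)%:C * inner mu f (e i)) ^+ 2)%:E = (abs2 (a f i))%:E.
  by rewrite normc_abs2.
have E0 (K : {fset I}) : 0 <= \sum_(i <- K) abs2 (a f i).
  by apply: sumr_ge0 => i _; exact: abs2_ge0.
split=> -[f2].
  under eq_esum do rewrite abs2E.
  set s := esum _ _ => soo; split => //.
  have s0 : (0 <= s)%E by apply: esum_ge0 => i _; rewrite lee_fin abs2_ge0.
  exists (fine s) => M; rewrite sqnorm_lincomb// -lee_fin fineK ?ge0_fin_numE//.
  apply: esum_ge; exists [set` J M]; first by split => //; exact: finite_fset.
  by rewrite fsbig_finite//= set_fsetK sumEFin.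
move=> [B hB]; split => //; under eq_esum do rewrite abs2E.
apply: (@le_lt_trans _ _ B%:E); last exact: ltry.
apply: ge_ereal_sup => _ /= [A [finA _] <-].
rewrite fsbig_finite//= sumEFin lee_fin.
have [M AM] := levels_cofinal (fset_set A).
apply: le_trans (hB M); rewrite sqnorm_lincomb//.
by rewrite (big_fset_split _ AM) lerDl.
Qed.

Lemma spectral_partial_cauchy f : spectral_dom mu lam e f -> forall eps : R, 0 < eps ->
  exists M, forall K : {fset I}, (J M `<=` K)%fset ->
    \sum_(i <- (K `\` J M)%fset) abs2 (a f i) < eps.
Proof.
move=> /spectral_domP[f2 [B hB]] eps e0.
have [|M hM] := @nondecreasing_bounded_cauchy _ (fun M => sqnorm mu (S f M)) B _ hB _ e0.
  move=> m n mn; rewrite !sqnorm_lincomb// (big_fset_split _ (homo_levels mn)) lerDl.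
  by apply: sumr_ge0 => i _; exact: abs2_ge0.
exists M => K JK; have [N KN] := levels_cofinal K.
have JJ : (J M `<=` J (maxn M N))%fset by apply: homo_levels; exact: leq_maxl.
apply: le_lt_trans (hM (maxn M N) (leq_maxl _ _)).
rewrite !sqnorm_lincomb// (big_fset_split _ JJ) addrAC subrr add0r.
rewrite [leRHS](@big_fset_split _ _ (K `\` J M)%fset)/= ?lerDl.
  by apply: sumr_ge0 => i _; exact: abs2_ge0.
apply: fsetSD; apply: fsubset_trans KN _; apply: homo_levels; exact: leq_maxr.
Qed.

Lemma spectral_partialB f M (K : {fset I}) : (J M `<=` K)%fset ->
  sqnorm mu (fun x => \sum_(i <- K) a f i * e i x - S f M x) =
  \sum_(i <- (K `\` J M)%fset) abs2 (a f i).
Proof.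
move=> JK; rewrite -(sqnorm_lincomb _ _ oe); congr (sqnorm mu _).
by apply/funext => x; rewrite (big_fset_split _ JK) addrAC subrr add0r.
Qed.

Lemma spectral_graphP f g : spectral_graph mu lam e f g <->
  [/\ spectral_dom mu lam e f, L2 mu g & forall eps : R, 0 < eps -> exists M0, forall M,
     (M0 <= M)%N -> sqnorm mu (fun x => g x - S f M x) <= eps].
Proof.
split=> -[dom g2 h]; split => // eps e0.
  have se : 0 < Num.sqrt eps by rewrite sqrtr_gt0.
  have [J0 hJ] := h _ se; have [M0 JM] := levels_cofinal J0.
  exists M0 => M M0M; have := hJ (J M) (fsubset_trans JM (homo_levels M0M)).
  rewrite L2norm_lt ?sqr_sqrtr ?(ltW e0)//; first exact: ltW.
  by apply: L2B => //; exact: L2_lincomb.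
have e8 : 0 < eps ^+ 2 / 8 by rewrite divr_gt0// exprn_gt0.
have [M1 h1] := h _ e8; have [M2 h2] := spectral_partial_cauchy dom e8.
exists (J (maxn M1 M2)) => K JK.
have l2 M : L2 mu (fun x => g x - S f M x) by apply: L2B => //; exact: L2_lincomb.
rewrite L2norm_lt//; last by apply: L2B => //; exact: L2_lincomb.
have := sqnormB_le (l2 (maxn M1 M2)) (L2B (L2_lincomb K (a f) oe) (L2_lincomb (J (maxn M1 M2)) (a f) oe)).
under eq_fun do rewrite opprB addrA subrK.
move=> /le_lt_trans; apply; rewrite spectral_partialB//.
have J2 : (J M2 `<=` J (maxn M1 M2))%fset by apply: homo_levels; exact: leq_maxr.
have : \sum_(i <- (K `\` J (maxn M1 M2))%fset) abs2 (a f i) <= \sum_(i <- (K `\` J M2)%fset) abs2 (a f i).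
  rewrite [leRHS](@big_fset_split _ _ (K `\` J (maxn M1 M2))%fset)/= ?lerDl.
    by apply: sumr_ge0 => i _; exact: abs2_ge0.
  exact: fsetDS.
have := h2 K (fsubset_trans J2 JK); have := h1 _ (leq_maxl M1 M2).
have : 0 < eps ^+ 2 by rewrite exprn_gt0.
set x1 := sqnorm _ _; set x2 := \sum_(i <- _) _; set x3 := \sum_(i <- _) _; lra.
Qed.

Lemma spectral_graph_exists f : spectral_dom mu lam e f ->
  exists g, spectral_graph mu lam e f g.
Proof.
move=> dom; have [|eps e0|g g2 hg] := @L2_complete _ _ _ mu (S f).
- by move=> M; exact: L2_lincomb.
- have [M0 h] := spectral_partial_cauchy dom e0; exists M0 => M M0M.
  by rewrite spectral_partialB; [apply: h|]; exact: homo_levels.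
- by exists g; apply/spectral_graphP.
Qed.

End OneBasis.

Section TwoBases.
Variables (I I' : choiceType) (deg : I -> nat) (deg' : I' -> nat).
Variables (J : nat -> {fset I}) (J' : nat -> {fset I'}).
Hypothesis memJ : forall M i, (i \in J M) = (deg i < M)%N.
Hypothesis memJ' : forall M i, (i \in J' M) = (deg' i < M)%N.
Variables (lam : I -> R) (lam' : I' -> R).
Hypothesis lamE : forall i j, deg i = deg' j -> lam i = lam' j.
Variables (e : I -> T -> R[i]) (e' : I' -> T -> R[i]).
Hypothesis oe : L2_orthonormal e.
Hypothesis oe' : L2_orthonormal e'.
Hypothesis cross : forall i j, deg i <> deg' j -> inner mu (e i) (e' j) = 0.
Hypothesis span : forall i, exists (K : {fset I'}) (c : I' -> R[i]),
  {ae mu, forall x, e i x = \sum_(j <- K) c j * e' j x}.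
Hypothesis span' : forall j, exists (K : {fset I}) (c : I -> R[i]),
  {ae mu, forall x, e' j x = \sum_(i <- K) c i * e i x}.

Let expand (A B : choiceType) (u : A -> T -> R[i]) (v : B -> T -> R[i])
  (K L : {fset B}) (c : B -> R[i]) a :
  L2_orthonormal u -> L2_orthonormal v ->
  (forall b, b \notin L -> inner mu (u a) (v b) = 0) ->
  {ae mu, forall x, u a x = \sum_(b <- K) c b * v b x} ->
  {ae mu, forall x, u a x = \sum_(b <- L) inner mu (u a) (v b) * v b x}.
Proof.
move=> ou ov L0 h; have cE b : inner mu (u a) (v b) = c b *+ (b \in K).
  rewrite -(inner_lincomb K c b ov); apply: inner_ael h; first exact: ov.1.
    exact: ou.1.
  exact: L2_lincomb.
apply: filterS h => x ->.
transitivity (\sum_(b <- (K `|` L)%fset) inner mu (u a) (v b) * v b x).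
  rewrite -(big_fset_incl _ (fsubsetUl K L)); last first.
    by move=> b _ bK; rewrite cE (negPf bK) mul0r.
  by rewrite big_seq [RHS]big_seq; apply: eq_bigr => b bK; rewrite cE bK.
apply/esym/big_fset_incl; first exact: fsubsetUr.
by move=> b _ /L0 ->; rewrite mul0r.
Qed.

Lemma spectral_partial_ae f M : L2 mu f ->
  {ae mu, forall x, spectral_partial J lam e f M x = spectral_partial J' lam' e' f M x}.
Proof.
move=> f2.
have ex : {ae mu, forall x, forall i, i \in J M ->
    e i x = \sum_(j <- J' M) inner mu (e i) (e' j) * e' j x}.
  have : forall i, {ae mu, forall x, i \in J M ->
      e i x = \sum_(j <- J' M) inner mu (e i) (e' j) * e' j x}.
    move=> i; case: (boolP (i \in J M)) => iM; last exact: nearW.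
    have [K [c h]] := span i.
    have L0 j : j \notin J' M -> inner mu (e i) (e' j) = 0.
      by move=> jM; apply: cross => ij; move: jM; rewrite memJ' -ij -memJ iM.
    by apply: filterS (expand oe oe' L0 h).
  move=> H.
  have : {ae mu, forall x, forall i, i \in (J M : seq I) -> i \in J M ->
      e i x = \sum_(j <- J' M) inner mu (e i) (e' j) * e' j x}.
    elim: (J M : seq I) => [|i s IH]; first exact: nearW.
    move: IH (H i); apply: filterS2 => x IH hi k; rewrite in_cons => /orP[/eqP->//|]; exact: IH.
  by apply: filterS => x h i iJ; exact: h.
have fE j : j \in J' M -> inner mu f (e' j) = \sum_(i <- J M) inner mu (e i) (e' j) * inner mu f (e i).
  move=> jM; have [K [c h]] := span' j.
  have L0 i : i \notin J M -> inner mu (e' j) (e i) = 0.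
    move=> iM; rewrite (innerC (oe.1 i) (oe'.1 j)) cross ?conjc0// => ij.
    by move: iM; rewrite memJ ij -memJ' jM.
  rewrite (inner_aer f2 (oe'.1 j) _ (expand oe' oe L0 h)); last exact: L2_lincomb.
  rewrite inner_sumr//; last by move=> i _; exact: oe.1.
  by apply: eq_bigr => i _; rewrite (innerC (oe.1 i) (oe'.1 j)) conjcK.
apply: filterS ex => x ex; rewrite /spectral_partial.
transitivity (\sum_(i <- J M) \sum_(j <- J' M)
  (lam' j)%:C * inner mu f (e i) * inner mu (e i) (e' j) * e' j x).
  rewrite big_seq [RHS]big_seq; apply: eq_bigr => i iM.
  rewrite {1}(ex i iM) mulr_sumr; apply: eq_bigr => j _.
  have [ij|/eqP ij] := eqVneq (deg i) (deg' j); first by rewrite (lamE ij) !mulrA.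
  by rewrite (cross ij) !(mul0r, mulr0).
rewrite exchange_big big_seq [RHS]big_seq; apply: eq_bigr => j jM.
rewrite fE// mulr_sumr mulr_suml; apply: eq_bigr => i _.
by rewrite -!mulrA; congr (_ * _); rewrite mulrCA.
Qed.

Lemma spectral_dom_transfer f : spectral_dom mu lam e f <-> spectral_dom mu lam' e' f.
Proof.
have eq M : L2 mu f -> sqnorm mu (spectral_partial J lam e f M) = sqnorm mu (spectral_partial J' lam' e' f M).
  by move=> f2; apply: sqnorm_ae; [exact: L2_lincomb|exact: L2_lincomb|exact: spectral_partial_ae].
split=> [/(spectral_domP lam memJ oe)|/(spectral_domP lam' memJ' oe')] [f2 [B hB]].
  by apply/(spectral_domP lam' memJ' oe'); split => //; exists B => M; rewrite -eq.
by apply/(spectral_domP lam memJ oe); split => //; exists B => M; rewrite eq.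
Qed.

Lemma spectral_graph_transfer f g : spectral_graph mu lam e f g <-> spectral_graph mu lam' e' f g.
Proof.
have eq M : L2 mu f -> L2 mu g -> sqnorm mu (fun x => g x - spectral_partial J lam e f M x) =
    sqnorm mu (fun x => g x - spectral_partial J' lam' e' f M x).
  move=> f2 g2; apply: sqnorm_ae; try by apply: L2B => //; exact: L2_lincomb.
  by apply: filterS (spectral_partial_ae M f2) => x ->.
split=> [/(spectral_graphP lam memJ oe)|/(spectral_graphP lam' memJ' oe')] [dom g2 h].
  have f2 := dom.1.
  apply/(spectral_graphP lam' memJ' oe'); split => //; first exact/spectral_dom_transfer.
  by move=> eps /h[M0 hM]; exists M0 => M /hM; rewrite eq.
have f2 := dom.1.
apply/(spectral_graphP lam memJ oe); split => //; first exact/spectral_dom_transfer.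
by move=> eps /h[M0 hM]; exists M0 => M /hM; rewrite -eq.
Qed.

End TwoBases.
End Spectral.

(** * Integration by parts and the Gamma function *)

Section ImproperParts.
Context {R : realType}.
Local Notation mu := (@lebesgue_measure R).
Implicit Types (F f g : R -> R).

Lemma ge0_integration_by_parts_bigcup (a b : R^nat) F f g (l : R) :
  (forall k, a k < b k) -> nonincreasing_seq a -> nondecreasing_seq b ->
  (forall k x, x \in `[a k, b k] -> is_derive x 1 F (f x - g x)) ->
  (forall k x, x \in `[a k, b k] -> {for x, continuous f} /\ {for x, continuous g}) ->
  (forall k x, x \in `[a k, b k] -> 0 <= f x /\ 0 <= g x) ->
  (fun k => F (b k) - F (a k)) @ \oo --> l ->
  (\int[mu]_(x in \bigcup_k [set` `[a k, b k]]) (f x)%:E =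
   \int[mu]_(x in \bigcup_k [set` `[a k, b k]]) (g x)%:E + l%:E)%E.
Proof.
move=> ab ai bd dF cfg fg0 cvl.
have cW (h : R -> R) k : (forall x, x \in `[a k, b k] -> {for x, continuous h}) ->
    {within [set` `[a k, b k]], continuous h}.
  by move=> ch; apply: continuous_in_subspaceT => x /set_mem; exact: ch.
have cf k : {within [set` `[a k, b k]], continuous f} by apply: cW => x /cfg[].
have cg k : {within [set` `[a k, b k]], continuous g} by apply: cW => x /cfg[].
have int_f k : mu.-integrable [set` `[a k, b k]] (EFin \o f).
  by apply: continuous_compact_integrable => //; exact: segment_compact.
have int_g k : mu.-integrable [set` `[a k, b k]] (EFin \o g).
  by apply: continuous_compact_integrable => //; exact: segment_compact.
have nd : nondecreasing_seq (fun k => `[a k, b k]%classic).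
  move=> k m km; apply/subsetPset => x /=; rewrite !in_itv/= => /andP[h1 h2].
  by rewrite (le_trans (ai _ _ km) h1) (le_trans h2 (bd _ _ km)).
have cvf : (\int[mu]_(x in `[a k, b k]) (f x)%:E @[k --> \oo] -->
    \int[mu]_(x in \bigcup_k [set` `[a k, b k]]) (f x)%:E)%E.
  apply: ge0_nondecreasing_set_cvg_integral => //.
    by move=> k; have /measurable_int := int_f k.
  by move=> k x /fg0[]; rewrite lee_fin.
have cvg_ : (\int[mu]_(x in `[a k, b k]) (g x)%:E @[k --> \oo] -->
    \int[mu]_(x in \bigcup_k [set` `[a k, b k]]) (g x)%:E)%E.
  apply: ge0_nondecreasing_set_cvg_integral => //.
    by move=> k; have /measurable_int := int_g k.
  by move=> k x /fg0[]; rewrite lee_fin.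
have key k : (\int[mu]_(x in `[a k, b k]) (f x)%:E =
    \int[mu]_(x in `[a k, b k]) (g x)%:E + (F (b k) - F (a k))%:E)%E.
  have dF' x : x \in `[a k, b k] -> derivable F x 1 by move=> /dF[].
  have := @continuous_FTC2 R (f \- g) F _ _ (ab k).
  rewrite EFinB => <-.
  - under [X in (_ + X)%E]eq_integral do rewrite /= EFinB.
    rewrite integralB//= addeC subeK//; exact: integrable_fin_num.
  - by apply: cW => x /cfg[c1 c2]; exact: continuousB.
  - split.
    + by move=> x /subset_itv_oo_cc; exact: dF'.
    + apply: cvg_at_right_filter; apply: differentiable_continuous; apply/derivable1_diffP.
      by apply: dF'; rewrite in_itv/= lexx ltW.
    + apply: cvg_at_left_filter; apply: differentiable_continuous; apply/derivable1_diffP.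
      by apply: dF'; rewrite in_itv/= lexx ltW.
  - by move=> x /subset_itv_oo_cc /dF d; rewrite derive1E derive_val.
have cvfg : (\int[mu]_(x in `[a k, b k]) (f x)%:E @[k --> \oo] -->
    \int[mu]_(x in \bigcup_k [set` `[a k, b k]]) (g x)%:E + l%:E)%E.
  under eq_cvg do rewrite key.
  apply: cvgeD; [exact: fin_num_adde_defl|exact: cvg_|].
  by apply: cvg_EFin; [exact: nearW|exact: cvl].
rewrite -(cvg_lim _ cvf)// (cvg_lim _ cvfg)//.
Qed.

Lemma expr_le_expR (x : R) (k : nat) : 0 <= x -> x ^+ k <= k`!%:R * expR x.
Proof.
move=> x0; case: k => [|k]; first by rewrite mul1r expr0 -expR0 ler_expR.
have := expR_ge1Dxn k x0; rewrite -lerBrDl ler_pdivrMr ?ltr0n ?fact_gt0//.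
move=> /le_trans; apply; rewrite mulrC ler_wpM2l// lerBlDr lerDl//.
Qed.

Lemma cvg_expr_expRN (k : nat) : (fun N : nat => N%:R ^+ k * expR (- N%:R) : R) @ \oo --> (0 : R).
Proof.
apply: (@squeeze_cvgr _ _ _ _ (fun=> 0) (fun N : nat => (k.+1)`!%:R * N%:R^-1)).
- near=> N; have N0 : (0 < N%:R :> R) by rewrite ltr0n; near: N; exists 1%N.
  rewrite mulr_ge0 ?exprn_ge0 ?expR_ge0//= expRN ler_pdivrMr ?expR_gt0//.
  rewrite mulrAC ler_pdivlMr// -exprSr; exact: expr_le_expR.
- exact: cvg_cst.
- rewrite -[X in _ --> X](mulr0 (k.+1)`!%:R); apply: cvgMr.
  by apply/gtr0_cvgV0; [near=> N; rewrite ltr0n; near: N; exists 1%N|exact: cvgr_idn].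
Unshelve. all: by end_near. Qed.

End ImproperParts.

Section GammaFunction.
Context {R : realType}.
Local Notation mu := (@lebesgue_measure R).
Implicit Types x t : R.

Lemma bigcup_itv_pos : \bigcup_k [set` `[(k.+2%:R : R)^-1, k.+2%:R]] = `]0, +oo[%classic.
Proof.
apply/seteqP; split=> [x [k _] /=|x /=]; rewrite !in_itv/= ?andbT.
  by move=> /andP[+ _]; apply: lt_le_trans; rewrite invr_gt0.
move=> x0; have [k kx] : exists k : nat, Num.max x x^-1 < k%:R.
  by exists (Num.truncn (Num.max x x^-1)).+1; exact: truncnS_gt.
move: kx; rewrite gt_max => /andP[k1 k2]; exists k => //=; rewrite in_itv/=.
have kk : k%:R <= k.+2%:R :> R by rewrite ler_nat; lia.
apply/andP; split; last by rewrite ltW// (lt_le_trans k1).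
by rewrite invf_ple ?posrE// ltW// (lt_le_trans k2).
Qed.

Lemma is_derive_powR_expRN x t : 0 < t ->
  is_derive t 1 (fun u => u `^ x * expR (- u)) (x * t `^ (x - 1) * expR (- t) - t `^ x * expR (- t)).
Proof.
move=> t0; have t0' : t \in `]0, +oo[ by rewrite in_itv/= t0.
have d1 : is_derive t 1 (@powR R ^~ x) (x * t `^ (x - 1)).
  split; first exact: derivable_powR.
  by rewrite -derive1E powR_derive1.
have d2 : is_derive t 1 (fun u : R => expR (- u)) (- expR (- t)).
  have := @is_derive1_comp R expR -%R t _ _ (is_derive_expR (- t)) (is_deriveNid t 1).
  by rewrite mulrN1.
apply: (is_derive_eq (is_deriveM d1 d2)).
by rewrite /GRing.scale /=; ring.
Qed.

Lemma continuous_powR_expRN x t : 0 < t ->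
  {for t, continuous (fun u => u `^ x * expR (- u))}.
Proof.
move=> t0; apply: differentiable_continuous; apply/derivable1_diffP.
by have [] := is_derive_powR_expRN x t0.
Qed.

Definition EGamma x : \bar R := (\int[mu]_(t in `]0%R, +oo[) (t `^ (x - 1) * expR (- t))%:E)%E.

Lemma GammaE x : Gamma x = fine (EGamma x).
Proof. by []. Qed.

Lemma measurable_powR_expRN x (D : set R) : measurable_fun D (fun t : R => t `^ x * expR (- t)).
Proof.
apply: measurable_funTS; apply: measurable_funM; first exact: measurable_powR.
by apply: measurableT_comp => //; exact: measurableT_comp.
Qed.

Lemma EGamma_ge0 x : (0 <= EGamma x)%E.
Proof. by apply: integral_ge0 => t _; rewrite lee_fin mulr_ge0 ?powR_ge0 ?expR_ge0. Qed.

Lemma EGammaS x : 0 < x -> EGamma (x + 1) = (x%:E * EGamma x)%E.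
Proof.
move=> x0; rewrite /EGamma -ge0_integralZl//; last 3 first.
- by apply/measurable_EFinP; exact: measurable_powR_expRN.
- by move=> t _; rewrite lee_fin mulr_ge0 ?powR_ge0 ?expR_ge0.
- by rewrite lee_fin ltW.
rewrite addrK -bigcup_itv_pos; under [RHS]eq_integral do rewrite -EFinM mulrA.
have pos k t : t \in `[(k.+2%:R : R)^-1, k.+2%:R] -> 0 < t.
  by rewrite in_itv/= => /andP[+ _]; apply: lt_le_trans; rewrite invr_gt0.
rewrite -[RHS]adde0; apply: (@ge0_integration_by_parts_bigcup _ _ _ (fun t => - (t `^ x * expR (- t)))
  (fun t => t `^ x * expR (- t)) (fun t => x * t `^ (x - 1) * expR (- t))).
- by move=> k; rewrite (@lt_trans _ _ 1)// ?invf_lt1// ltr1n.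
- by move=> k l kl; rewrite lef_pV2 ?posrE// ler_nat.
- by move=> k l kl; rewrite ler_nat.
- move=> k t /pos t0; have := is_deriveN (is_derive_powR_expRN x t0).
  by rewrite opprB.
- move=> k t /pos t0; split; first exact: continuous_powR_expRN.
  rewrite (_ : (fun _ => _) = (fun u : R => x * (u `^ (x - 1) * expR (- u)))).
    by apply: cvgMr; exact: continuous_powR_expRN.
  by apply/funext => u; rewrite mulrA.
- move=> k t _; rewrite !mulr_ge0 ?powR_ge0 ?expR_ge0//; exact: ltW.
- rewrite -[X in _ --> X](addr0 (0 : R)) -[X in X + _]oppr0 -[X in _ + X]oppr0.
  apply: cvgD; apply: cvgN.
    pose m := (Num.truncn x).+1.
    apply: (@squeeze_cvgr _ _ _ _ (fun=> 0) (fun k : nat => k.+2%:R ^+ m * expR (- k.+2%:R))).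
    + near=> k; rewrite mulr_ge0 ?powR_ge0 ?expR_ge0//=.
      rewrite ler_wpM2r ?expR_ge0// -powR_mulrn// ler_powR ?ler1n//.
      by rewrite ltW// truncnS_gt.
    + exact: cvg_cst.
    + by have := @cvg_expr_expRN R m; rewrite -(cvg_shiftn 2); under eq_cvg do rewrite /= addn2.
  rewrite -oppr0; apply: cvgN.
  apply: (@squeeze_cvgr _ _ _ _ (fun=> 0) (fun k : nat => (k.+2%:R : R)^-1 `^ x)).
  + near=> k; rewrite mulr_ge0 ?powR_ge0 ?expR_ge0//=.
    by rewrite ler_piMr ?powR_ge0// -expR0 ler_expR oppr_le0 invr_ge0.
  + exact: cvg_cst.
  + have := powR_cvg0 x0 => /cvg_at_rightP; apply.
    split; first by move=> k; rewrite invr_gt0.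
    by have := @cvg_harmonic R; rewrite -(cvg_shiftn 1); under eq_cvg do rewrite /= addn1.
Unshelve. all: by end_near. Qed.

Lemma integral_expRN_ge (r : R) :
  (\int[mu]_(t in `[r, +oo[) (expR (- t))%:E)%E = (expR (- r))%:E.
Proof.
have d t : is_derive t 1 (fun u : R => - expR (- u)) (expR (- t)).
  have := @is_derive1_comp R expR -%R t _ _ (is_derive_expR (- t)) (is_deriveNid t 1).
  by move=> /is_deriveN; rewrite mulrN1 opprK.
have cE : continuous (fun u : R => expR (- u)).
  move=> t; apply: continuous_comp; first exact: opp_continuous.
  exact: continuous_expR.
rewrite (@ge0_continuous_FTC2y _ _ (fun u => - expR (- u)) _ 0).
- by rewrite sub0e EFinN oppeK.
- by move=> t _; exact: expR_ge0.
- exact: continuous_subspaceT.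
- by rewrite -oppr0; apply: cvgN; exact: cvgr_expR.
- by move=> t _; have [] := d t.
- by apply: cvg_at_right_filter; apply: cvgN; exact: cE.
- by move=> t _; rewrite derive1E derive_val.
Qed.

Lemma EGamma1 : EGamma 1 = 1%:E.
Proof.
rewrite /EGamma; under eq_integral do rewrite subrr powRr0 mul1r.
rewrite integral_itv_obnd_cbnd; first by rewrite integral_expRN_ge oppr0 expR0.
apply/measurable_EFinP/measurable_funTS.
by apply: measurableT_comp => //; exact: measurableT_comp.
Qed.

Lemma EGamma_nat k : EGamma k.+1%:R = (k`!%:R)%:E.
Proof.
elim: k => [|k IH]; first by rewrite EGamma1.
by rewrite -natr1 EGammaS// IH -EFinM -natrM factS.
Qed.

Lemma EGamma_fin_num x : 0 < x -> EGamma x \is a fin_num.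
Proof.
move=> x0.
have ge1 y : 1 <= y -> EGamma y \is a fin_num.
  move=> y1; rewrite ge0_fin_numE ?EGamma_ge0//.
  pose m := (Num.truncn y).+1.
  apply: (@le_lt_trans _ _ (EGamma 1 + EGamma m.+1%:R)%E); last first.
    by rewrite EGamma1 EGamma_nat -EFinD ltry.
  have p0 z : {in `]0, +oo[, forall t : R, (0 <= (t `^ z * expR (- t))%:E)%E}.
    by move=> t _; rewrite lee_fin mulr_ge0 ?powR_ge0 ?expR_ge0.
  rewrite /EGamma -ge0_integralD//; last 4 first.
  - by move=> t ?; exact: p0.
  - by apply/measurable_EFinP; exact: measurable_powR_expRN.
  - by move=> t ?; exact: p0.
  - by apply/measurable_EFinP; exact: measurable_powR_expRN.
  apply: ge0_le_integral => //.
  - by move=> t ?; exact: p0.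
  - by apply/measurable_EFinP; exact: measurable_powR_expRN.
  - by apply: emeasurable_funD; apply/measurable_EFinP; exact: measurable_powR_expRN.
  move=> t /=; rewrite in_itv/= andbT => t0.
  rewrite -EFinD lee_fin -mulrDl ler_wpM2r ?expR_ge0// subrr powRr0.
  have [t1|t1] := leP 1 t.
    rewrite ler_wpDl// ler_powR// lerB// (le_trans (ltW (truncnS_gt y)))//.
    by rewrite ler_nat.
  rewrite ler_wpDr ?powR_ge0//.
  rewrite -[leRHS](powRr0 t) ger_powR ?t0 ?(ltW t1)//; lra.
have [x1|x1] := leP 1 x; first exact: ge1.
have := ge1 (x + 1); rewrite lerDr => /(_ (ltW x0)); rewrite EGammaS//.
by have := EGamma_ge0 x; case: (EGamma x) => // _; rewrite mulry gtr0_sg// mul1e.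
Qed.

Lemma GammaS x : 0 < x -> Gamma (x + 1) = x * Gamma x.
Proof. by move=> x0; rewrite !GammaE EGammaS// fineM// EGamma_fin_num. Qed.

Lemma EFin_Gamma x : 0 < x -> (Gamma x)%:E = EGamma x.
Proof. by move=> x0; rewrite GammaE fineK// EGamma_fin_num. Qed.

Lemma Gamma_nat k : Gamma (k.+1%:R : R) = k`!%:R.
Proof. by rewrite GammaE EGamma_nat. Qed.

Lemma Gamma_gt0 x : 0 < x -> 0 < Gamma x.
Proof.
move=> x0.
have ge1 (y : R) : 1 <= y -> 0 < Gamma y.
  move=> y1; rewrite -lte_fin (@EFin_Gamma y) ?(lt_le_trans ltr01)//.
  apply: (@lt_le_trans _ _ (\int[mu]_(t in `[1%R, 2%R]) (cst (expR (-2))%:E t))%E).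
    rewrite integral_cst//= lebesgue_measure_itv/= lte_fin ltr1n/=.
    by rewrite -EFinB -EFinM lte_fin mulr_gt0 ?expR_gt0//; lra.
  apply: (@le_trans _ _ (\int[mu]_(t in `[1%R, 2%R]) (t `^ (y - 1) * expR (- t))%:E)%E).
    apply: ge0_le_integral => //.
    - by move=> t _; rewrite lee_fin expR_ge0.
    - by apply/measurable_EFinP; exact: measurable_powR_expRN.
    - move=> t /=; rewrite in_itv/= => /andP[t1 t2]; rewrite lee_fin.
      rewrite -[leLHS]mul1r ler_pM ?expR_ge0//.
        by rewrite -[leLHS](powRr0 t) ler_powR//; lra.
      by rewrite ler_expR lerN2.
  apply: ge0_subset_integral => //.
  - by apply/measurable_EFinP; exact: measurable_powR_expRN.
  - by move=> t _; rewrite lee_fin mulr_ge0 ?powR_ge0 ?expR_ge0.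
  - by move=> t /=; rewrite !in_itv/= andbT => /andP[+ _]; apply: lt_le_trans.
have := ge1 (x + 1); rewrite lerDr => /(_ (ltW x0)); rewrite GammaS//.
by rewrite pmulr_rgt0.
Qed.

End GammaFunction.

(** * Lebesgue measure on R^n and Gaussian moments *)

Section ScaleLine.
Context {R : realType}.
Local Notation mu := (@lebesgue_measure R).

Lemma lebesgue_measure_scale (c : R) (A : set R) : c != 0 -> measurable A ->
  mu A = (`|c|%:E * mu ((fun x : R => (c * x)%R) @^-1` A))%E.
Proof.
move=> c0 mA.
have mc : measurable_fun setT (fun x : measurableTypeR R => (c * x : measurableTypeR R)).
  exact: measurable_funM.
pose nu := [the {measure set (measurableTypeR R) -> \bar R} of mscale (NngNum (normr_ge0 c))
  (measure_function_pushforward__canonical__measure_function_Measure mu mc)].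
rewrite (@lebesgue_measure_unique R nu)// => _ [[a b] /= ab <-].
rewrite /nu /mscale /= /pushforward.
have [cgt|clt|/eqP] := ltrgt0P c; last by rewrite (negPf c0).
- rewrite (_ : _ @^-1` _ = [set` `]a / c, b / c]]); last first.
    apply/seteqP; split => x /=; rewrite !in_itv/= ltr_pdivrMr// ler_pdivlMr// mulrC//.
  rewrite !lebesgue_measure_itv/= !lte_fin ltr_pM2r ?invr_gt0//.
  case: ifPn => _; last by rewrite mule0.
  by rewrite -!EFinD -EFinM; congr (_%:E); field.
- rewrite (_ : _ @^-1` _ = [set` `[b / c, a / c[]); last first.
    apply/seteqP; split => x /=; rewrite !in_itv/= ler_ndivrMr// ltr_ndivlMr// mulrC andbC//.
  rewrite !lebesgue_measure_itv/= !lte_fin ltr_nM2r ?invr_lt0//.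
  case: ifPn => _; last by rewrite mule0.
  by rewrite -!EFinD -EFinM; congr (_%:E); field.
Qed.

Lemma ge0_integral_scale (c : R) (f : R -> \bar R) : c != 0 -> measurable_fun setT f ->
  (forall x, 0 <= f x)%E ->
  (\int[mu]_x f x = `|c|%:E * \int[mu]_x f (c * x)%R)%E.
Proof.
move=> c0 mf f0.
have mc : measurable_fun setT (fun x : measurableTypeR R => (c * x : measurableTypeR R)).
  exact: measurable_funM.
pose push := measure_function_pushforward__canonical__measure_function_Measure mu mc.
rewrite (@eq_measure_integral _ _ _ _ [the {measure set (measurableTypeR R) -> \bar R} of mscale (NngNum (normr_ge0 c)) push]); last first.
  by move=> A mA _; rewrite [LHS](lebesgue_measure_scale c0 mA).
rewrite ge0_integral_mscale//=; congr (_ * _)%E.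
by rewrite ge0_integral_pushforward.
Qed.

End ScaleLine.

Section IteratedRn.
Context {R : realType}.
Local Notation mu := (@lebesgue_measure R).

Lemma ge0_integral_Rn0 (f : Rn R 0 -> \bar R) :
  measurable_fun setT f -> (\int[lebesgue_Rn R 0]_x f x = f [tuple])%E.
Proof. by move=> mf; rewrite integral_dirac// diracT mul1e. Qed.

Lemma ge0_integral_Rn_cons n (f : Rn R n.+1 -> \bar R) :
  measurable_fun setT f -> (forall x, 0 <= f x)%E ->
  (\int[lebesgue_Rn R n.+1]_x f x =
   \int[mu]_a \int[lebesgue_Rn R n]_x f (Rn_cons (a, x)))%E.
Proof.
move=> mf f0.
pose push := measure_function_pushforward__canonical__measure_function_Measure
  (mu \x lebesgue_Rn R n)%E (@measurable_Rn_cons R n).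
transitivity (\int[push]_x f x)%E.
  by apply: eq_measure_integral => A mA _; rewrite /push /=.
rewrite ge0_integral_pushforward//; last exact: measurable_Rn_cons.
rewrite preimage_setT (@fubini_tonelli1 _ _ _ _ _ mu (lebesgue_Rn R n) (f \o @Rn_cons R n))//.
- by apply: measurableT_comp => //; exact: measurable_Rn_cons.
by move=> p; exact: f0.
Qed.

Lemma measurable_fun_Rn_slice n d' (T : measurableType d') (f : Rn R n.+1 -> T) (a : R) :
  measurable_fun setT f -> measurable_fun setT (fun x => f (Rn_cons (a, x))).
Proof.
move=> mf; apply: (measurableT_comp mf).
apply: (measurableT_comp (@measurable_Rn_cons R n)); exact: measurable_pair1.
Qed.

Definition Rn_scale n (c : R) (x : Rn R n) : Rn R n := [tuple c * tnth x i | i < n].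

Lemma measurable_Rn_scale n c : measurable_fun setT (@Rn_scale n c).
Proof.
apply/measurable_fun_tnthP => i.
rewrite (_ : _ \o _ = fun x : Rn R n => c * tnth x i); last first.
  by apply/funext => x /=; rewrite tnth_mktuple.
by apply: measurable_funM => //; exact: measurable_tnth.
Qed.

Lemma Rn_scale_cons n c a (x : Rn R n) :
  Rn_scale c (Rn_cons (a, x)) = Rn_cons (c * a, Rn_scale c x).
Proof.
apply: eq_from_tnth => i; rewrite tnth_mktuple /Rn_cons.
by case: (unliftP ord0 i) => [j ->|->]; rewrite !(tnthS, tnth0) ?tnth_mktuple.
Qed.

Lemma ge0_integral_Rn_scale n (c : R) (f : Rn R n -> \bar R) :
  0 < c -> measurable_fun setT f -> (forall x, 0 <= f x)%E ->
  (\int[lebesgue_Rn R n]_x f x = (c ^+ n)%:E * \int[lebesgue_Rn R n]_x f (Rn_scale c x))%E.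
Proof.
move=> c0; elim: n f => [|n IH] f mf f0.
  rewrite expr0 mul1e !ge0_integral_Rn0//; first by rewrite [Rn_scale _ _]tuple0.
  by apply: (measurableT_comp mf); exact: measurable_Rn_scale.
have mfs : measurable_fun setT (f \o Rn_scale c).
  by apply: (measurableT_comp mf); exact: measurable_Rn_scale.
rewrite !ge0_integral_Rn_cons//.
have mF (g : Rn R n.+1 -> \bar R) : measurable_fun setT g -> (forall x, 0 <= g x)%E ->
    measurable_fun setT (fun a : R => \int[lebesgue_Rn R n]_x g (Rn_cons (a, x)))%E.
  move=> mg g0; apply: (@measurable_fun_fubini_tonelli_F _ _ _ _ _ (lebesgue_Rn R n) (g \o @Rn_cons R n)) => //.
    by apply: (measurableT_comp mg); exact: measurable_Rn_cons.
  by move=> p; exact: g0.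
transitivity (`|c|%:E * \int[mu]_a \int[lebesgue_Rn R n]_x f (Rn_cons ((c * a)%R, x)))%E.
  apply: (@ge0_integral_scale R c (fun a => \int[lebesgue_Rn R n]_x f (Rn_cons (a, x)))%E).
  - by rewrite gt_eqF.
  - exact: mF.
  - by move=> a; apply: integral_ge0.
rewrite (gtr0_norm c0).
transitivity (c%:E * \int[mu]_a ((c ^+ n)%:E * \int[lebesgue_Rn R n]_x (f \o Rn_scale c) (Rn_cons (a, x))))%E.
  congr (_ * _)%E; apply: eq_integral => a _.
  rewrite (IH (fun x => f (Rn_cons (c * a, x))))//; last exact: measurable_fun_Rn_slice.
  by congr (_ * _)%E; apply: eq_integral => x _; rewrite /= Rn_scale_cons.
rewrite ge0_integralZl//; last 3 first.
- apply: mF => // x; exact: f0.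
- by move=> a _; apply: integral_ge0 => x _; exact: f0.
- by rewrite lee_fin exprn_ge0// ltW.
by rewrite muleA -EFinM -exprS.
Qed.

End IteratedRn.

Section ProductIntegral.
Context {R : realType}.
Local Notation mu := (@lebesgue_measure R).

Lemma integral_Rn_cons n (f : Rn R n.+1 -> \bar R) :
  (lebesgue_Rn R n.+1).-integrable setT f ->
  (\int[lebesgue_Rn R n.+1]_x f x =
   \int[mu]_a \int[lebesgue_Rn R n]_x f (Rn_cons (a, x)))%E.
Proof.
move=> /integrableP[mf fy].
pose push := measure_function_pushforward__canonical__measure_function_Measure
  (mu \x lebesgue_Rn R n)%E (@measurable_Rn_cons R n).
have mfc : measurable_fun setT (f \o @Rn_cons R n).
  by apply: (measurableT_comp mf); exact: measurable_Rn_cons.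
have ifc : (mu \x lebesgue_Rn R n)%E.-integrable setT (f \o @Rn_cons R n).
  apply/(integrable12ltyP _ _ mfc) => /=.
  rewrite -(ge0_integral_Rn_cons (f := fun x => `|f x|%E))//.
  exact: measurableT_comp.
transitivity (\int[push]_x f x)%E.
  by apply: eq_measure_integral => A mA _; rewrite /push /=.
rewrite integral_pushforward//; last exact: measurable_Rn_cons.
by rewrite preimage_setT -integral12_prod_meas1.
Qed.

Lemma Rn_cons_prod n (F : 'I_n.+1 -> R -> R) a (x : Rn R n) :
  \prod_(i < n.+1) F i (tnth (Rn_cons (a, x)) i) =
  F ord0 a * \prod_(i < n) F (lift ord0 i) (tnth x i).
Proof.
rewrite big_ord_recl tnth0; congr (_ * _); apply: eq_bigr => i _.
by rewrite tnthS.
Qed.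

Lemma measurable_prod_Rn n (F : 'I_n -> R -> R) :
  (forall i, measurable_fun setT (F i)) ->
  measurable_fun setT (fun x : Rn R n => \prod_(i < n) F i (tnth x i)).
Proof.
move=> mF; apply: measurable_prod => i _.
by apply: (measurableT_comp (mF i)); exact: measurable_tnth.
Qed.

Lemma ge0_integral_prod_Rn n (F : 'I_n -> R -> R) :
  (forall i, measurable_fun setT (F i)) -> (forall i t, 0 <= F i t) ->
  (\int[lebesgue_Rn R n]_x (\prod_(i < n) F i (tnth x i))%:E =
   \prod_(i < n) \int[mu]_t (F i t)%:E)%E.
Proof.
elim: n F => [|n IH] F mF F0.
  rewrite big_ord0 ge0_integral_Rn0 ?big_ord0//.
  by apply/measurable_EFinP; exact: measurable_prod_Rn.
have mp : measurable_fun setT (fun x : Rn R n => \prod_(i < n) F (lift ord0 i) (tnth x i)).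
  by apply: (measurable_prod_Rn (F := fun i => F (lift ord0 i))) => i; exact: mF.
rewrite ge0_integral_Rn_cons; last 2 first.
- by apply/measurable_EFinP; exact: measurable_prod_Rn.
- by move=> x; rewrite lee_fin prodr_ge0.
under eq_integral => a _.
  under eq_integral do rewrite Rn_cons_prod EFinM.
  rewrite ge0_integralZl//; last 3 first.
  - exact/measurable_EFinP.
  - by move=> x _; rewrite lee_fin prodr_ge0.
  - by rewrite lee_fin.
  rewrite (IH (fun i => F (lift ord0 i)))//.
  over.
rewrite big_ord_recl ge0_integralZr//.
- by apply/measurable_EFinP; exact: mF.
- by move=> t _; rewrite lee_fin.
- elim/big_ind: _ => //; first by move=> x y; exact: mule_ge0.
  by move=> i _; apply: integral_ge0 => t _; rewrite lee_fin.
Qed.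

Lemma integrable_prod_Rn n (F : 'I_n -> R -> R) :
  (forall i, mu.-integrable setT (EFin \o F i)) ->
  (lebesgue_Rn R n).-integrable setT (EFin \o (fun x : Rn R n => \prod_(i < n) F i (tnth x i))).
Proof.
move=> iF; have mF i : measurable_fun setT (F i).
  by apply/measurable_EFinP; have /measurable_int := iF i.
apply/integrableP; split; first by apply/measurable_EFinP; exact: measurable_prod_Rn.
under eq_integral => x _ do rewrite /= normr_prod.
rewrite (ge0_integral_prod_Rn (F := fun i t => `|F i t|))//; last first.
  by move=> i; exact: measurableT_comp.
have : (\prod_(i < n) \int[mu]_t (`|F i t|)%:E)%E \is a fin_num.
  elim/big_ind: _ => //; first by move=> x y; exact: fin_numM.
  move=> i _; have /integrableP[_ h] := iF i.
  by rewrite ge0_fin_numE// integral_ge0.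
by rewrite ge0_fin_numE// ; elim/big_ind: _ => //; [move=> x y; exact: mule_ge0|
  move=> i _; apply: integral_ge0 => t _; rewrite lee_fin].
Qed.

Lemma Rintegral_prod_Rn n (F : 'I_n -> R -> R) :
  (forall i, mu.-integrable setT (EFin \o F i)) ->
  \int[lebesgue_Rn R n]_x (\prod_(i < n) F i (tnth x i)) = \prod_(i < n) \int[mu]_t F i t.
Proof.
elim: n F => [|n IH] F iF.
  rewrite big_ord0 /Rintegral ge0_integral_Rn0 ?big_ord0//.
  by apply/measurable_EFinP; apply: (measurable_prod_Rn (F := F)) => -[].
have ip := integrable_prod_Rn (fun i => iF (lift ord0 i)).
rewrite /Rintegral (integral_Rn_cons (integrable_prod_Rn iF)) /=.
under eq_integral => a _.
  under eq_integral do rewrite Rn_cons_prod EFinM.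
  rewrite integralZl// -(fineK (integrable_fin_num _ ip))// -/(Rintegral _ _ _).
  rewrite (IH (fun i => F (lift ord0 i)))// muleC.
  over.
rewrite integralZl//; last exact: iF.
rewrite fineM//=; last by have := iF ord0; exact: integrable_fin_num.
by rewrite big_ord_recl mulrC.
Qed.

End ProductIntegral.

Section GaussianMoments.
Context {R : realType}.
Local Notation mu := (@lebesgue_measure R).

Definition gauss_monomial k (t : R) : R := t ^+ k * expR (- t ^+ 2).

Lemma is_derive_gauss_monomial (k : nat) (t : R) :
  is_derive t 1 (gauss_monomial k) (k%:R * gauss_monomial k.-1 t - 2 * gauss_monomial k.+1 t).
Proof.
have d1 : is_derive t 1 (fun u : R => u ^+ k) (k%:R * t ^+ k.-1).
  rewrite (_ : (fun u : R => _) = (@id R) ^+ k); last first.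
    by apply/funext => u; rewrite exprfctE.
  apply: (is_derive_eq (is_deriveX k (is_derive_id t 1))).
  by rewrite /GRing.scale/= mulr1.
have d2 : is_derive t 1 (fun u : R => expR (- u ^+ 2)) (- (2 * t) * expR (- t ^+ 2)).
  have h : is_derive t 1 (fun u : R => - u ^+ 2) (- (2 * t)).
    have -> : (fun u : R => - u ^+ 2) = - ((@id R) ^+ 2).
      by apply/funext => u; rewrite !fctE.
    apply: (is_derive_eq (is_deriveN (is_deriveX 2 (is_derive_id t 1)))).
    by rewrite /GRing.scale/= expr1 mulr1.
  apply: (is_derive_eq (@is_derive1_comp R expR _ t _ _ (is_derive_expR (- t ^+ 2)) h)).
  by rewrite mulrC.
apply: (is_derive_eq (is_deriveM d1 d2)).
by rewrite /GRing.scale/= /gauss_monomial (exprS t k); ring.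
Qed.

Lemma continuous_gauss_monomial k : continuous (gauss_monomial k).
Proof.
move=> t; apply: differentiable_continuous; apply/derivable1_diffP.
by have [] := is_derive_gauss_monomial k t.
Qed.

Lemma measurable_gauss_monomial k : measurable_fun setT (gauss_monomial k).
Proof. by apply: continuous_measurable_fun; exact: continuous_gauss_monomial. Qed.

Lemma gauss_monomial_even_ge0 k t : 0 <= gauss_monomial k.*2 t.
Proof. by rewrite mulr_ge0 ?expR_ge0// -muln2 exprM sqr_ge0. Qed.

Lemma bigcup_itv_sym : \bigcup_k [set` `[(- k.+1%:R : R), k.+1%:R]] = setT.
Proof.
apply/seteqP; split=> // x _; exists (Num.truncn `|x|) => //=.
by rewrite in_itv /= -ler_norml ltW// truncnS_gt.
Qed.

Lemma integral_gauss_even_rec j :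
  (2%:E * \int[mu]_t (gauss_monomial j.+1.*2 t)%:E =
   j.*2.+1%:R%:E * \int[mu]_t (gauss_monomial j.*2 t)%:E)%E.
Proof.
have m k : measurable_fun setT (EFin \o gauss_monomial k).
  by apply/measurable_EFinP; exact: measurable_gauss_monomial.
have e k t : setT t -> (0 <= (gauss_monomial k.*2 t)%:E)%E.
  by move=> _; rewrite lee_fin gauss_monomial_even_ge0.
rewrite -!ge0_integralZl//; [|exact: m|exact: e|exact: m|exact: e].
under eq_integral do rewrite -EFinM.
under [RHS]eq_integral do rewrite -EFinM.
rewrite -bigcup_itv_sym.
rewrite -[RHS]adde0; apply: (@ge0_integration_by_parts_bigcup _ _ _ (\- gauss_monomial j.*2.+1)
  (fun t => 2 * gauss_monomial j.+1.*2 t) (fun t => j.*2.+1%:R * gauss_monomial j.*2 t)).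
- by move=> k; rewrite ltrNl (@lt_trans _ _ 0)// oppr_lt0.
- by move=> k l kl; rewrite lerN2 ler_nat.
- by move=> k l kl; rewrite ler_nat.
- move=> k t _; apply: (is_derive_eq (is_deriveN (is_derive_gauss_monomial _ _))).
  by rewrite opprB.
- have c (a : R) k : continuous (fun t => a * gauss_monomial k t).
    by move=> t; apply: cvgMr; exact: continuous_gauss_monomial.
  by move=> k t _; split; exact: c.
- by move=> k t _; split; apply: mulr_ge0 => //; exact: gauss_monomial_even_ge0.
- apply: (@squeeze_cvgr _ _ _ _ (fun k : nat => - (2 * (k.+1%:R ^+ j.*2.+1 * expR (- k.+1%:R)))) (fun=> 0)).
  + near=> k.
    have E : gauss_monomial j.*2.+1 (- k.+1%:R) = - gauss_monomial j.*2.+1 k.+1%:R.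
      by rewrite /gauss_monomial sqrrN exprNn -signr_odd /= odd_double expr1 mulN1r mulNr.
    have E0 : 0 <= gauss_monomial j.*2.+1 k.+1%:R by rewrite mulr_ge0 ?expR_ge0// exprn_ge0.
    have E1 : gauss_monomial j.*2.+1 k.+1%:R <= k.+1%:R ^+ j.*2.+1 * expR (- k.+1%:R).
      rewrite ler_wpM2l ?exprn_ge0// ler_expR lerN2 expr2 ler_peMl//.
      by rewrite ler1n.
    by rewrite /= E opprK; apply/andP; split; lra.
  + rewrite -[X in _ --> X]oppr0; apply: cvgN; rewrite -(mulr0 2); apply: cvgMr.
    by have := @cvg_expr_expRN R j.*2.+1; rewrite -(cvg_shiftn 1); under eq_cvg do rewrite /= addn1.
  + exact: cvg_cst.
Unshelve. all: by end_near. Qed.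

Lemma integral_gauss_even_lty j : (\int[mu]_t (gauss_monomial j.*2 t)%:E < +oo)%E.
Proof.
elim: j => [|j IH].
  under eq_integral do rewrite /gauss_monomial expr0 mul1r.
  by have := @integralT_gauss R; rewrite /gauss_fun => ->; rewrite ltry.
have Bfin : (\int[mu]_t (gauss_monomial j.*2 t)%:E)%E \is a fin_num.
  rewrite ge0_fin_numE//; apply: integral_ge0 => t _.
  by rewrite lee_fin gauss_monomial_even_ge0.
have := integral_gauss_even_rec j; rewrite ltey => h; apply/eqP => Ay; move: h.
by rewrite Ay -(fineK Bfin) -EFinM gt0_muley.
Qed.

Lemma integrable_gauss_even j : mu.-integrable setT (EFin \o gauss_monomial j.*2).
Proof.
apply/integrableP; split; first by apply/measurable_EFinP; exact: measurable_gauss_monomial.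
under eq_integral do rewrite /= ger0_norm ?gauss_monomial_even_ge0//.
exact: integral_gauss_even_lty.
Qed.

Lemma integrable_gauss_monomial k : mu.-integrable setT (EFin \o gauss_monomial k).
Proof.
have [[j ->]|[j ->]] : (exists j, k = j.*2) \/ (exists j, k = j.*2.+1).
- by case: (boolP (odd k)) => ok; [right|left]; exists k./2; lia.
- exact: integrable_gauss_even.
have := integrableD measurableT (integrable_gauss_even j) (integrable_gauss_even j.+1).
apply: le_integrable => //; first by apply/measurable_EFinP; exact: measurable_gauss_monomial.
move=> t _ /=; rewrite lee_fin [leRHS]ger0_norm ?addr_ge0 ?gauss_monomial_even_ge0//.
rewrite /gauss_monomial normrM (ger0_norm (expR_ge0 _)) -mulrDl ler_wpM2r ?expR_ge0//.
rewrite doubleS (exprS t j.*2.+1) (exprS t j.*2).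
have : 0 <= t ^+ j.*2 by rewrite -muln2 exprM sqr_ge0.
set y := t ^+ j.*2 => y0; rewrite normrM (ger0_norm y0).
have key : `|t| <= 1 + t ^+ 2.
  by have := sqr_ge0 (`|t| - 1); have := real_normK (num_real t); have := normr_ge0 t; nra.
by apply: le_trans (ler_wpM2r y0 key) _; rewrite mulrDl mul1r expr2 mulrA.
Qed.

Definition gauss_moment k : R := \int[mu]_t gauss_monomial k t.

Lemma gauss_moment_odd j : gauss_moment j.*2.+1 = 0.
Proof.
rewrite /gauss_moment /Rintegral integralE.
set f := fun t => (gauss_monomial j.*2.+1 t)%:E.
have -> : (\int[mu]_t f^\+ t = \int[mu]_t f^\- t)%E.
  rewrite (@ge0_integral_scale R (-1)) ?oppr_eq0 ?oner_eq0//; last first.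
    by apply: measurable_funepos; apply/measurable_EFinP; exact: measurable_gauss_monomial.
  rewrite normrN1 mul1e; apply: eq_integral => t _.
  rewrite /f funeposE funenegE /= mulN1r /gauss_monomial sqrrN exprNn.
  by rewrite -signr_odd /= odd_double expr1 mulN1r mulNr EFinN.
have if_ := integrable_funeneg measurableT (integrable_gauss_monomial j.*2.+1).
by rewrite subee// integrable_fin_num.
Qed.

Lemma gauss_moment0 : gauss_moment 0 = Num.sqrt pi.
Proof.
rewrite /gauss_moment; under eq_Rintegral do rewrite /gauss_monomial expr0 mul1r.
by have := @integralT_gauss R; rewrite /gauss_fun /Rintegral => ->.
Qed.

Lemma gauss_moment_rec k : 2 * gauss_moment k.+1 = k%:R * gauss_moment k.-1.
Proof.
case: (boolP (odd k)) => ok; last first.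
  have -> : k.+1 = k./2.*2.+1 by lia.
  rewrite gauss_moment_odd mulr0; case: k ok => [|k] ok; first by rewrite mul0r.
  by rewrite (_ : k.+1.-1 = k./2.*2.+1) ?gauss_moment_odd ?mulr0//; lia.
have -> : k.+1 = k./2.+1.*2 by lia.
have -> : k.-1 = k./2.*2 by lia.
have -> : k%:R = k./2.*2.+1%:R :> R by congr _%:R; lia.
have := congr1 fine (integral_gauss_even_rec k./2).
by rewrite !fineM// integrable_fin_num// integrable_gauss_even.
Qed.

End GaussianMoments.

(** * The complex Gaussian functional *)

Section ComplexIntegral.
Context {R : realType} {d : measure_display} {T : measurableType d}.
Variable mu : {measure set T -> \bar R}.
Local Notation Re := (@complex.Re R).
Local Notation Im := (@complex.Im R).
Implicit Types f g : T -> R[i].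

Definition Cintegrable f := mu.-integrable setT (EFin \o (Re \o f)) /\
  mu.-integrable setT (EFin \o (Im \o f)).

Lemma CintegrableD f g : Cintegrable f -> Cintegrable g -> Cintegrable (fun x => f x + g x).
Proof.
move=> [fr fi] [gr gi]; split.
  apply: eq_integrable (integrableD measurableT fr gr) => // x _ /=.
  by case: (f x) (g x) => ? ? [].
apply: eq_integrable (integrableD measurableT fi gi) => // x _ /=.
by case: (f x) (g x) => ? ? [].
Qed.

Lemma CintegrableZ c f : Cintegrable f -> Cintegrable (fun x => c * f x).
Proof.
move=> [fr fi]; case: c => a b; split.
  apply: eq_integrable (integrableB measurableT (integrableZl measurableT a fr)
    (integrableZl measurableT b fi)) => // x _ /=.
  by case: (f x).
apply: eq_integrable (integrableD measurableT (integrableZl measurableT a fi)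
    (integrableZl measurableT b fr)) => // x _ /=.
by case: (f x).
Qed.

Lemma Cintegrable_sum (I : Type) (s : seq I) (F : I -> T -> R[i]) :
  (forall i, Cintegrable (F i)) -> Cintegrable (fun x => \sum_(i <- s) F i x).
Proof.
move=> iF; elim: s => [|i s IH].
  under eq_fun do rewrite big_nil.
  by split; exact: (@integrable0 _ _ _ mu setT).
by under eq_fun do rewrite big_cons; exact: CintegrableD.
Qed.

Lemma CintegralD f g : Cintegrable f -> Cintegrable g ->
  Cintegral mu (fun x => f x + g x) = Cintegral mu f + Cintegral mu g.
Proof.
move=> [fr fi] [gr gi]; apply/eqP; rewrite eq_complex /=; apply/andP; split; apply/eqP;
  rewrite -RintegralD//; apply: eq_Rintegral => x _ /=; by case: (f x) (g x) => ? ? [].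
Qed.

Lemma CintegralZ c f : Cintegrable f ->
  Cintegral mu (fun x => c * f x) = c * Cintegral mu f.
Proof.
move=> [fr fi].
have Z k (h : T -> R) : mu.-integrable setT (EFin \o h) ->
    mu.-integrable setT (EFin \o (fun x => k * h x)).
  by move=> /(integrableZl measurableT k); apply: eq_integrable.
case: c => a b; apply/eqP; rewrite eq_complex /=; apply/andP; split; apply/eqP.
  rewrite -!RintegralZl// -RintegralB//; [|exact: Z|exact: Z].
  by apply: eq_Rintegral => x _; case: (f x).
rewrite -!RintegralZl// -RintegralD//; [|exact: Z|exact: Z].
by apply: eq_Rintegral => x _; case: (f x).
Qed.

Lemma Cintegral_real (h : T -> R) : Cintegral mu (fun x => (h x)%:C) = (\int[mu]_x h x)%:C.
Proof. by rewrite /Cintegral /= /Rintegral [X in _ +i* fine X]integral0. Qed.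

Lemma Cintegrable_real (h : T -> R) : mu.-integrable setT (EFin \o h) ->
  Cintegrable (fun x => (h x)%:C).
Proof. by move=> ih; split => //=; exact: (@integrable0 _ _ _ mu setT). Qed.

End ComplexIntegral.

Section GaussianRn.
Context {R : realType} {n : nat}.
Local Notation P := (mpoly n R[i]).
Local Notation leb := (lebesgue_Rn R n).
Implicit Types p q : P.

Lemma enorm_sqr (x : Rn R n) : enorm x ^+ 2 = \sum_(i < n) tnth x i ^+ 2.
Proof. by rewrite sqr_sqrtr// sumr_ge0// => i _; exact: sqr_ge0. Qed.

Lemma enorm_ge0 (x : Rn R n) : 0 <= enorm x.
Proof. exact: sqrtr_ge0. Qed.

Lemma Cpoly_funX m x : Cpoly_fun (mpolyX R[i] m) x = (\prod_(i < n) tnth x i ^+ m i)%:C.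
Proof.
rewrite /Cpoly_fun mevalX rmorph_prod; apply: eq_bigr => i _.
by rewrite rmorphXn.
Qed.

Definition gauss_Cpoly p (x : Rn R n) : R[i] := Cpoly_fun p x * (expR (- enorm x ^+ 2))%:C.

Definition gauss_monomial_Rn (m : multinom n) (x : Rn R n) : R :=
  \prod_(i < n) gauss_monomial (m i) (tnth x i).

Lemma gauss_Cpoly_sum p x : gauss_Cpoly p x =
  \sum_(m <- msupp p) mcoeff m p * (gauss_monomial_Rn m x)%:C.
Proof.
rewrite /gauss_Cpoly {1}(mpolyE p) /Cpoly_fun raddf_sum mulr_suml.
apply: eq_bigr => m _; rewrite /= mevalZ -/(Cpoly_fun (mpolyX _ m) x) Cpoly_funX -mulrA.
congr (_ * _); rewrite -rmorphM /gauss_monomial_Rn big_split /=; congr (_ * _)%:C.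
by rewrite enorm_sqr -sumrN expR_sum.
Qed.

Lemma integrable_gauss_monomial_Rn m : leb.-integrable setT (EFin \o gauss_monomial_Rn m).
Proof.
apply: (integrable_prod_Rn (F := fun i => gauss_monomial (m i))) => i.
exact: integrable_gauss_monomial.
Qed.

Lemma Cintegrable_gauss_Cpoly p : Cintegrable leb (gauss_Cpoly p).
Proof.
rewrite (_ : gauss_Cpoly p = fun x => \sum_(m <- msupp p) mcoeff m p * (gauss_monomial_Rn m x)%:C).
  apply: Cintegrable_sum => m; apply: CintegrableZ; apply: Cintegrable_real.
  exact: integrable_gauss_monomial_Rn.
by apply/funext => x; exact: gauss_Cpoly_sum.
Qed.

Definition gaussC p : R[i] := Cintegral leb (gauss_Cpoly p).

Lemma gaussCD p q : gaussC (p + q) = gaussC p + gaussC q.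
Proof.
rewrite -CintegralD; [|exact: Cintegrable_gauss_Cpoly|exact: Cintegrable_gauss_Cpoly].
congr Cintegral; apply/funext => x.
by rewrite /gauss_Cpoly /Cpoly_fun mevalD mulrDl.
Qed.

Lemma gaussCZ c p : gaussC (c *: p) = c * gaussC p.
Proof.
rewrite -CintegralZ; last exact: Cintegrable_gauss_Cpoly.
congr Cintegral; apply/funext => x.
by rewrite /gauss_Cpoly /Cpoly_fun mevalZ mulrA.
Qed.

Lemma gaussCX m : gaussC (mpolyX _ m) = (\prod_(i < n) gauss_moment (m i) : R)%:C.
Proof.
rewrite /gaussC (_ : gauss_Cpoly _ = fun x => (gauss_monomial_Rn m x)%:C).
  rewrite Cintegral_real; congr _%:C.
  apply: (Rintegral_prod_Rn (F := fun i => gauss_monomial (m i))) => i.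
  exact: integrable_gauss_monomial.
apply/funext => x; rewrite gauss_Cpoly_sum msuppX big_seq1 mcoeffX eqxx mul1r//.
Qed.

Lemma gaussC1 : gaussC 1 = (Num.sqrt pi ^+ n)%:C.
Proof.
rewrite -mpolyX0 gaussCX; under eq_bigr do rewrite mnm0E gauss_moment0.
by rewrite prodr_const card_ord.
Qed.

Lemma gaussC_adj i p : gaussC (mderiv i p) = gaussC (2 * mpolyX _ (mnm1 i) * p).
Proof.
have gsum (I : Type) (s : seq I) (F : I -> P) : gaussC (\sum_(x <- s) F x) = \sum_(x <- s) gaussC (F x).
  by apply: (big_morph _ gaussCD); rewrite -(scale0r (0 : P)) gaussCZ mul0r.
rewrite {1 2}(mpolyE p) raddf_sum mulr_sumr !gsum; apply: eq_bigr => m _ /=.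
rewrite mderivZ -scalerAr !gaussCZ; apply: (congr1 (fun z => mcoeff m p * z)).
rewrite mderivX gaussCZ -mulrA -mpolyC_nat mul_mpolyC gaussCZ -mpolyXD !gaussCX.
rewrite (_ : 2 = 2%:R%:C); last by rewrite rmorph_nat.
rewrite -[(m i)%:R](rmorph_nat (real_complex R)) -!rmorphM /=; congr _%:C.
rewrite (bigD1 i)//= [in RHS](bigD1 i)//= mnmBE mnmDE mnm1E eqxx subn1 add1n !mulrA.
rewrite gauss_moment_rec; congr (_ * _); apply: eq_bigr => j ji.
by rewrite mnmBE mnmDE mnm1E eq_sym (negPf ji) subn0 add0n.
Qed.

Definition Cpoly_conj p : P := map_mpoly (@conjc R) p.

Lemma Cpoly_fun_conj p x : Cpoly_fun (Cpoly_conj p) x = conjc (Cpoly_fun p x).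
Proof.
rewrite /Cpoly_conj /map_mpoly /mmap /Cpoly_fun raddf_sum [in RHS]mevalE conjc_sum.
apply: eq_bigr => m _; rewrite /= mmap1_id mevalM mevalC conjcM; congr (_ * _).
by rewrite -!mevalX -/(Cpoly_fun (mpolyX _ m) x) Cpoly_funX conjc_real.
Qed.

Lemma Cpoly_conj_mderiv i p : mderiv i (Cpoly_conj p) = Cpoly_conj (mderiv i p).
Proof.
apply/mpolyP => m; rewrite mcoeff_deriv !mcoeff_map_mpoly mcoeff_deriv.
by rewrite raddfMn.
Qed.

Lemma Cpoly_funM p q x : Cpoly_fun (p * q) x = Cpoly_fun p x * Cpoly_fun q x.
Proof. exact: mevalM. Qed.

Lemma gaussC_inner p q (h : Rn R n -> R) :
  (forall x, h x ^+ 2 = expR (- enorm x ^+ 2)) ->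
  inner leb (fun x => Cpoly_fun p x * (h x)%:C) (fun x => Cpoly_fun q x * (h x)%:C) =
  gaussC (p * Cpoly_conj q).
Proof.
move=> hE; rewrite /inner /gaussC; congr (Cintegral _ _); apply/funext => x.
have -> : Num.conj (Cpoly_fun q x * (h x)%:C) = conjc (Cpoly_fun q x) * (h x)%:C.
  by rewrite -[in RHS](conjc_real (h x)); exact: conjcM.
by rewrite /gauss_Cpoly Cpoly_funM Cpoly_fun_conj -hE expr2 rmorphM /=; ring.
Qed.

End GaussianRn.

(** * Polar coordinates *)

Section RestrictedMeasure.
Context {d : measure_display} {T : measurableType d} {R : realType}.
Variable mu : {measure set T -> \bar R}.

Lemma ge0_integral_mrestr (B : set T) (mB : measurable B) (f : T -> \bar R) :
  measurable_fun setT f -> (forall x, 0 <= f x)%E ->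
  (\int[mrestr mu mB]_x f x = \int[mu]_(x in B) f x)%E.
Proof.
move=> mf f0.
have mB' : measurable (~` B) by exact: measurableC.
rewrite [LHS](@ge0_negligible_integral _ _ _ _ _ (~` B))//; last first.
  by rewrite -[LHS]/(mu (~` B `&` B)) setICl measure0.
rewrite setTD setCK.
rewrite [RHS](@eq_measure_integral _ _ _ _ (measure_add (mrestr mu mB) (mrestr mu mB'))); last first.
  move=> A mA _; transitivity (mu (A `&` B) + mu (A `&` ~` B))%E; last exact/esym/measure_addE.
  rewrite -[in LHS](setIT A) -(setUCr B) setIUr measureU//.
  - exact: measurableI.
  - exact: measurableI.
  - by rewrite setIACA setICr setI0.
have mfB := measurable_funS measurableT (@subsetT _ B) mf.
rewrite ge0_integral_measure_add// [X in (_ + X)%E](_ : _ = 0%E) ?adde0//.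
by apply: null_set_integral => //; rewrite -[LHS]/(mu (B `&` ~` B)) setICr measure0.
Qed.
End RestrictedMeasure.

Section LayerCake.
Context {R : realType} {n : nat}.
Local Notation mu := (@lebesgue_measure R).
Local Notation leb := (lebesgue_Rn R n).
Implicit Types x : Rn R n.

Lemma enorm_scale (c : R) x : 0 <= c -> enorm (Rn_scale c x) = c * enorm x.
Proof.
move=> c0; rewrite /enorm; under eq_bigr do rewrite tnth_mktuple exprMn.
by rewrite -mulr_sumr sqrtrM ?sqr_ge0// sqrtr_sqr ger0_norm.
Qed.

Lemma normalize_scale (c : R) x : 0 < c -> normalize (Rn_scale c x) = normalize x.
Proof.
move=> c0; apply: eq_from_tnth => i; rewrite !tnth_mktuple enorm_scale ?ltW//.
by rewrite invfM mulrACA divff ?mul1r// gt_eqF.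
Qed.

Lemma scale_normalize x : 0 < enorm x -> Rn_scale (enorm x) (normalize x) = x.
Proof.
move=> x0; apply: eq_from_tnth => i; rewrite !tnth_mktuple mulrC divfK// gt_eqF//.
Qed.

Definition punctured_ball : set (Rn R n) := [set x | 0 < enorm x <= 1].
Definition punctured : set (Rn R n) := [set x | 0 < enorm x].

Lemma measurable_punctured_ball : measurable punctured_ball.
Proof.
rewrite (_ : punctured_ball = enorm @^-1` `]0, 1]%classic).
  by rewrite -[X in measurable X]setTI; exact: measurable_enorm.
by apply/seteqP; split=> x /=; rewrite in_itv.
Qed.

Lemma measurable_punctured : measurable punctured.
Proof.
rewrite (_ : punctured = enorm @^-1` `]0, +oo[%classic).
  by rewrite -[X in measurable X]setTI; exact: measurable_enorm.
by apply/seteqP; split=> x /=; rewrite in_itv/= andbT.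
Qed.

(* Fubini on |x|^2 <= u: each u-section is a dilate of the punctured unit ball. *)
Let S : set (Rn R n * R) := [set z | 0 < enorm z.1 /\ enorm z.1 ^+ 2 <= z.2].

Let mS : measurable (S : set (Rn R n * measurableTypeR R)).
Proof.
have m1 : measurable_fun setT (fun z : Rn R n * measurableTypeR R => enorm z.1).
  by apply: measurableT_comp; [exact: measurable_enorm|exact: measurable_fst].
have m2 : measurable_fun setT (fun z : Rn R n * measurableTypeR R => z.2 - enorm z.1 ^+ 2).
  by apply: measurable_funB; [exact: measurable_snd|exact: measurable_funX].
rewrite (_ : S = ((fun z : Rn R n * measurableTypeR R => enorm z.1) @^-1` `]0, +oo[%classic) `&`
  ((fun z : Rn R n * measurableTypeR R => z.2 - enorm z.1 ^+ 2) @^-1` `[0, +oo[%classic)).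
  apply: measurableI; rewrite -[X in measurable X]setTI; [exact: m1|exact: m2].
by apply/seteqP; split=> z /=; rewrite !in_itv/= !andbT subr_ge0.
Qed.

Variables (Q : Rn R n -> R) (g : R -> R).
Hypothesis mQ : measurable_fun setT Q.
Hypothesis Q0 : forall x, 0 <= Q x.
Hypothesis Qscale : forall c x, 0 < c -> Q (Rn_scale c x) = Q x.
Hypothesis mg : measurable_fun setT g.
Hypothesis g0 : forall u, 0 <= g u.

Let f (z : Rn R n * measurableTypeR R) : \bar R := (Q z.1 * g z.2 * \1_S z)%:E.

Let mf : measurable_fun setT f.
Proof.
apply/measurable_EFinP; apply: measurable_funM; last exact: (measurable_indic mS).
apply: measurable_funM.
  by apply: measurableT_comp; [exact: mQ|exact: measurable_fst].
by apply: measurableT_comp; [exact: mg|exact: measurable_snd].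
Qed.

Let f0 z : (0 <= f z)%E.
Proof. by rewrite lee_fin !mulr_ge0. Qed.

Let tail x : (\int[mu]_u f (x, u) =
  if (0 < enorm x)%R then (Q x)%:E * \int[mu]_(u in `[(enorm x ^+ 2)%R, +oo[) (g u)%:E else 0)%E.
Proof.
case: ifPn => x0; last first.
  rewrite integral0_eq// => u _; rewrite /f indicE memNset ?mulr0// => -[/= h _].
  by rewrite h in x0.
rewrite -ge0_integralZl//; last 3 first.
- exact/measurable_EFinP/measurable_funTS.
- by move=> u _; rewrite lee_fin.
- by rewrite lee_fin.
rewrite [RHS]integral_mkcond; apply: eq_integral => u _; rewrite patchE /f /= indicE.
rewrite mem_setE in_itv/= andbT.
have -> : (x, u) \in S = (enorm x ^+ 2 <= u).
  by apply/idP/idP => [/set_mem[]//|h]; apply/mem_set.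
by case: ifPn => _; [rewrite mulr1 EFinM|rewrite mulr0].
Qed.

Lemma measurable_layer :
  measurable_fun punctured (fun x => (Q x)%:E * \int[mu]_(u in `[(enorm x ^+ 2)%R, +oo[) (g u)%:E)%E.
Proof.
have h := @measurable_fun_fubini_tonelli_F _ _ _ _ _ mu f mf f0.
apply: (eq_measurable_fun (fun x => \int[mu]_u f (x, u))%E).
  by move=> x /set_mem xp; rewrite tail xp.
exact: measurable_funTS.
Qed.

Lemma layer_cake :
  (\int[leb]_(x in punctured) ((Q x)%:E * \int[mu]_(u in `[(enorm x ^+ 2)%R, +oo[) (g u)%:E) =
   \int[leb]_(x in punctured_ball) (Q x)%:E * \int[mu]_(u in `]0%R, +oo[) (g u * u `^ (n%:R / 2))%:E)%E.
Proof.
transitivity (\int[leb]_x \int[mu]_u f (x, u))%E.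
  rewrite integral_mkcond; apply: eq_integral => x _; rewrite tail patchE.
  by rewrite mem_setE; case: ifPn.
rewrite (@fubini_tonelli _ _ _ _ _ leb mu f mf f0).
set C := (\int[leb]_(x in punctured_ball) (Q x)%:E)%E.
have C0 : (0 <= C)%E by apply: integral_ge0 => x _; rewrite lee_fin.
rewrite muleC -ge0_integralZr//; last 2 first.
- apply/measurable_EFinP/measurable_funTS; apply: measurable_funM => //; exact: measurable_powR.
- by move=> u _; rewrite lee_fin mulr_ge0 ?powR_ge0.
rewrite [RHS]integral_mkcond; apply: eq_integral => u _; rewrite patchE mem_setE in_itv/= andbT.
case: ifPn => [u0|]; last first.
  rewrite -leNgt => u0; rewrite integral0_eq// => x _.
  rewrite /f indicE memNset ?mulr0// => -[/= x0 xu].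
  by have := exprn_gt0 2 x0; rewrite ltNge (le_trans xu u0).
have su : 0 < Num.sqrt u by rewrite sqrtr_gt0.
have [su' u0'] : 0 <= Num.sqrt u /\ 0 <= u by split; exact: ltW.
rewrite (@ge0_integral_Rn_scale _ _ (Num.sqrt u) (fun x => f (x, u)))//; last first.
  by apply: (measurableT_comp mf); exact: measurable_pair2.
transitivity ((Num.sqrt u ^+ n)%:E * ((g u)%:E * C))%E.
  congr (_ * _)%E; rewrite /C -ge0_integralZl//; last 4 first.
  - exact: measurable_punctured_ball.
  - exact/measurable_EFinP/measurable_funTS.
  - by move=> x _; rewrite lee_fin.
  - by rewrite lee_fin.
  rewrite [RHS]integral_mkcond; apply: eq_integral => x _; rewrite patchE /f /= Qscale// indicE.
  have -> : (Rn_scale (Num.sqrt u) x, u) \in S = (x \in punctured_ball).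
    have eS : enorm (Rn_scale (Num.sqrt u) x) = Num.sqrt u * enorm x by rewrite enorm_scale.
    have eS2 : (enorm (Rn_scale (Num.sqrt u) x) ^+ 2 <= u) = (enorm x <= 1).
      by rewrite eS exprMn sqr_sqrtr// ger_pMr// expr_le1// enorm_ge0.
    apply/idP/idP => [/set_mem[/= + +]|/set_mem/andP[x0 x1]].
      by rewrite eS2 eS pmulr_rgt0// => x0 x1; apply/mem_set/andP.
    by apply/mem_set; split => /=; rewrite ?eS2// eS pmulr_rgt0.
  by case: ifPn => _; [rewrite mulr1 EFinM muleC|rewrite mulr0].
rewrite muleA -EFinM; congr (_%:E * _)%E; rewrite mulrC; congr (_ * _).
by rewrite -powR12_sqrt// -powR_mulrn ?powR_ge0// -powRrM mulrC.
Qed.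

End LayerCake.

Section Polar.
Context {R : realType} {n : nat}.
Hypothesis n_gt0 : (0 < n)%N.
Local Notation mu := (@lebesgue_measure R).
Local Notation leb := (lebesgue_Rn R n).
Implicit Types x : Rn R n.

Lemma cvg_powR_expRN (s : R) : u `^ s * expR (- u) @[u --> +oo] --> (0 : R).
Proof.
pose m := (Num.truncn `|s|).+1.
apply: (@squeeze_cvgr _ _ _ _ (fun=> 0) (fun u : R => (m.+1)`!%:R * u^-1)).
- near=> u; have u1 : 1 <= u by near: u; exact: nbhs_pinfty_ge.
  have u0 : 0 < u by exact: lt_le_trans u1.
  rewrite mulr_ge0 ?powR_ge0 ?expR_ge0//= expRN ler_pdivrMr ?expR_gt0//.
  rewrite mulrAC ler_pdivlMr//.
  apply: le_trans (expr_le_expR m.+1 (ltW u0)).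
  rewrite exprSr ler_wpM2r ?(ltW u0)// -powR_mulrn ?(ltW u0)// ler_powR//.
  by rewrite (le_trans (ler_norm s))// ltW// truncnS_gt.
- exact: cvg_cst.
- rewrite -[X in _ --> X](mulr0 (m.+1)`!%:R); apply: cvgMr.
  apply/gtr0_cvgV0; last exact: cvg_id.
  by near=> u; near: u; exact: nbhs_pinfty_gt.
Unshelve. all: by end_near. Qed.

Lemma integral_tail_powR_expRN (s t : R) : 0 <= s -> 0 < t ->
  (\int[mu]_(u in `[t, +oo[) (u `^ s * expR (- u))%:E =
   \int[mu]_(u in `[t, +oo[) (s * u `^ (s - 1) * expR (- u))%:E + (t `^ s * expR (- t))%:E)%E.
Proof.
move=> s0 t0.
pose b : R^nat := fun k => t + k.+1%:R.
have ge k u : u \in `[t, b k] -> t <= u by rewrite in_itv/= => /andP[].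
have <- : \bigcup_k [set` `[t, b k]] = `[t, +oo[%classic.
  apply/seteqP; split=> [x [k _ /ge tx]|x /=]; first by rewrite /= in_itv/= tx.
  rewrite in_itv/= andbT => tx; exists (Num.truncn (x - t)) => //=.
  by rewrite in_itv/= tx -lerBlDl ltW// truncnS_gt.
have pos k u : u \in `[t, b k] -> 0 < u by move=> /ge; exact: lt_le_trans.
apply: (@ge0_integration_by_parts_bigcup _ (fun=> t) b (fun u => - (u `^ s * expR (- u)))).
- by move=> k; rewrite ltrDl.
- by [].
- by move=> k m km; rewrite lerD2l ler_nat.
- by move=> k u /pos u0; have := is_deriveN (is_derive_powR_expRN s u0); rewrite opprB.
- move=> k u /pos u0; split; first exact: continuous_powR_expRN.
  rewrite (_ : (fun _ => _) = (fun u : R => s * (u `^ (s - 1) * expR (- u)))).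
    by apply: cvgMr; exact: continuous_powR_expRN.
  by apply/funext => v; rewrite mulrA.
- by move=> k u _; rewrite !mulr_ge0 ?powR_ge0 ?expR_ge0.
- rewrite -[X in _ --> X]add0r; apply: cvgD; last by rewrite opprK; exact: cvg_cst.
  rewrite -oppr0; apply: cvgN.
  apply: (@cvg_comp _ _ _ _ (fun u : R => u `^ s * expR (- u)) _ _ _ _ (cvg_powR_expRN s)).
  apply/cvgryPge => M; have [N _ hN] := @nbhs_infty_ger R (M - t).
  exists N => // k /= /hN /=; rewrite lerBlDl => /le_trans; apply.
  by rewrite lerD2l ler_nat.
Qed.

Lemma lebesgue_Rn_norm0 : leb [set x | enorm x = 0] = 0%E.
Proof.
case: n n_gt0 => // m _.
have m0 : measurable [set x : Rn R m.+1 | tnth x ord0 = 0].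
  rewrite (_ : [set _ | _] = (fun x : Rn R m.+1 => tnth x ord0) @^-1` [set 0]) //.
  by rewrite -[X in measurable X]setTI; exact: measurable_tnth.
apply/eqP; rewrite -measure_le0.
apply: (@le_trans _ _ (lebesgue_Rn R m.+1 [set x : Rn R m.+1 | tnth x ord0 = 0])).
  apply: le_measure; rewrite ?inE//.
    rewrite (_ : [set _ | _] = (@enorm R m.+1) @^-1` [set 0]) //.
    by rewrite -[X in measurable X]setTI; exact: measurable_enorm.
  move=> x /= /eqP; rewrite sqrtr_eq0 => h; apply/eqP; rewrite -sqrf_eq0 eq_le sqr_ge0 andbT.
  apply: le_trans h; rewrite (bigD1 ord0)//= lerDl sumr_ge0// => i _; exact: sqr_ge0.
rewrite -[leLHS]/((mu \x lebesgue_Rn R m)%E (@Rn_cons R m @^-1` [set x : Rn R m.+1 | tnth x ord0 = 0])).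
rewrite (_ : _ @^-1` _ = [set (0 : measurableTypeR R)] `*` setT); last first.
  by apply/seteqP; split => -[a y] /=; rewrite tnth0 => // -[].
rewrite product_measure1E//= -[X in (_ <= X)%E](mul0e (lebesgue_Rn R m setT)).
rewrite le_eqVlt; apply/orP; left; apply/eqP; congr (_ * _)%E; exact: lebesgue_measure_set1.
Qed.

Lemma lebesgue_Rn_ball_lty : (leb punctured_ball < +oo)%E.
Proof.
have mB := @measurable_punctured_ball R n.
apply: (@le_lt_trans _ _ (\int[leb]_x (expR 1 * (expR (- enorm x ^+ 2)))%:E)%E).
  rewrite -[leb _]mul1e -integral_cst// integral_mkcond.
  apply: ge0_le_integral => //.
  - by move=> x _; rewrite patchE; case: ifP.
  - by apply/measurable_restrict => //; exact: measurable_cst.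
  - apply/measurable_EFinP; apply: measurable_funM => //; apply: measurableT_comp => //.
    by apply: measurableT_comp => //; apply: measurable_funX; exact: measurable_enorm.
  move=> x _; rewrite patchE; case: ifPn => [/set_mem/andP[x0 x1]|_].
    by rewrite -expRD lee_fin -[leLHS]expR0 ler_expR subr_ge0 expr_le1// enorm_ge0.
  have h : (0 <= (expR 1 * expR (- enorm x ^+ 2))%:E)%E by rewrite lee_fin mulr_ge0 ?expR_ge0.
  exact: h.
have := integrableZl measurableT (expR 1) (@integrable_gauss_monomial_Rn R n (@mnm0 n)).
move=> /integrableP[_]; apply: le_lt_trans.
rewrite le_eqVlt; apply/orP; left; apply/eqP; apply: eq_integral => x _ /=.
rewrite ger0_norm ?mulr_ge0 ?expR_ge0//; last first.
  by apply: prodr_ge0 => i _; rewrite /gauss_monomial mnm0E mul1r expR_ge0.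
congr (_ * _)%:E; rewrite enorm_sqr -sumrN expR_sum; apply: eq_bigr => i _.
by rewrite /gauss_monomial mnm0E mul1r.
Qed.

Lemma ge0_integral_surface (q : Rn R n -> \bar R) : measurable_fun setT q ->
  (forall x, 0 <= q x)%E ->
  (\int[surface_measure]_x q x =
   n%:R%:E * \int[leb]_(x in punctured_ball) q (normalize x))%E.
Proof.
move=> mq q0.
have mB := @measurable_punctured_ball R n.
pose push := measure_function_pushforward__canonical__measure_function_Measure
    (mrestr leb mB) (@measurable_normalize R n).
have n0 : 0 <= n%:R :> R by [].
rewrite (@eq_measure_integral _ _ _ _ [the {measure set (Rn R n) -> \bar R} of mscale (NngNum n0) push]); last first.
  move=> A mA _; rewrite -[RHS]/(n%:R%:E * leb ((normalize @^-1` A) `&` punctured_ball))%E.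
  by rewrite -[LHS]/(n%:R%:E * leb [set x | (0 < enorm x <= 1)%R /\ A (normalize x)])%E setIC.
rewrite ge0_integral_mscale//=; congr (_ * _)%E.
rewrite ge0_integral_pushforward//; last exact: measurable_normalize.
rewrite preimage_setT ge0_integral_mrestr//.
by apply: (measurableT_comp mq); exact: measurable_normalize.
by move=> x; exact: q0.
Qed.

Lemma ge0_polar (s : nat) (q : Rn R n -> R) (K : R) : measurable_fun setT q ->
  (forall x, 0 <= q x) -> (forall c x, 0 < c -> q (Rn_scale c x) = c ^+ (2 * s) * q x) ->
  (forall x, q (normalize x) <= K) ->
  (\int[leb]_x (q x * expR (- enorm x ^+ 2))%:E =
   (Gamma (s%:R + n%:R / 2) / 2)%:E * \int[surface_measure]_x (q x)%:E)%E
  /\ (\int[surface_measure]_x (q x)%:E < +oo)%E.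
Proof.
move=> mq q0 qs qK.
have mB := @measurable_punctured_ball R n.
have mP := @measurable_punctured R n.
pose Q x := q (normalize x).
have mQ : measurable_fun setT Q by apply: (measurableT_comp mq); exact: measurable_normalize.
have Q0 x : 0 <= Q x by exact: q0.
have Qs c x : 0 < c -> Q (Rn_scale c x) = Q x by move=> c0; rewrite /Q normalize_scale.
set C := (\int[leb]_(x in punctured_ball) (Q x)%:E)%E.
have C0 : (0 <= C)%E by apply: integral_ge0 => x _; rewrite lee_fin.
have Coo : (C < +oo)%E.
  apply: (@le_lt_trans _ _ (\int[leb]_(x in punctured_ball) (cst K%:E) x)%E).
    apply: ge0_le_integral => //.
    - by move=> x _; rewrite lee_fin.
    - by apply/measurable_EFinP; exact: measurable_funTS.
    - by move=> x _; rewrite lee_fin qK.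
  rewrite integral_cst// lte_mul_pinfty//; last exact: lebesgue_Rn_ball_lty.
  by rewrite lee_fin (le_trans (Q0 [tuple of nseq n 0])) ?qK.
rewrite ge0_integral_surface//; last exact/measurable_EFinP.
rewrite -/C; split; last by rewrite lte_mul_pinfty.
have np : 0 < n%:R / 2 :> R by rewrite divr_gt0// ltr0n.
have sn : 0 < s%:R + n%:R / 2 :> R by rewrite ltr_wpDl.
(* r^s e^{-r} is the integral of u^s e^{-u} - s u^{s-1} e^{-u} over u >= r; both
   terms are nonnegative, so that the layer cake applies to each. *)
pose g1 (u : R) := u `^ s%:R * expR (- u).
pose g2 (u : R) := s%:R * u `^ (s%:R - 1) * expR (- u).
have mg1 : measurable_fun setT g1 by exact: measurable_powR_expRN.
have mg2 : measurable_fun setT g2.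
  rewrite /g2; under eq_fun do rewrite -mulrA; apply: measurable_funM => //.
  exact: measurable_powR_expRN.
have g10 u : 0 <= g1 u by rewrite mulr_ge0 ?powR_ge0 ?expR_ge0.
have g20 u : 0 <= g2 u by rewrite !mulr_ge0 ?powR_ge0 ?expR_ge0.
have X1 : (\int[mu]_(u in `]0%R, +oo[) (g1 u * u `^ (n%:R / 2))%:E = EGamma (s%:R + n%:R / 2 + 1))%E.
  apply: eq_integral => u; rewrite inE/= in_itv/= andbT => u0.
  rewrite /g1 mulrAC -powRD; last by rewrite (gt_eqF u0) implybT.
  by rewrite addrK.
have X2 : (\int[mu]_(u in `]0%R, +oo[) (g2 u * u `^ (n%:R / 2))%:E = s%:R%:E * EGamma (s%:R + n%:R / 2))%E.
  rewrite /EGamma -ge0_integralZl//; last 2 first.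
  - by apply/measurable_EFinP; exact: measurable_powR_expRN.
  - by move=> u _; rewrite lee_fin mulr_ge0 ?powR_ge0 ?expR_ge0.
  apply: eq_integral => u; rewrite inE/= in_itv/= andbT => u0.
  rewrite /g2 -EFinM addrAC (@powRD _ u (s%:R - 1) (n%:R / 2)); last by rewrite (gt_eqF u0) implybT.
  by congr _%:E; ring.
have L1 := layer_cake mQ Q0 Qs mg1 g10; have L2 := layer_cake mQ Q0 Qs mg2 g20.
have ML2 := measurable_layer mQ Q0 mg2 g20.
set X := (\int[leb]_x (q x * expR (- enorm x ^+ 2))%:E)%E.
have mX : measurable_fun setT (fun x => (q x * expR (- enorm x ^+ 2))%:E).
  apply/measurable_EFinP; apply: measurable_funM => //; apply: measurableT_comp => //.
  by apply: measurableT_comp => //; apply: measurable_funX; exact: measurable_enorm.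
have XE : X = (\int[leb]_(x in punctured) (q x * expR (- enorm x ^+ 2))%:E)%E.
  rewrite /X (@ge0_negligible_integral _ _ _ _ _ [set x | enorm x = 0])//.
  - congr integral; apply/seteqP; split => x /=.
      by move=> [_ /eqP x0]; rewrite /punctured/= lt_neqAle eq_sym x0 enorm_ge0.
    by move=> x0; split => // x00; move: x0; rewrite /punctured/= x00 ltxx.
  - rewrite (_ : [set _ | _] = (@enorm R n) @^-1` [set 0]) //.
    by rewrite -[X in measurable X]setTI; exact: measurable_enorm.
  - by move=> x _; rewrite lee_fin mulr_ge0 ?expR_ge0.
  - exact: lebesgue_Rn_norm0.
have key : (C * EGamma (s%:R + n%:R / 2 + 1)%R = C * (s%:R%:E * EGamma (s%:R + n%:R / 2)%R) + X)%E.
  rewrite -X1 -X2 -L1 -L2 XE -ge0_integralD//; last 3 first.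
  - by move=> x _; rewrite mule_ge0 ?lee_fin ?integral_ge0// => u _; rewrite lee_fin.
  - by move=> x _; rewrite lee_fin mulr_ge0 ?expR_ge0.
  - exact: measurable_funTS.
  apply: eq_integral => x /set_mem x0.
  rewrite integral_tail_powR_expRN ?exprn_gt0// ge0_muleDr//; last 2 first.
  - by apply: integral_ge0 => u _; rewrite lee_fin; exact: g20.
  - by rewrite lee_fin mulr_ge0 ?powR_ge0 ?expR_ge0.
  congr (_ + _)%E; rewrite -EFinM powR_mulrn ?sqr_ge0// mulrA; congr (_ * _)%:E.
  by rewrite -[in RHS](scale_normalize x0) qs// exprM mulrC.
move: key; rewrite EGammaS// -!EFin_Gamma//.
have Cf : C \is a fin_num by rewrite ge0_fin_numE.
rewrite -(fineK Cf) -!EFinM; set c := fine C; set G := Gamma _.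
clear XE; case: X => [r| |]//.
by rewrite -EFinD => -[h]; congr _%:E; lra.
Qed.

End Polar.

Section SignedPolar.
Context {R : realType} {n : nat}.
Hypothesis n_gt0 : (0 < n)%N.
Local Notation leb := (lebesgue_Rn R n).
Implicit Types x : Rn R n.

Lemma Rintegral_polar (s : nat) (q : Rn R n -> R) (K : R) : measurable_fun setT q ->
  (forall c x, 0 < c -> q (Rn_scale c x) = c ^+ (2 * s) * q x) ->
  (forall x, `|q (normalize x)| <= K) ->
  \int[leb]_x (q x * expR (- enorm x ^+ 2)) =
   Gamma (s%:R + n%:R / 2) / 2 * \int[surface_measure]_x q x.
Proof.
move=> mq qs qK.
have max_scale (f : Rn R n -> R) : (forall c x, 0 < c -> f (Rn_scale c x) = c ^+ (2 * s) * f x) ->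
    forall c x, 0 < c -> Num.max (f (Rn_scale c x)) 0 = c ^+ (2 * s) * Num.max (f x) 0.
  by move=> fs c x c0; rewrite fs// maxr_pMr ?mulr0// exprn_ge0// ltW.
have max_le (f : Rn R n -> R) : (forall x, `|f (normalize x)| <= K) ->
    forall x, Num.max (f (normalize x)) 0 <= K.
  by move=> fK x; rewrite ge_max (le_trans (ler_norm _) (fK x)) (le_trans (normr_ge0 _) (fK x)).
have mqN : measurable_fun setT (fun x => - q x) by exact: measurableT_comp.
have max_ge0 (f : Rn R n -> R) x : 0 <= Num.max (f x) 0 by rewrite le_max lexx orbT.
have qsN c x : 0 < c -> - q (Rn_scale c x) = c ^+ (2 * s) * - q x by move=> c0; rewrite qs// mulrN.
have qKN x : `|- q (normalize x)| <= K by rewrite normrN.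
have [P1 P2] := @ge0_polar R n n_gt0 s (fun x => Num.max (q x) 0) K
  (measurable_maxr mq (measurable_cst _)) (max_ge0 _) (max_scale _ qs) (max_le _ qK).
have [N1 N2] := @ge0_polar R n n_gt0 s (fun x => Num.max (- q x) 0) K
  (measurable_maxr mqN (measurable_cst _)) (max_ge0 (fun x => - q x)) (max_scale (fun x => - q x) qsN) (max_le (fun x => - q x) qKN).
have e0 x : 0 <= expR (- enorm x ^+ 2) by exact: expR_ge0.
rewrite /Rintegral integralE [in RHS]integralE.
have -> : (\int[leb]_x (fun x0 => (q x0 * expR (- enorm x0 ^+ 2))%:E)^\+ x =
    \int[leb]_x (Num.max (q x) 0 * expR (- enorm x ^+ 2))%:E)%E.
  by apply: eq_integral => x _; rewrite funeposE -EFin_max maxr_pMl// mul0r.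
have -> : (\int[leb]_x (fun x0 => (q x0 * expR (- enorm x0 ^+ 2))%:E)^\- x =
    \int[leb]_x (Num.max (- q x) 0 * expR (- enorm x ^+ 2))%:E)%E.
  by apply: eq_integral => x _; rewrite funenegE -EFinN -EFin_max maxr_pMl// mul0r mulNr.
have sp (f : Rn R n -> R) : (\int[surface_measure]_x (fun x0 => (f x0)%:E)^\+ x =
    \int[surface_measure]_x (Num.max (f x) 0)%:E)%E.
  by apply: eq_integral => x _; rewrite funeposE -EFin_max.
have sm (f : Rn R n -> R) : (\int[surface_measure]_x (fun x0 => (f x0)%:E)^\- x =
    \int[surface_measure]_x (Num.max (- f x) 0)%:E)%E.
  by apply: eq_integral => x _; rewrite funenegE -EFinN -EFin_max.
rewrite sp sm P1 N1.
have fin (f : Rn R n -> R) : (\int[surface_measure]_x (Num.max (f x) 0)%:E < +oo)%E ->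
    (\int[surface_measure]_x (Num.max (f x) 0)%:E)%E \is a fin_num.
  move=> h; rewrite ge0_fin_numE//; apply: integral_ge0 => x _.
  by rewrite lee_fin le_max lexx orbT.
rewrite -(fineK (fin q P2)) -(fineK (fin (fun x => - q x) N2)).
by rewrite -!EFinM -!EFinB /= mulrBr.
Qed.

Lemma measurable_Cpoly_fun (p : mpoly n R[i]) :
  measurable_fun setT (@complex.Re R \o Cpoly_fun p) /\
  measurable_fun setT (@complex.Im R \o Cpoly_fun p).
Proof.
have mm (m : multinom n) : measurable_fun setT (fun x : Rn R n => \prod_(i < n) tnth x i ^+ m i).
  by apply: measurable_prod => i _; apply: measurable_funX; exact: measurable_tnth.
have E x : Cpoly_fun p x = \sum_(m <- msupp p) mcoeff m p * (\prod_(i < n) tnth x i ^+ m i)%:C.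
  rewrite /Cpoly_fun {1}(mpolyE p) raddf_sum; apply: eq_bigr => m _.
  by rewrite /= mevalZ -/(Cpoly_fun (mpolyX _ m) x) Cpoly_funX.
have ReM (z : R[i]) (r : R) : complex.Re (z * r%:C) = complex.Re z * r.
  by case: z => a b /=; rewrite mulr0 subr0.
have ImM (z : R[i]) (r : R) : complex.Im (z * r%:C) = complex.Im z * r.
  by case: z => a b /=; rewrite mulr0 add0r.
split.
  rewrite (_ : _ \o _ = fun x => \sum_(m <- msupp p) complex.Re (mcoeff m p) * \prod_(i < n) tnth x i ^+ m i).
    by apply: measurable_sum => m; apply: measurable_funM => //; exact: measurable_cst.
  by apply/funext => x /=; rewrite E raddf_sum; apply: eq_bigr => m _ /=; rewrite ReM.
rewrite (_ : _ \o _ = fun x => \sum_(m <- msupp p) complex.Im (mcoeff m p) * \prod_(i < n) tnth x i ^+ m i).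
  by apply: measurable_sum => m; apply: measurable_funM => //; exact: measurable_cst.
by apply/funext => x /=; rewrite E raddf_sum; apply: eq_bigr => m _ /=; rewrite ImM.
Qed.

Lemma Cpoly_fun_scale (p : mpoly n R[i]) (d : nat) (c : R) x : p \is ishomog1 d mdeg ->
  Cpoly_fun p (Rn_scale c x) = (c ^+ d)%:C * Cpoly_fun p x.
Proof.
move=> /dhomogP hp; rewrite /Cpoly_fun !mevalE mulr_sumr big_seq [RHS]big_seq.
apply: eq_bigr => m /hp dm; rewrite mulrCA; congr (_ * _).
rewrite -(etrans (esym (mdegE m)) dm) -prodrXr !rmorph_prod -big_split /=; apply: eq_bigr => i _.
by rewrite tnth_mktuple rmorphM exprMn rmorphXn.
Qed.

Lemma Cpoly_fun_bounded (p : mpoly n R[i]) : exists K : R, forall x,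
  `|complex.Re (Cpoly_fun p (normalize x))| <= K /\ `|complex.Im (Cpoly_fun p (normalize x))| <= K.
Proof.
have nE x i : `|tnth (normalize x) i| <= 1.
  rewrite tnth_mktuple normrM normfV (ger0_norm (enorm_ge0 x)).
  have [->|x0] := eqVneq (enorm x) 0; first by rewrite invr0 mulr0.
  rewrite ler_pdivrMr ?mul1r ?lt_neqAle ?enorm_ge0 1?eq_sym ?x0// -sqrtr_sqr ler_wsqrtr//.
  by rewrite (bigD1 i)//= lerDl sumr_ge0// => j _; exact: sqr_ge0.
exists (\sum_(m <- msupp p) (`|complex.Re (mcoeff m p)| + `|complex.Im (mcoeff m p)|)) => x.
set r := fun m : multinom n => \prod_(i < n) tnth (normalize x) i ^+ m i.
have r1 m : `|r m| <= 1.
  rewrite normr_prod; apply: prodr_ile1 => i _.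
  by rewrite normrX exprn_ge0//= exprn_ile1.
have E : Cpoly_fun p (normalize x) = \sum_(m <- msupp p) mcoeff m p * (r m)%:C.
  rewrite /Cpoly_fun {1}(mpolyE p) raddf_sum; apply: eq_bigr => m _.
  by rewrite /= mevalZ -/(Cpoly_fun (mpolyX _ m) _) Cpoly_funX.
rewrite E !raddf_sum; split; apply: le_trans (ler_norm_sum _ _ _) _; apply: ler_sum => m _ /=.
  case: (mcoeff m p) => a b /=; rewrite mulr0 subr0 normrM ler_wpDr//.
  by rewrite ler_piMr.
case: (mcoeff m p) => a b /=; rewrite mulr0 add0r normrM ler_wpDl//.
by rewrite ler_piMr.
Qed.

Lemma gaussC_polar (s : nat) (p : mpoly n R[i]) : p \is ishomog1 (2 * s)%N mdeg ->
  gaussC p = (Gamma (s%:R + n%:R / 2) / 2)%:C * Cintegral surface_measure (Cpoly_fun p).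
Proof.
move=> hp; have [mr mi] := measurable_Cpoly_fun p; have [K hK] := Cpoly_fun_bounded p.
have hs := fun c x => Cpoly_fun_scale c x hp.
have Pr := @Rintegral_polar s _ K mr _ (fun x => (hK x).1).
have Pi := @Rintegral_polar s _ K mi _ (fun x => (hK x).2).
apply/eqP; rewrite eq_complex /= !mul0r subr0 addr0 -Pr; last first.
  by move=> c x _; rewrite /= hs; case: (Cpoly_fun p x) => a b /=; rewrite mul0r subr0.
rewrite -Pi; last first.
  by move=> c x _; rewrite /= hs; case: (Cpoly_fun p x) => a b /=; rewrite mul0r addr0.
apply/andP; split; apply/eqP; apply: eq_Rintegral => x _; rewrite /gauss_Cpoly /=;
  case: (Cpoly_fun p x) => a b /=; rewrite mulr0 ?subr0 ?add0r//.
Qed.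

End SignedPolar.

(** * Hermite and Laguerre polynomials *)

Section SpecialPolynomials.

Fixpoint hermP (R : nzRingType) (k : nat) : {poly R} :=
  if k is k'.+1 then 2 * 'X * hermP R k' - (hermP R k')^`() else 1.

(* [lagP b k] is k! L_k^b: the factorial keeps the recursion free of division. *)
Fixpoint lagP (K : fieldType) (b : K) (k : nat) : {poly K} :=
  if k is k'.+1 then 'X * (lagP b k')^`() + ((b + k'.+1%:R)%:P - 'X) * lagP b k' else 1.

Lemma deriv_natr (R : nzRingType) k : (k%:R : {poly R})^`() = 0.
Proof. by rewrite -polyC_natr derivC. Qed.

Lemma deriv_hermP (R : comNzRingType) k : (hermP R k)^`() = (2 * k)%:R * hermP R k.-1.
Proof.
elim: k => [|k IH]; first by rewrite /= -[1]/(1%:R) deriv_natr muln0 mul0r.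
rewrite [hermP R k.+1]/= derivB -mulrA !derivM derivX deriv_natr mul0r add0r mul1r.
rewrite IH derivM deriv_natr mul0r add0r.
case: k IH => [|k] IH; first by rewrite /= muln0 !mul0r mulr0 addr0 subr0 muln1.
rewrite [k.+1.-1]/= [k.+2.-1]/= [in RHS]/= [hermP R k.+1 in LHS]/=.
have -> : (2 * k.+2)%:R = 2 + (2 * k.+1)%:R :> {poly R} by rewrite -natrD; congr _%:R; lia.
by ring.
Qed.

Lemma hermP_rec (R : comNzRingType) k :
  hermP R k.+2 = 2 * 'X * hermP R k.+1 - (2 * k.+1)%:R * hermP R k.
Proof.
rewrite [LHS]/= -[2 * 'X * hermP R k - (hermP R k)^`()]/(hermP R k.+1).
by rewrite deriv_hermP.
Qed.

Lemma map_lagP (K L : fieldType) (f : {rmorphism K -> L}) (b : K) k :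
  map_poly f (lagP b k) = lagP (f b) k.
Proof.
elim: k => [|k IH] /=; first by rewrite rmorph1.
rewrite rmorphD !rmorphM rmorphB /= map_polyX -deriv_map map_polyC /= IH.
by rewrite rmorphD rmorph_nat.
Qed.

Section RealPoly.
Context {R : realType}.
Implicit Types (q : {poly R}) (t u a b : R).

Lemma is_derive_horner q t : is_derive t 1 (horner q) q^`().[t].
Proof.
elim/poly_ind: q => [|q c IH].
  rewrite deriv0 horner0 (_ : horner 0 = cst 0); first exact: is_derive_cst.
  by apply/funext => u; rewrite horner0.
rewrite (_ : horner _ = (fun u => q.[u] * u) \+ cst c); last first.
  by apply/funext => u; rewrite !hornerE.
apply: (is_derive_eq (is_deriveD (is_deriveM IH (is_derive_id t 1)) (is_derive_cst c t 1))).
by rewrite /GRing.scale /= derivD derivC derivM derivX !hornerE; ring.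
Qed.

Lemma hermite_polyE k t : hermite_poly k t = (hermP R k).[t].
Proof.
have D : derive1n k (fun u : R => expR (- u ^+ 2)) = fun u => ((-1) ^+ k *: hermP R k).[u] * expR (- u ^+ 2).
  elim: k => [|k IH]; first by rewrite derive1n0; apply/funext => u; rewrite expr0 scale1r hornerC mul1r.
  rewrite derive1nS IH; apply/funext => u; rewrite derive1E.
  have d2 : is_derive u 1 (fun v : R => expR (- v ^+ 2)) (- (2 * u) * expR (- u ^+ 2)).
    have := is_derive_gauss_monomial 0 u.
    rewrite (_ : gauss_monomial 0 = fun v : R => expR (- v ^+ 2)); last first.
      by apply/funext => v; rewrite /gauss_monomial mul1r.
    by move=> h; apply: (is_derive_eq h); rewrite /gauss_monomial /= expr1; ring.
  have dd := is_deriveM (is_derive_horner ((-1) ^+ k *: hermP R k) u) d2.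
  rewrite (@derive_val _ _ _ _ _ _ _ dd) /GRing.scale /= (exprS (-1) k) derivZ.
  by rewrite !hornerZ hornerD hornerN !hornerM hornerX -polyC_natr hornerC; ring.
have e1 : expR (t ^+ 2) * expR (- t ^+ 2) = 1 by rewrite -expRD subrr expR0.
have s1 : (-1) ^+ k * (-1) ^+ k = 1 :> R by rewrite -expr2 -exprM mulnC exprM sqrrN !expr1n.
rewrite /hermite_poly D hornerZ; set H := (hermP R k).[t].
transitivity (((-1) ^+ k * (-1) ^+ k) * (expR (t ^+ 2) * expR (- t ^+ 2)) * H); last by rewrite e1 s1 !mul1r.
by ring.
Qed.

Fixpoint powexpP a j : {poly R} :=
  if j is j'.+1 then (((a - j'%:R)%:P - 'X) * powexpP a j' + 'X * (powexpP a j')^`()) else 1.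

Lemma derive1n_powR_expRN a j u : 0 < u ->
  derive1n j (fun v : R => expR (- v) * v `^ a) u = u `^ (a - j%:R) * expR (- u) * (powexpP a j).[u].
Proof.
elim: j u => [|j IH] u u0.
  by rewrite derive1n0 subr0 hornerC mulr1 mulrC.
rewrite derive1nS derive1E.
rewrite (@near_eq_derive _ _ _ _ (fun v => v `^ (a - j%:R) * expR (- v) * (powexpP a j).[v])); last first.
  by near=> v; rewrite IH//; near: v; exact: lt_nbhsr.
have dd := is_deriveM (is_derive_powR_expRN (a - j%:R) u0) (is_derive_horner (powexpP a j) u).
rewrite (@derive_val _ _ _ _ _ _ _ dd) /GRing.scale /=.
have -> : u `^ (a - j%:R) = u `^ (a - j.+1%:R) * u.
  rewrite -{3}(powRr1 (ltW u0)) -powRD; last by rewrite (gt_eqF u0) implybT.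
  by rewrite -natr1; congr (_ `^ _); ring.
have -> : a - j%:R - 1 = a - j.+1%:R by rewrite -natr1; ring.
by rewrite !hornerE; ring.
Unshelve. all: by end_near. Qed.

Lemma powexpP_shift a j : powexpP (a + 1) j = powexpP a j + j%:R * powexpP a j.-1.
Proof.
elim: j => [|j IH]; first by rewrite /= mul0r addr0.
rewrite [LHS]/= IH [powexpP a j.+1]/= [j.+1.-1]/= derivD derivM deriv_natr mul0r add0r.
have jE : j%:R * ((a + 1 - j%:R)%:P - 'X) * powexpP a j.-1 + j%:R * ('X * (powexpP a j.-1)^`()) =
    j%:R * powexpP a j.
  case: j {IH} => [|j]; first by rewrite !mul0r addr0.
  rewrite [powexpP a j.+1]/= [j.+1.-1]/= (_ : a + 1 - j.+1%:R = a - j%:R); first ring.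
  by rewrite -natr1; ring.
have -> : (a + 1 - j%:R)%:P = (a - j%:R)%:P + 1 :> {poly R}.
  by rewrite -polyC1 -polyCD; congr _%:P; ring.
move: jE; have -> : (a + 1 - j%:R)%:P = (a - j%:R)%:P + 1 :> {poly R}.
  by rewrite -polyC1 -polyCD; congr _%:P; ring.
rewrite -natr1; set c := (a - j%:R)%:P; set q := powexpP a j; set q' := powexpP a j.-1.
move=> jE; transitivity ((c - 'X) * q + 'X * q^`() + q +
  (j%:R * (c + 1 - 'X) * q' + j%:R * ('X * q'^`()))); first by ring.
by rewrite jE; ring.
Qed.

Lemma powexpP_lagP b k : powexpP (b + k%:R) k = lagP b k.
Proof.
elim: k => [//|k IH].
rewrite -natr1 addrA powexpP_shift /= IH addrK.
by rewrite polyCD polyC_natr; ring.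
Qed.

Lemma laguerre_polyE k b t : 0 < t -> laguerre_poly k b t = (k`!%:R)^-1 * (lagP b k).[t].
Proof.
move=> t0; rewrite /laguerre_poly (addrC k%:R b) derive1n_powR_expRN// powexpP_lagP addrK.
have tb : (t `^ b)^-1 * t `^ b = 1 by rewrite mulVf// gt_eqF// powR_gt0.
have et : expR t * expR (- t) = 1 by rewrite -expRD subrr expR0.
rewrite powRN; set L := (lagP b k).[t]; set c := (k`!%:R)^-1.
transitivity (c * (((t `^ b)^-1 * t `^ b) * (expR t * expR (- t)) * L)); first by ring.
by rewrite tb et !mul1r.
Qed.

End RealPoly.
End SpecialPolynomials.

Lemma radial_lagP (K : numFieldType) n s k (Y : mpoly n K) :
  Y \is ishomog1 s mdeg -> mlap Y = 0 ->
  radial k Y = (-1) ^+ k *: (radial_fun n (lagP (s%:R + n%:R / 2 - 1) k) * Y).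
Proof.
move=> hs Y0; have hY : eigen s Y by apply/harmonic_eigen.
have eY : euler Y = s%:R * Y by apply/homog_euler.
elim: k => [|k IH]; first by rewrite /= scale1r /radial_fun rmorph1 hornerC mul1r.
rewrite [radial k.+1 Y]/= (raise2_eigen (eigen_radial k hY)) {}IH.
set q := lagP _ k; set b := s%:R + n%:R / 2 - 1 in q *.
rewrite -(mul_mpolyC ((-1) ^+ k)) eulerM euler_const mul0r add0r eulerM euler_radial_fun eY.
have -> : radial_fun n (lagP b k.+1) = r2 K n * radial_fun n q^`() +
    (mpolyC n (b + k.+1%:R) - r2 K n) * radial_fun n q.
  rewrite /radial_fun /= rmorphD !rmorphM rmorphB /= map_polyX map_polyC /=.
  by rewrite !hornerE.
have two : 2^-1 *: (2 : mpoly n K) = 1.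
  by rewrite -(@mpolyC_nat n K 2) -mul_mpolyC -mpolyCM mulVf ?pnatr_eq0// mpolyC1.
have bE : mpolyC n (b + k.+1%:R) = 2^-1 *: ((s + (s + 2 * k) + n)%:R : mpoly n K).
  rewrite -(@mpolyC_nat n K) -mul_mpolyC -mpolyCM; congr mpolyC.
  rewrite /b (natrD _ (s + (s + 2 * k)) n) (natrD _ s (s + 2 * k)) (natrD _ s (2 * k)) natrM -natr1; by field.
rewrite -(mul_mpolyC ((-1) ^+ k.+1)) exprS mpolyCM mpolyCN mpolyC1 bE.
rewrite -!mul_mpolyC in two *.
move: two; set h := mpolyC n 2^-1; set e := mpolyC n _; set F := radial_fun _ _; set F' := radial_fun _ _.
move=> two; rewrite -(addnA s) (natrD _ s).
have -> : r2 K n * F' = h * 2 * (r2 K n * F') by rewrite two mul1r.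
by ring.
Qed.

Section Evaluation.
Context {R : realType} {n : nat}.
Implicit Types x : Rn R n.
Local Notation P := (mpoly n R[i]).

Definition half_gauss x : R := expR (- (enorm x ^+ 2 / 2)).

Lemma half_gauss_sqr x : half_gauss x ^+ 2 = expR (- enorm x ^+ 2).
Proof. by rewrite -expRM_natl; congr expR; field. Qed.

Lemma Cpoly_fun_r2 x : Cpoly_fun (r2 R[i] n) x = (enorm x ^+ 2)%:C.
Proof.
rewrite enorm_sqr /r2 /Cpoly_fun raddf_sum raddf_sum; apply: eq_bigr => i _ /=.
by rewrite !expr2 mevalM mevalXU rmorphM.
Qed.

Lemma Cpoly_fun_radial_fun (q : {poly R}) x :
  Cpoly_fun (radial_fun n (map_poly (real_complex R) q)) x = (q.[enorm x ^+ 2])%:C.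
Proof.
elim/poly_ind: q => [|q c IH].
  by rewrite /radial_fun !rmorph0 !horner0 /Cpoly_fun meval0.
rewrite /radial_fun !rmorphD !rmorphM /= !map_polyX !map_polyC /= !hornerD !hornerM !hornerX !hornerC.
rewrite /Cpoly_fun mevalD mevalM mevalC -/(radial_fun n _) -/(Cpoly_fun _ x) -/(Cpoly_fun _ x).
by rewrite IH Cpoly_fun_r2 -rmorphM -rmorphD expr2 mulrA.
Qed.

Lemma Cpoly_fun_herm1 i k x : Cpoly_fun (herm1 R[i] i k) x = ((hermP R k).[tnth x i])%:C.
Proof.
suff: Cpoly_fun (herm1 R[i] i k) x = ((hermP R k).[tnth x i])%:C /\
  Cpoly_fun (herm1 R[i] i k.+1) x = ((hermP R k.+1).[tnth x i])%:C by case.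
elim: k => [|k [IH IH1]].
  rewrite /= /Cpoly_fun meval1 hornerC; split => //.
  rewrite raiseE -[mderiv _ 1]/(mderiv i (1%:R : P)) mderiv_nat subr0 mulr1.
  rewrite -[deriv 1]/(deriv (1%:R : {poly R})) deriv_natr subr0 mulr1 -polyC_natr hornerM hornerC hornerX.
  by rewrite mevalM -mpolyC_nat mevalC mevalXU rmorphM rmorph_nat.
split=> //; rewrite herm1_rec hermP_rec /Cpoly_fun mevalB !mevalM -!mpolyC_nat !mevalC mevalXU.
rewrite -/(Cpoly_fun (herm1 R[i] i k) x) -/(Cpoly_fun (herm1 R[i] i k.+1) x) IH IH1 -(polyC_natr R 2) -(polyC_natr R (2 * k.+1)) ; move: (hermP R k) (hermP R k.+1) => A B; rewrite hornerD hornerN !hornerM !hornerC hornerX.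
by rewrite rmorphB !rmorphM /= !rmorph_nat.
Qed.

Lemma Cpoly_fun_herm (m : multinom n) x :
  Cpoly_fun (herm R[i] m) x = (\prod_(i < n) (hermP R (m i)).[tnth x i])%:C.
Proof.
rewrite /herm /Cpoly_fun rmorph_prod rmorph_prod; apply: eq_bigr => i _.
exact: Cpoly_fun_herm1.
Qed.

Definition hermite_cst (a : n.-tuple nat) : R :=
  \prod_(i < n) (Num.sqrt (2 ^+ tnth a i * (tnth a i)`!%:R * Num.sqrt pi))^-1.

Lemma hermite_funE (a : n.-tuple nat) x : hermite_fun a x =
  (hermite_cst a)%:C * (Cpoly_fun (herm R[i] (Multinom a)) x * (half_gauss x)%:C).
Proof.
rewrite /hermite_fun Cpoly_fun_herm -!rmorphM; congr _%:C.
have -> : half_gauss x = \prod_(i < n) expR (- (tnth x i ^+ 2 / 2)).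
  by rewrite /half_gauss enorm_sqr mulr_suml -sumrN expR_sum.
rewrite -!big_split; apply: eq_bigr => i _ /=.
by rewrite /hermite_fun1 hermite_polyE mulrA.
Qed.

Lemma norm_hermite_cst (a : n.-tuple nat) : hermite_cst a ^+ 2 *
  ((\prod_(i < n) (2 ^ tnth a i * (tnth a i)`!)%N)%:R * Num.sqrt pi ^+ n) = 1.
Proof.
have -> : Num.sqrt pi ^+ n = \prod_(i < n) Num.sqrt pi :> R by rewrite prodr_const card_ord.
rewrite natr_prod -prodrXl -!big_split big1// => i _ /=.
rewrite natrM natrX exprVn sqr_sqrtr ?mulVf//.
  by rewrite !mulf_neq0 ?expf_neq0// ?pnatr_eq0 -?lt0n ?fact_gt0// sqrtr_eq0 -ltNge pi_gt0.
Qed.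

Section Phi.
Hypothesis n_gt0 : (0 < n)%N.
Variables (d : nat -> nat) (Y : forall s, 'I_(d s) -> P).
Hypothesis Y_basis : forall s : nat, orthonormal_harmonic_basis s (@Y s).

Let b s : R := n%:R / 2 - 1 + s%:R.

Definition phi_cst s k : R := Num.sqrt (2 * Gamma (k%:R + 1) / Gamma (k%:R + b s + 1)) / k`!%:R * (-1) ^+ k.

Lemma basis_homog s j : @Y s j \is ishomog1 s mdeg.
Proof. by have [h _ _ _] := Y_basis s; have [] := h j. Qed.

Lemma basis_harmonic s j : mlap (@Y s j) = 0.
Proof. by have [h _ _ _] := Y_basis s; have [] := h j. Qed.

Lemma phiE k s j x : 0 < enorm x -> phi Y (k, existT _ s j) x =
  (phi_cst s k)%:C * (Cpoly_fun (radial k (@Y s j)) x * (half_gauss x)%:C).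
Proof.
move=> x0; rewrite /phi /laguerre_fun laguerre_polyE ?exprn_gt0//.
rewrite (radial_lagP _ (basis_homog j) (basis_harmonic j)) -mul_mpolyC.
have -> : lagP (s%:R + n%:R / 2 - 1 : R[i]) k = map_poly (real_complex R) (lagP (b s) k).
  rewrite map_lagP /b; congr lagP.
  by rewrite !(rmorphD, rmorphN, rmorphM, fmorphV) /= !rmorph_nat; ring.
rewrite !Cpoly_funM Cpoly_fun_radial_fun [Cpoly_fun (mpolyC n _) x]mevalC.
rewrite -[(-1) ^+ k](rmorph_sign (real_complex R)) /phi_cst /half_gauss -/(b s).
have signE : (-1) ^+ k * (-1) ^+ k = 1 :> R by rewrite -expr2 -exprM mulnC exprM sqrrN !expr1n.
set S := Num.sqrt _; set L := (lagP _ _).[_]; set E := expR _; set y := Cpoly_fun _ x.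
transitivity ((S / k`!%:R * ((-1) ^+ k * (-1) ^+ k) * L * E)%:C * y).
  by congr (_%:C * _); rewrite signE; ring.
by rewrite !rmorphM /=; ring.
Qed.

End Phi.
End Evaluation.

(** * The two orthonormal systems *)

Section GaussFun.
Context {R : realType} {n : nat}.
Local Notation P := (mpoly n R[i]).
Local Notation leb := (lebesgue_Rn R n).
Local Notation Re := (@complex.Re R).
Local Notation Im := (@complex.Im R).
Implicit Types (p q : P) (x : Rn R n).

Lemma Cpoly_conjB p q : Cpoly_conj (p - q) = Cpoly_conj p - Cpoly_conj q.
Proof. exact: (rmorphB (map_mpoly (@conjc R))). Qed.

Lemma Cpoly_conjM p q : Cpoly_conj (p * q) = Cpoly_conj p * Cpoly_conj q.
Proof. exact: (rmorphM (map_mpoly (@conjc R))). Qed.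

Lemma Cpoly_conj_nat k : Cpoly_conj (k%:R : P) = k%:R.
Proof. exact: (rmorph_nat (map_mpoly (@conjc R))). Qed.

Lemma Cpoly_conj_sum (I : Type) (s : seq I) (Q : pred I) (F : I -> P) :
  Cpoly_conj (\sum_(i <- s | Q i) F i) = \sum_(i <- s | Q i) Cpoly_conj (F i).
Proof. exact: (rmorph_sum (map_mpoly (@conjc R))). Qed.

Lemma Cpoly_conj_prod (I : Type) (s : seq I) (Q : pred I) (F : I -> P) :
  Cpoly_conj (\prod_(i <- s | Q i) F i) = \prod_(i <- s | Q i) Cpoly_conj (F i).
Proof. exact: (rmorph_prod (map_mpoly (@conjc R))). Qed.

Lemma Cpoly_conjZ c p : Cpoly_conj (c *: p) = conjc c *: Cpoly_conj p.
Proof.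
apply/mpolyP => m; rewrite mcoeff_map_mpoly !mcoeffZ mcoeff_map_mpoly.
exact: conjcM.
Qed.

Lemma Cpoly_conjX (m : multinom n) : Cpoly_conj (mpolyX R[i] m) = mpolyX R[i] m.
Proof.  apply/mpolyP => m'; rewrite mcoeff_map_mpoly !mcoeffX; exact: (rmorph_nat (@conjc R)). Qed.

Lemma Cpoly_conj_raise i p : Cpoly_conj (raise i p) = raise i (Cpoly_conj p).
Proof.
by rewrite !raiseE Cpoly_conjB !Cpoly_conjM Cpoly_conj_nat Cpoly_conjX Cpoly_conj_mderiv.
Qed.

Lemma Cpoly_conj_herm (m : multinom n) : Cpoly_conj (herm R[i] m) = herm R[i] m.
Proof.
rewrite /herm Cpoly_conj_prod; apply: eq_bigr => i _; rewrite /herm1.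
by elim: (m i) => [|k IH] /=; [exact: (Cpoly_conj_nat 1)|rewrite Cpoly_conj_raise IH].
Qed.

Lemma Cpoly_conj_radial k p : Cpoly_conj (radial k p) = radial k (Cpoly_conj p).
Proof.
elim: k => //= k <-; rewrite /raise2 Cpoly_conjZ Cpoly_conj_sum.
rewrite (_ : conjc 4^-1 = 4^-1); last by rewrite fmorphV rmorph_nat.
by congr (_ *: _); apply: eq_bigr => i _; rewrite !Cpoly_conj_raise.
Qed.

Lemma Cpoly_conj_mlap p : mlap (Cpoly_conj p) = Cpoly_conj (mlap p).
Proof.
by rewrite /mlap Cpoly_conj_sum; apply: eq_bigr => i _; rewrite !Cpoly_conj_mderiv.
Qed.

Lemma eigen_Cpoly_conj N p : eigen N p -> eigen N (Cpoly_conj p).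
Proof.
rewrite /eigen => h; rewrite -(Cpoly_conj_nat (2 * N)) -Cpoly_conjM -h !hermite_opE Cpoly_conj_sum.
by apply: eq_bigr => i _; rewrite Cpoly_conj_raise Cpoly_conj_mderiv.
Qed.

Lemma Cpoly_conj_homog s p : p \is ishomog1 s mdeg -> Cpoly_conj p \is ishomog1 s mdeg.
Proof.
move=> /dhomogP h; apply/dhomogP => m; rewrite mcoeff_msupp mcoeff_map_mpoly => pm.
apply: h; rewrite mcoeff_msupp; apply: contraNneq pm => ->.
exact/eqP/(rmorph0 (@conjc R)).
Qed.

Definition gauss_poly p x : R[i] := Cpoly_fun p x * (half_gauss x)%:C.

Lemma gauss_polyD p q x : gauss_poly (p + q) x = gauss_poly p x + gauss_poly q x.
Proof. by rewrite /gauss_poly /Cpoly_fun mevalD mulrDl. Qed.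

Lemma gauss_polyZ c p x : gauss_poly (c *: p) x = c * gauss_poly p x.
Proof. by rewrite /gauss_poly /Cpoly_fun mevalZ mulrA. Qed.

Lemma gauss_poly0 x : gauss_poly 0 x = 0.
Proof. by rewrite /gauss_poly /Cpoly_fun meval0 mul0r. Qed.

Lemma gauss_poly_sum (I : Type) (s : seq I) (F : I -> P) x :
  gauss_poly (\sum_(i <- s) F i) x = \sum_(i <- s) gauss_poly (F i) x.
Proof.
apply: (big_morph (fun p => gauss_poly p x)); last exact: gauss_poly0.
by move=> p q; exact: gauss_polyD.
Qed.

Lemma inner_gauss_poly p q :
  inner leb (gauss_poly p) (gauss_poly q) = gaussC (p * Cpoly_conj q).
Proof. by apply: gaussC_inner; exact: half_gauss_sqr. Qed.

Lemma inner_gauss_poly_eigen N M p q : eigen N p -> eigen M q -> N <> M ->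
  inner leb (gauss_poly p) (gauss_poly q) = 0.
Proof.
move=> hp hq NM; rewrite inner_gauss_poly.
apply: (gauss_eigen_orth gaussCD gaussCZ gaussC_adj hp _ NM).
exact: eigen_Cpoly_conj.
Qed.

Lemma measurable_half_gauss : measurable_fun setT (half_gauss : Rn R n -> R).
Proof.
apply: measurableT_comp => //; apply: measurableT_comp => //.
apply: measurable_funM; last exact: measurable_cst.
apply: measurable_funX; exact: measurable_enorm.
Qed.

Lemma measurable_gauss_poly p :
  measurable_fun setT (Re \o gauss_poly p) /\ measurable_fun setT (Im \o gauss_poly p).
Proof.
have [mr mi] := measurable_Cpoly_fun p; split.
  rewrite (_ : _ \o _ = (fun x => (Re \o Cpoly_fun p) x * half_gauss x)).
    by apply: measurable_funM => //; exact: measurable_half_gauss.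
  by apply/funext => x; rewrite /gauss_poly /=; case: (Cpoly_fun p x) => a b /=; ring.
rewrite (_ : _ \o _ = (fun x => (Im \o Cpoly_fun p) x * half_gauss x)).
  by apply: measurable_funM => //; exact: measurable_half_gauss.
by apply/funext => x; rewrite /gauss_poly /=; case: (Cpoly_fun p x) => a b /=; ring.
Qed.

Lemma L2_gauss_poly p : L2 leb (gauss_poly p).
Proof.
have [mr mi] := measurable_gauss_poly p; apply/L2P; split=> //.
have [ir _] := Cintegrable_gauss_Cpoly (p * Cpoly_conj p).
apply: eq_integrable ir => // x _ /=; congr EFin.
rewrite /gauss_Cpoly Cpoly_funM Cpoly_fun_conj -half_gauss_sqr /gauss_poly abs2M.
rewrite (_ : Cpoly_fun p x * _ = (abs2 (Cpoly_fun p x))%:C); last exact: mulc_conj.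
by rewrite -rmorphM /= /abs2 /= expr0n addr0.
Qed.

End GaussFun.

Lemma L2_ae (R : realType) (d : measure_display) (T : measurableType d)
    (mu : {measure set T -> \bar R}) (f g : T -> R[i]) :
  measurable_fun setT (@complex.Re R \o f) -> measurable_fun setT (@complex.Im R \o f) ->
  L2 mu g -> {ae mu, forall x, f x = g x} -> L2 mu f.
Proof.
move=> mr mi /L2P[mr' mi' ig] fg; apply/L2P; split=> //.
apply/integrableP; split; first by apply/measurable_EFinP; exact: measurable_abs2.
have /integrableP[_] := ig; congr (_ < _)%E; apply: ae_eq_integral => //.
- by apply: measurableT_comp => //; apply/measurable_EFinP; exact: measurable_abs2.
- by apply: measurableT_comp => //; apply/measurable_EFinP; exact: measurable_abs2.
by apply: filterS fg => x /= -> _.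
Qed.

Lemma innerZZ (R : realType) (d : measure_display) (T : measurableType d)
    (mu : {measure set T -> \bar R}) (a b : R) (f g : T -> R[i]) : L2 mu f -> L2 mu g ->
  inner mu (fun x => a%:C * f x) (fun x => b%:C * g x) = (a * b)%:C * inner mu f g.
Proof.
move=> lf lg; rewrite innerZl//; last exact: L2Z.
rewrite (innerC (L2Z b%:C lg) lf) innerZl// conjcM -innerC//.
by rewrite conjc_real mulrA rmorphM.
Qed.

Section Orthonormal.
Context {R : realType} {n : nat}.
Local Notation P := (mpoly n R[i]).
Local Notation leb := (lebesgue_Rn R n).

Lemma hermite_fun_gauss (a : n.-tuple nat) : @hermite_fun R n a =
  fun x => (hermite_cst a)%:C * gauss_poly (herm R[i] (Multinom a)) x.
Proof. by apply/funext => x; exact: hermite_funE. Qed.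

Lemma orthonormal_hermite : L2_orthonormal leb (@hermite_fun R n).
Proof.
split=> [a|a b]; first by rewrite hermite_fun_gauss; apply: L2Z; exact: L2_gauss_poly.
rewrite !hermite_fun_gauss innerZZ; [|exact: L2_gauss_poly|exact: L2_gauss_poly].
rewrite inner_gauss_poly Cpoly_conj_herm (gauss_herm gaussCD gaussCZ gaussC_adj) gaussC1.
have [->|ab] := eqVneq a b.
  rewrite eqxx mul1r -[X in _ * (X * _)](rmorph_nat (real_complex R)) -!rmorphM /=.
  by rewrite -expr2 norm_hermite_cst.
by rewrite (_ : _ == _ = false) ?mul0r ?mulr0//; apply: contraNF ab => /eqP[->].
Qed.

Section Phi.
Hypothesis n_gt0 : (0 < n)%N.
Variables (d : nat -> nat) (Y : forall s, 'I_(d s) -> P).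
Hypothesis Y_basis : forall s : nat, orthonormal_harmonic_basis s (@Y s).

Local Notation cst := (@phi_cst R n).

Definition phi_gauss (i : phi_index d) x : R[i] :=
  let: (k, existT s j) := i in (cst s k)%:C * gauss_poly (radial k (Y j)) x.

Lemma phi_gauss_ae i : {ae leb, forall x, phi Y i x = phi_gauss i x}.
Proof.
case: i => k [s j]; exists [set x | enorm x = 0]; split.
- rewrite (_ : [set _ | _] = enorm @^-1` [set 0])//.
  rewrite -[X in measurable X]setTI; exact: (@measurable_enorm R n).
- exact: lebesgue_Rn_norm0.
move=> x /=; apply: contra_notP => x0; apply: phiE => //.
by rewrite lt_neqAle enorm_ge0 andbT eq_sym; exact/eqP.
Qed.

Lemma L2_phi_gauss i : L2 leb (phi_gauss i).
Proof. by case: i => k [s j]; apply: L2Z; exact: L2_gauss_poly. Qed.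

Lemma L2_phi i : L2 leb (phi Y i).
Proof.
suff [mr mi] : measurable_fun setT (@complex.Re R \o phi Y i) /\
    measurable_fun setT (@complex.Im R \o phi Y i).
  by apply: L2_ae (L2_phi_gauss i) (phi_gauss_ae i).
case: i => k [s j].
have [mr mi] := measurable_gauss_poly (radial k (Y j)).
have [mr' mi'] := measurable_Cpoly_fun (Y j).
pose v : R := laguerre_fun k (n%:R / 2 - 1 + s%:R) 0.
have phi_if x : phi Y (k, existT _ s j) x = if 0 < enorm x
    then (cst s k)%:C * gauss_poly (radial k (Y j)) x else v%:C * Cpoly_fun (Y j) x.
  case: ifPn => [|x0]; first exact: phiE.
  rewrite /phi (_ : enorm x = 0)//; apply/eqP; rewrite eq_le enorm_ge0 andbT.
  by rewrite leNgt.
have mpos : measurable_fun setT (fun x : Rn R n => 0 < enorm x).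
  by apply: measurable_fun_ltr => //; exact: measurable_enorm.
have ReZ (a : R) z : complex.Re (a%:C * z) = a * complex.Re z by case: z => z1 z2 /=; ring.
have ImZ (a : R) z : complex.Im (a%:C * z) = a * complex.Im z by case: z => z1 z2 /=; ring.
split.
- rewrite (_ : _ \o _ = fun x => if 0 < enorm x then
    cst s k * (@complex.Re R \o gauss_poly (radial k (Y j))) x else
    v * (@complex.Re R \o Cpoly_fun (Y j)) x).
    by apply: measurable_fun_ifT => //; exact: measurable_funM.
  by apply/funext => x; rewrite /comp phi_if; case: ifP => _; rewrite ReZ.
- rewrite (_ : _ \o _ = fun x => if 0 < enorm x then
    cst s k * (@complex.Im R \o gauss_poly (radial k (Y j))) x else
    v * (@complex.Im R \o Cpoly_fun (Y j)) x).
    by apply: measurable_fun_ifT => //; exact: measurable_funM.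
  by apply/funext => x; rewrite /comp phi_if; case: ifP => _; rewrite ImZ.
Qed.

Lemma inner_phi i f : L2 leb f -> inner leb f (phi Y i) = inner leb f (phi_gauss i).
Proof.
by move=> lf; apply: inner_aer => //; [exact: L2_phi|exact: L2_phi_gauss|exact: phi_gauss_ae].
Qed.

Let z s : R := s%:R + n%:R / 2.

Let z_gt0 s : 0 < z s.
Proof. by rewrite ltr_wpDl// divr_gt0// ltr0n. Qed.

Lemma Gamma_add_nat (x : R) k : 0 < x -> Gamma (k%:R + x) = \prod_(i < k) (i%:R + x) * Gamma x.
Proof.
move=> x0; elim: k => [|k IH]; first by rewrite big_ord0 mul1r add0r.
rewrite big_ord_recr /= -natr1 addrAC GammaS; last by rewrite ltr_wpDl.
by rewrite IH mulrA; congr (_ * _); exact: mulrC.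
Qed.

Let Gamma_phi s k : Gamma (k%:R + (n%:R / 2 - 1 + s%:R) + 1) =
  \prod_(i < k) (i%:R + z s) * Gamma (z s).
Proof.
rewrite (_ : k%:R + _ + 1 = k%:R + z s); last by rewrite /z; ring.
exact/Gamma_add_nat/z_gt0.
Qed.

Let prod_gt0 s k : 0 < \prod_(i < k) (i%:R + z s).
Proof. by apply: prodr_gt0 => i _; rewrite ltr_wpDl. Qed.

Let fact_neq0 k : (k`!%:R : R) != 0.
Proof. by rewrite pnatr_eq0 -lt0n fact_gt0. Qed.

Lemma phi_cst_sqr s k : cst s k ^+ 2 * (\prod_(i < k) ((radial_coef n s i)%:R / 2) *
  (Gamma (z s) / 2)) = 1.
Proof.
have -> : \prod_(i < k) ((radial_coef n s i)%:R / 2) = k`!%:R * \prod_(i < k) (i%:R + z s) :> R.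
  elim: k => [|k IH]; first by rewrite !big_ord0 mulr1.
  rewrite !big_ord_recr /= IH factS /radial_coef /z (natrM _ k.+1 k`!) (natrM _ k.+1) (natrD _ (2 * (k + s)) n) (natrM _ 2) (natrD _ k s).
  by field.
have := prod_gt0 s k; have := Gamma_gt0 (z_gt0 s); have := fact_neq0 k.
rewrite /phi_cst !exprMn -exprM (mulnC k) exprM sqrrN !expr1n mulr1 sqr_sqrtr; last first.
  by rewrite Gamma_phi natr1 Gamma_nat divr_ge0 ?mulr_ge0// ltW// ?mulr_gt0// Gamma_gt0.
rewrite Gamma_phi natr1 Gamma_nat.
move: (k`!%:R : R) (\prod_(i < k) _) (Gamma _) => f p g f0 /lt0r_neq0 g0 /lt0r_neq0 p0.
by field; rewrite f0 g0 p0.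
Qed.

Lemma phi_cst_neq0 s k : cst s k != 0.
Proof.
by apply/negP => /eqP c0; have := phi_cst_sqr s k; rewrite c0 expr0n mul0r => /eqP; rewrite eq_sym oner_eq0.
Qed.

Lemma orthonormal_phi : L2_orthonormal leb (phi Y).
Proof.
split=> [i|i i']; first exact: L2_phi.
rewrite (inner_phi _ (L2_phi i)) (@inner_ael _ _ _ leb _ _ (phi_gauss i)); last first.
- exact: phi_gauss_ae.
- exact: L2_phi_gauss.
- exact: L2_phi.
- exact: L2_phi_gauss.
case: i i' => k [s j] [k' [s' j']].
rewrite /phi_gauss innerZZ; [|exact: L2_gauss_poly|exact: L2_gauss_poly].
have hs t (l : 'I_(d t)) : eigen t (Y l) by apply/harmonic_eigen; [exact: basis_harmonic|exact: basis_homog].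
have cY0 t (l : 'I_(d t)) : mlap (Cpoly_conj (Y l)) = 0.
  by rewrite Cpoly_conj_mlap (basis_harmonic Y_basis) (Cpoly_conj_nat 0).
rewrite inner_gauss_poly Cpoly_conj_radial.
have [kk|kk] := eqVneq k k'; last first.
  rewrite (gauss_radial_neq gaussCD gaussCZ gaussC_adj (hs _ j) (basis_harmonic Y_basis j)
    (eigen_Cpoly_conj (hs _ j')) (cY0 _ j')) ?mulr0; last exact/eqP.
  by rewrite (_ : _ == _ = false)//; apply: contraNF kk => /eqP[->].
subst k'; rewrite (gauss_radial_eq gaussCD gaussCZ gaussC_adj _ _ (eigen_Cpoly_conj (hs _ j')) (cY0 _ j')).
have [ss|ss] := eqVneq s s'; last first.
  rewrite (gauss_eigen_orth gaussCD gaussCZ gaussC_adj (hs _ j) (eigen_Cpoly_conj (hs _ j'))) ?mulr0; last exact/eqP.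
  by rewrite (_ : _ == _ = false)//; apply: contraNF ss => /eqP h; apply/eqP; exact: (congr1 (fun i : phi_index d => tag i.2) h).
subst s'; rewrite (@gaussC_polar _ _ n_gt0 s); last first.
  by rewrite mul2n -addnn; apply: dhomogM; [exact: basis_homog|apply: Cpoly_conj_homog; exact: basis_homog].
have -> : Cintegral surface_measure (Cpoly_fun (Y j * Cpoly_conj (Y j'))) = (j == j')%:R.
  have [_ _ _ <-] := Y_basis s; congr (Cintegral _ _); apply/funext => x.
  by rewrite Cpoly_funM Cpoly_fun_conj.
have -> : \prod_(i < k) ((radial_coef n s i)%:R / 2) =
    (\prod_(i < k) ((radial_coef n s i)%:R / 2) : R)%:C.
  by rewrite rmorph_prod; apply: eq_bigr => i _; rewrite rmorphM fmorphV !rmorph_nat.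
have := phi_cst_sqr s k; rewrite /z; move: (cst s k) (\prod_(i < k) _ : R) (Gamma _ / 2) => c p g cE.
rewrite !mulrA -!rmorphM -expr2 -(mulrA (c ^+ 2)) cE mul1r.
have [->|jj] := eqVneq j j'; first by rewrite eqxx.
rewrite (_ : _ == _ = false)//; apply: contraNF jj => /eqP/(congr1 snd) /= /eqP.
by rewrite -[existT _ s j']/(Tagged (fun s => 'I_(d s)) j') eq_Tagged.
Qed.

End Phi.
End Orthonormal.

Section FiniteSpan.
Context {R : realType} {d : measure_display} {T : measurableType d}.
Variable mu : {measure set T -> \bar R}.
Variables (I : choiceType) (e : I -> T -> R[i]).
Implicit Types f g : T -> R[i].

Definition ae_span f := exists (K : {fset I}) (c : I -> R[i]),
  {ae mu, forall x, f x = \sum_(j <- K) c j * e j x}.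

Lemma ae_span_ae f g : {ae mu, forall x, f x = g x} -> ae_span g -> ae_span f.
Proof.
move=> fg [K [c h]]; exists K, c; apply: filterS2 fg h => x -> ->; by [].
Qed.

Lemma ae_span_basis i : ae_span (e i).
Proof.
exists [fset i]%fset, (fun=> 1); apply: aeW => x.
by rewrite big_seq_fset1 mul1r.
Qed.

Lemma ae_span0 : ae_span (fun=> 0).
Proof. by exists fset0, (fun=> 0); apply: aeW => x; rewrite big_seq_fset0. Qed.

Lemma ae_spanZ a f : ae_span f -> ae_span (fun x => a * f x).
Proof.
move=> [K [c h]]; exists K, (fun j => a * c j); apply: filterS h => x ->.
by rewrite mulr_sumr; apply: eq_bigr => j _; rewrite mulrA.
Qed.

Lemma ae_spanD f g : ae_span f -> ae_span g -> ae_span (fun x => f x + g x).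
Proof.
move=> [K [c h]] [L [b k]].
exists (K `|` L)%fset, (fun j => c j *+ (j \in K) + b j *+ (j \in L)).
have ext (A : {fset I}) (a : I -> R[i]) x : (A `<=` K `|` L)%fset ->
    \sum_(j <- A) a j * e j x = \sum_(j <- (K `|` L)%fset) a j *+ (j \in A) * e j x.
  move=> AKL; rewrite (big_fset_split _ AKL) [X in _ + X]big_seq [X in _ + X]big1 ?addr0.
    by rewrite big_seq [RHS]big_seq; apply: eq_bigr => j ->.
  by move=> j; rewrite inE => /andP[/negPf-> _]; rewrite mul0r.
apply: filterS2 h k => x -> ->.
rewrite (ext K)//; last exact: fsubsetUl.
rewrite (ext L)//; last exact: fsubsetUr.
by rewrite -big_split; apply: eq_bigr => j _; rewrite mulrDl.
Qed.

Lemma ae_span_sum (A : Type) (s : seq A) (F : A -> T -> R[i]) :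
  (forall a, ae_span (F a)) -> ae_span (fun x => \sum_(a <- s) F a x).
Proof.
move=> h; elim: s => [|a s IH]; first by under eq_fun do rewrite big_nil; exact: ae_span0.
by under eq_fun do rewrite big_cons; exact: ae_spanD.
Qed.

End FiniteSpan.

Section Spans.
Context {R : realType} {n : nat}.
Local Notation P := (mpoly n R[i]).
Local Notation leb := (lebesgue_Rn R n).

Lemma hermite_cst_neq0 (a : n.-tuple nat) : hermite_cst a != 0 :> R.
Proof.
apply/negP => /eqP c0; have := norm_hermite_cst (R := R) a.
by rewrite c0 expr0n mul0r => /eqP; rewrite eq_sym oner_eq0.
Qed.

Lemma ae_span_hermite N (p : P) : eigen N p ->
  ae_span leb (@hermite_fun R n) (gauss_poly p).
Proof.
move=> /eigen_herm_span[s ->].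
rewrite (_ : gauss_poly _ = fun x => \sum_(cm <- s) cm.1 * gauss_poly (herm R[i] cm.2) x); last first.
  by apply/funext => x; rewrite gauss_poly_sum; apply: eq_bigr => cm _; rewrite gauss_polyZ.
apply: ae_span_sum => -[c [a]]; apply: ae_spanZ => /=.
apply: (ae_span_ae (g := fun x => ((hermite_cst a)^-1)%:C * hermite_fun a x)).
  apply: aeW => x; rewrite hermite_funE mulrA -rmorphM mulVf ?mul1r//.
  exact: hermite_cst_neq0.
by apply: ae_spanZ; exact: ae_span_basis.
Qed.

Section Phi.
Hypothesis n_gt0 : (0 < n)%N.
Variables (d : nat -> nat) (Y : forall s, 'I_(d s) -> P).
Hypothesis Y_basis : forall s : nat, orthonormal_harmonic_basis s (@Y s).

Lemma ae_span_phi N (p : P) : eigen N p -> ae_span leb (phi Y) (gauss_poly p).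
Proof.
move=> /(radial_span n_gt0)[Ys [hYs ->]].
rewrite (_ : gauss_poly _ = fun x => \sum_(k < (N./2).+1) gauss_poly (radial k (Ys k)) x); last first.
  by apply/funext => x; rewrite gauss_poly_sum.
apply: ae_span_sum => k; have [] := hYs k; first by rewrite -ltnS.
move=> hk Yk0; have [_ _ basis _] := Y_basis (N - 2 * k).
have [|c ->] := basis (Ys k); first by split=> //; apply/harmonic_eigen.
rewrite (_ : gauss_poly _ = fun x => \sum_j c j * gauss_poly (radial k (@Y (N - 2 * k) j)) x); last first.
  apply/funext => x; rewrite (big_morph (radial k) (radialD k) (_ : radial k 0 = 0)); last first.
    by rewrite -(scale0r (0 : P)) radialZ !scale0r.
  by rewrite gauss_poly_sum; apply: eq_bigr => j _; rewrite radialZ gauss_polyZ.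
apply: ae_span_sum => j; apply: ae_spanZ.
pose i : phi_index d := (k : nat, existT _ (N - 2 * k)%N j).
pose a : R[i] := ((@phi_cst R n (N - 2 * k) k)^-1)%:C.
apply: (ae_span_ae (g := fun x => a * phi Y i x)); last first.
  by apply: ae_spanZ; exact: ae_span_basis.
apply: filterS (phi_gauss_ae n_gt0 Y_basis i) => x ->.
by rewrite /phi_gauss /= mulrA -rmorphM mulVf ?mul1r// phi_cst_neq0.
Qed.

Definition hermite_deg (a : n.-tuple nat) : nat := (\sum_(i < n) tnth a i)%N.

Definition phi_deg (i : phi_index d) : nat := (projT1 i.2 + 2 * i.1)%N.

Lemma eigen_radial_Y i : eigen (phi_deg i) (radial i.1 (Y (projT2 i.2))).
Proof.
apply: eigen_radial; apply/harmonic_eigen; [exact: basis_harmonic|exact: basis_homog].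
Qed.

Lemma phi_gaussE i x : phi_gauss Y i x =
  (@phi_cst R n (projT1 i.2) i.1)%:C * gauss_poly (radial i.1 (Y (projT2 i.2))) x.
Proof. by case: i => k [s j]. Qed.

Lemma eigen_herm_tuple (a : n.-tuple nat) :
  eigen (hermite_deg a) (herm R[i] (Multinom a)).
Proof. by have := eigen_herm R[i] (Multinom a); rewrite mdegE. Qed.

Lemma hermite_in_span_phi a : ae_span leb (phi Y) (hermite_fun a).
Proof.
by rewrite hermite_fun_gauss; apply: ae_spanZ; apply: ae_span_phi (eigen_herm_tuple a).
Qed.

Lemma phi_in_span_hermite i : ae_span leb (@hermite_fun R n) (phi Y i).
Proof.
apply: (ae_span_ae (phi_gauss_ae n_gt0 Y_basis i)).
rewrite (_ : phi_gauss Y i = fun x => (@phi_cst R n (projT1 i.2) i.1)%:C * gauss_poly (radial i.1 (Y (projT2 i.2))) x); last by apply/funext => x; exact: phi_gaussE.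
by apply: ae_spanZ; apply: ae_span_hermite (eigen_radial_Y i).
Qed.

Lemma inner_hermite_phi a i : hermite_deg a <> phi_deg i ->
  inner leb (hermite_fun a) (phi Y i) = 0.
Proof.
move=> ai; rewrite inner_phi//; last exact: (orthonormal_hermite.1 a).
rewrite hermite_fun_gauss (_ : phi_gauss Y i = fun x => (@phi_cst R n (projT1 i.2) i.1)%:C * gauss_poly (radial i.1 (Y (projT2 i.2))) x); last by apply/funext => x; exact: phi_gaussE.
rewrite innerZZ; [|exact: L2_gauss_poly|exact: L2_gauss_poly].
by rewrite (inner_gauss_poly_eigen (eigen_herm_tuple a) (eigen_radial_Y i) ai) mulr0.
Qed.

End Phi.

Lemma hermite_deg_fset : exists J : nat -> {fset n.-tuple nat},
  forall M a, (a \in J M) = (hermite_deg a < M)%N.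
Proof.
exists (fun M => [fset a in [seq a <- [seq map_tuple val t | t : n.-tuple 'I_M] |
  (hermite_deg a < M)%N]]%fset) => M a.
rewrite !inE /= mem_filter; case: ltnP => //= aM.
have ltM i : (tnth a i < M)%N by apply: leq_ltn_trans aM; rewrite /hermite_deg (bigD1 i)//= leq_addr.
apply/fintype.imageP; exists [tuple Ordinal (ltM i) | i < n] => //.
by apply: eq_from_tnth => i; rewrite tnth_map tnth_mktuple.
Qed.

Lemma phi_deg_fset (d : nat -> nat) : exists J : nat -> {fset phi_index d},
  forall M i, (i \in J M) = (phi_deg i < M)%N.
Proof.
pose r M : seq {s : nat & 'I_(d s)} := [seq Tagged (fun s => 'I_(d s)) j | s <- iota 0 M, j <- enum 'I_(d s)].
exists (fun M => [fset i in [seq i <- [seq (k, t) | k <- iota 0 M, t <- r M] |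
  (phi_deg (i : phi_index d) < M)%N]]%fset) => M i.
rewrite !inE /= mem_filter; case: ltnP => //= iM.
case: i iM => k [s j]; rewrite /phi_deg /= => iM; apply/allpairsP; exists (k, existT _ s j).
split => //=; first by rewrite mem_iota; lia.
by apply/allpairsPdep; exists s, j; rewrite mem_iota mem_enum; split=> //; lia.
Qed.

End Spans.

Theorem mainTheorem1 (R : realType) (n : nat) (n_ge1 : (1 <= n)%N)
    (d : nat -> nat) (Y : forall s : nat, 'I_(d s) -> mpoly.mpoly n R[i])
    (Y_basis : forall s : nat, orthonormal_harmonic_basis s (Y s)) :
  Htilde_dom Y = H_dom /\
  forall f : Rn R n -> R[i], H_dom f ->
    (exists g : Rn R n -> R[i], H_graph f g) /\
    (forall g : Rn R n -> R[i], Htilde_graph Y f g <-> H_graph f g).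
Proof.
have [J memJ] := @hermite_deg_fset n; have [J' memJ'] := phi_deg_fset d.
have oe := @orthonormal_hermite R n; have oe' := orthonormal_phi n_ge1 Y_basis.
have lamE (a : n.-tuple nat) (i : phi_index d) : hermite_deg a = phi_deg i ->
    hermite_eigenvalue a = @phi_eigenvalue R n d i.
  case: i => k [s j]; rewrite /hermite_eigenvalue -/(hermite_deg a) => ->.
  by rewrite /phi_deg /= (natrD _ s) (natrM _ 2).
have cross := inner_hermite_phi n_ge1 Y_basis.
have span := hermite_in_span_phi n_ge1 Y_basis.
have span' := phi_in_span_hermite n_ge1 Y_basis.
split.
  apply/seteqP; split=> f; apply (spectral_dom_transfer memJ memJ' lamE oe oe' cross span span').
move=> f Hf; split; first exact: spectral_graph_exists memJ oe f Hf.
by move=> g; split; apply (spectral_graph_transfer memJ memJ' lamE oe oe' cross span span').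
Qed.
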